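(* Let $C>0$ and an integer $\ell\ge 3$ be fixed, and let $p=p(n)>0$ be any function of $n$. Let $(G_n)$ be a sequence of graphs with $|G_n|=n$ satisfying the following three conditions: (1) $\sup_n s_p(F,G_n)<\infty$ for each finite tree $F$; (2) $\displaystyle\sum_{u}\sum_{v\ne u}p_{\ell-1}(u,v)^2=O\bigl(n^{2\ell-2}p^{2\ell-2}\bigr)$; (3) for each fixed integer $k\ge1$, $\displaystyle\sum_{u}\sum_{v\ne u}p_{\ell}(u,v)^k=O\bigl(n^{2+k(\ell-1)}p^{k\ell}\bigr)$; where the sums are over vertices $u,v$ of $G_n$ and the implied constants do not depend on $n$. Suppose also that $d_{\mathrm{cut}}(G_n,\kappa)\to0$ for some kernel $\kappa:[0,1]^2\to[0,C]$. Then $s_p(F,G_n)\to s(F,\kappa)$ as $n\to\infty$ for each $F\in\mathcal{F}_\ell$.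
   Context: Graphs are finite and simple unless stated otherwise; $|G|$ and $e(G)$ are the numbers of vertices and edges. A sequence $(G_n)$ with $|G_n|=n$, $V(G_n)=\{1,\dots,n\}$, need only be defined for $n$ in an infinite subset of $\mathbb{N}$; limits are along that subset. $\mathrm{emb}(F,G)$ is the number of injective homomorphisms from $F$ to $G$, and for $|G|=n\ge|F|$, $s_p(F,G)=\mathrm{emb}(F,G)/(p^{e(F)}n_{(|F|)})$, where $p=p(n)$ and $n_{(k)}=n(n-1)\cdots(n-k+1)$; $s_p(F,G)=0$ if $|F|>|G|$. For vertices $u,v$ of $G_n$, $p_t(u,v)$ is the number of paths (with no repeated vertices) of length $t$, i.e. with $t$ edges, from $u$ to $v$ in $G_n$. For $\ell\ge 2$, $\mathcal{F}_\ell$ is the set of (isomorphism classes of) simple graphs obtained from a finite loopless multigraph by subdividing each edge exactly $\ell-1$ times. A kernel is a symmetric measurable function $\kappa:[0,1]^2\to[0,\infty)$. For a graph $F$ with vertex set $\{1,\dots,k\}$, $s(F,\kappa)=\int_{[0,1]^k}\prod_{ij\in E(F)}\kappa(x_i,x_j)\,dx_1\cdots dx_k$. The cut norm of an integrable $W:[0,1]^2\to\mathbb{R}$ is $\|W\|_{\mathrm{cut}}=\sup_{S,T}\left|\int_{S\times T}W(x,y)\,dx\,dy\right|$, the supremum being over measurable $S,T\subset[0,1]$. For kernels, $d_{\mathrm{cut}}(\kappa_1,\kappa_2)=\inf_\tau\|\kappa_1-\kappa_2^{(\tau)}\|_{\mathrm{cut}}$, where $\tau$ runs over measure-preserving bijections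 $[0,1]\to[0,1]$ and $\kappa^{(\tau)}(x,y)=\kappa(\tau(x),\tau(y))$. To a graph $G$ with vertex set $\{1,\dots,n\}$ associate the kernel $\kappa_G$ equal to $1/p(n)$ on $((i-1)/n,i/n]\times((j-1)/n,j/n]$ whenever $ij\in E(G)$, and $0$ elsewhere; $d_{\mathrm{cut}}(G,\kappa)$ means $d_{\mathrm{cut}}(\kappa_G,\kappa)$. *)

(* Defs.v *)
From HB Require Import structures.
From mathcomp Require Import all_boot all_order all_algebra.
From mathcomp Require Import all_classical all_reals all_analysis.
Set Implicit Arguments.
Unset Strict Implicit.
Unset Printing Implicit Defensive.
Import Order.TTheory GRing.Theory Num.Theory.
Import numFieldNormedType.Exports.
Local Open Scope ring_scope.

Record sgraph (V : finType) := SGraph {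
  edge :> rel V ;
  edge_sym : symmetric edge ;
  edge_irrefl : irreflexive edge }.

Definition edges (V : finType) (G : sgraph V) : {set {set V}} :=
  [set [set uv.1; uv.2] | uv : V * V & edge G uv.1 uv.2].

Definition is_tree (V : finType) (G : sgraph V) : Prop :=
  [/\ (0 < #|V|)%N,
      (forall u v : V, connect (edge G) u v) &
      (forall c : seq V, (2 < size c)%N -> ~ ucycle (edge G) c)].

Definition isomorphic (V W : finType) (F : sgraph V) (G : sgraph W) : Prop :=
  exists2 f : V -> W, bijective f & forall u v, edge F u v = edge G (f u) (f v).

(* Each edge is listed with an (irrelevant) choice of order of its two ends. *)
Record multigraph (V E : finType) := MultiGraph {
  ends : E -> V * V ;
  ends_loopless : forall a : E, (ends a).1 != (ends a).2 }.

Section Subdivision.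
Variables (V E : finType) (H : multigraph V E) (l : nat).

(* The i-th vertex (0 <= i <= l) of the path with l edges replacing the edge a:
   inr (a, j) is the (j+1)-st of the l-1 new vertices inserted in a. *)
Definition subdiv_vertex (a : E) (i : nat) : V + E * 'I_l.-1 :=
  if i is i'.+1 then
    if insub i' is Some j then inr (a, j) else inl (ends H a).2
  else inl (ends H a).1.

Definition subdiv_rel : rel (V + E * 'I_l.-1)%type := fun u v =>
  [exists a : E, [exists i : 'I_l,
    ((u == subdiv_vertex a i) && (v == subdiv_vertex a i.+1)) ||
    ((v == subdiv_vertex a i) && (u == subdiv_vertex a i.+1))]].

Lemma subdiv_sym : symmetric subdiv_rel.
Proof.
by move=> u v; apply: eq_existsb => a; apply: eq_existsb => i; rewrite orbC.
Qed.

Lemma subdiv_vertexS_neq (a : E) (i : nat) : (i < l)%N ->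
  subdiv_vertex a i != subdiv_vertex a i.+1.
Proof.
case: i => [|i] /= il.
  by case: insubP => //= _; apply: contra_neq (ends_loopless H a) => -[].
case: insubP => [j _ ji|]; last by rewrite -ltnS (ltn_predK il) il.
case: insubP => [k _ ki|//]; apply/eqP => -[jk].
by move: ji; rewrite jk ki => /esym/n_Sn.
Qed.

Lemma subdiv_irrefl : irreflexive subdiv_rel.
Proof.
move=> u; apply/negbTE/negP => /existsP[a] /existsP[i].
move=> /orP[] /andP[/eqP e1 /eqP e2];
  by have /eqP[] := subdiv_vertexS_neq a (ltn_ord i); rewrite -e1 -e2.
Qed.

Definition subdivision : sgraph (V + E * 'I_l.-1)%type :=
  SGraph subdiv_sym subdiv_irrefl.

End Subdivision.

Definition subdivided_class (l : nat) (V : finType) (F : sgraph V) : Prop :=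
  exists (W E : finType) (H : multigraph W E), isomorphic F (subdivision H l).

Definition emb (V W : finType) (F : sgraph V) (G : sgraph W) : nat :=
  #|[set f : {ffun V -> W} | injectiveb f &
      [forall u, forall v, edge F u v ==> edge G (f u) (f v)]]|.

(* For u != v, such a path is determined by its vertices after u. *)
Definition npaths (V : finType) (G : sgraph V) (t : nat) (u v : V) : nat :=
  #|[set w : t.-tuple V | [&& path (edge G) u w, uniq (u :: w) & last u w == v]]|.

Local Open Scope classical_set_scope.

Section Densities.
Context {R : realType}.
Local Notation mu := (@lebesgue_measure R).

Definition emb_density (p : R) (V W : finType) (F : sgraph V) (G : sgraph W) : R :=
  if (#|V| <= #|W|)%N then
    (emb F G)%:R / (p ^+ #|edges F| * (#|W| ^_ #|V|)%:R)
  else 0.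

Definition unit_itv : set R := `[0, 1]%classic.

Lemma measurable_unit_itv : measurable unit_itv.
Proof. exact: measurable_itv. Qed.

(* A function on [0,1]^2 is represented by a function on R * R whose values
   outside the unit square are never used. *)
Definition is_kernel (k : R * R -> R) : Prop :=
  [/\ measurable_fun (unit_itv `*` unit_itv) k,
      (forall x y, unit_itv x -> unit_itv y -> k (x, y) = k (y, x)) &
      (forall x y, unit_itv x -> unit_itv y -> 0 <= k (x, y))].

(* Lebesgue measure on [0,1], as a probability on the measurable space R: the
   library states lebesgue_measure on the alias measurableTypeR R of R. *)
Definition lebesgue01 (A : set R) : \bar R := mrestr mu measurable_unit_itv A.

Lemma lebesgue01_0 : lebesgue01 set0 = 0%E.
Proof. exact: (measure0 (mrestr mu measurable_unit_itv)). Qed.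

Lemma lebesgue01_ge0 A : (0 <= lebesgue01 A)%E.
Proof. exact: (measure_ge0 (mrestr mu measurable_unit_itv)). Qed.

Lemma lebesgue01_sigma_additive : semi_sigma_additive lebesgue01.
Proof.
exact: (@measure_semi_sigma_additive _ _ _ (mrestr mu measurable_unit_itv)).
Qed.

HB.instance Definition _ := isMeasure.Build _ _ _ lebesgue01
  lebesgue01_0 lebesgue01_ge0 lebesgue01_sigma_additive.

Lemma lebesgue01_setT : lebesgue01 [set: R] = 1%E.
Proof.
by rewrite /lebesgue01 /mrestr setTI lebesgue_measure_itv/= lte_fin ltr01 sube0.
Qed.

HB.instance Definition _ :=
  Measure_isProbability.Build _ _ _ lebesgue01 lebesgue01_setT.

Definition cons_tuple k (xt : R * k.-tuple R) : k.+1.-tuple R :=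
  [tuple of xt.1 :: xt.2].

Lemma measurable_cons_tuple k : measurable_fun [set: R * k.-tuple R] (@cons_tuple k).
Proof. exact: (measurable_cons measurable_fst measurable_snd). Qed.

HB.instance Definition _ k :=
  isMeasurableFun.Build _ _ _ _ (@cons_tuple k) (@measurable_cons_tuple k).

Fixpoint cube_measure (k : nat) : probability (k.-tuple R) R :=
  if k is k'.+1 then distribution (lebesgue01 \x cube_measure k')%E (@cons_tuple k')
  else \d_[tuple].

Definition unit_cube (k : nat) : set (k.-tuple R) :=
  [set x | forall i, unit_itv (tnth x i)].

Definition kernel_density (k : nat) (F : sgraph 'I_k) (ka : R * R -> R) : \bar R :=
  (\int[cube_measure k]_(x in @unit_cube k)
    (\prod_(i < k) \prod_(j < k | (i < j)%N && edge F i j)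
       ka (tnth x i, tnth x j))%:E)%E.

Definition cut_norm (W : R * R -> R) : \bar R :=
  ereal_sup [set r | exists S T : set R,
    [/\ measurable S, measurable T, S `<=` unit_itv, T `<=` unit_itv &
        r = `| \int[(lebesgue01 \x lebesgue01)%E]_(z in S `*` T) (W z)%:E |%E]].

Definition mp_bijection (tau : R -> R) : Prop :=
  [/\ set_bij unit_itv unit_itv tau,
      measurable_fun unit_itv tau &
      forall A : set R, measurable A -> A `<=` unit_itv ->
        mu (unit_itv `&` tau @^-1` A) = mu A].

Definition d_cut (k1 k2 : R * R -> R) : \bar R :=
  ereal_inf [set cut_norm (fun z => k1 z - k2 (tau z.1, tau z.2)) |
               tau in mp_bijection].

(* Vertex i : 'I_n, counted from 0, owns the interval (i/n, (i+1)/n]. *)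
Definition graph_kernel (p : R) (n : nat) (G : sgraph 'I_n) (z : R * R) : R :=
  if [exists i : 'I_n, [exists j : 'I_n,
        [&& edge G i j,
            z.1 \in `](i%:R / n%:R), (i.+1%:R / n%:R)] &
            z.2 \in `](j%:R / n%:R), (j.+1%:R / n%:R)]]]]
  then p^-1 else 0.

End Densities.

(* Main.v *)
From HB Require Import structures.
Require Import Defs.
From mathcomp Require Import all_boot all_order all_algebra.
From mathcomp Require Import all_classical all_reals all_analysis.
From mathcomp Require Import measurable_realfun.
From mathcomp Require Import ring lra zify.

(** Write a = A / p for the scaled adjacency matrix of the graph, and let K be the average
    of the suitably relabelled limit kernel over the cells of the n by n grid. Then K takes
    values in [0, C], a - K is small in cut norm (cut_bound_cell_avg), and by the counting
    lemma for bounded kernels (counting) the density of every graph in K is close to its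
    density in the limit. It remains to compare a with K on a fixed finite vertex set.

    Colour the vertices of the graph by the vertices of F, and keep only the maps that send
    every vertex of F into its own colour class. Such maps are injective, and every
    injective map is kept by the same proportion of all colourings (avg_sum_compatible);
    hence it suffices to treat each colouring separately. With a colouring fixed, the paths
    that replace the edges of H cannot meet, and the number of kept maps is a sum over the
    images of the vertices of H of a product over the edges of H of the entries of chains
    a 1_V1 a 1_V2 ... a with l factors a (sum_compatible). An entry is at most the
    normalised number of paths of length l between two vertices (chain_le_path_density), so
    all its moments are bounded by the third hypothesis on the graphs, and products of such
    entries are determined by the entries up to small L1 errors (prod_avg_close). This is
    why the edges of H may be parallel.

    The chain in a is close to the chain in K in L1 (chain_close). In the difference of the
    first links, a - K acts on chains of length l - 1, bounded in L2 by the second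
    hypothesis. Cut off at a high level they are bounded functions, on which a kernel that
    is small in cut norm acts as an operator that is small in L1 (cut_bound_L1); the part
    above the level is controlled by the moments of the degrees. Once K stands in front,
    each later link is exchanged in the same way, now with the bounded function on the left
    of the link and with the number of walks on its right (comp_chain_close). The moments
    of the degrees come from the star counts, which are tree counts, and walks are no more
    frequent than stars (degree_walks_le).

    Moments of the degrees are related to star counts only if n p >= 1. If n p < 1, the
    third hypothesis for k = 2 makes paths of length l rare, because the number of paths
    between two vertices is at most its own square, and K itself is small (sparse_small);
    so both chains are close to 0 (coloured_chain_close). *)

Set Implicit Arguments.
Unset Strict Implicit.
Unset Printing Implicit Defensive.
Import Order.TTheory GRing.Theory Num.Theory.
Import numFieldNormedType.Exports.
Local Open Scope ring_scope.

(** * Averages and uniform integrability *)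

Section Averages.
Variable R : realFieldType.

Definition avg (T : finType) (f : T -> R) : R := (\sum_x f x) / #|T|%:R.

Variable T : finType.
Implicit Types f g : T -> R.

Lemma eq_avg f g : f =1 g -> avg f = avg g.
Proof. by move=> fg; rewrite /avg (eq_bigr g). Qed.

Lemma ler_avg f g : (forall x, f x <= g x) -> avg f <= avg g.
Proof. by move=> fg; rewrite ler_wpM2r ?invr_ge0// ler_sum. Qed.

Lemma avg_ge0 f : (forall x, 0 <= f x) -> 0 <= avg f.
Proof. by move=> f0; rewrite divr_ge0// sumr_ge0. Qed.

Lemma avgD f g : avg (fun x => f x + g x) = avg f + avg g.
Proof. by rewrite /avg big_split mulrDl. Qed.

Lemma avgN f : avg (fun x => - f x) = - avg f.
Proof. by rewrite /avg sumrN mulNr. Qed.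

Lemma avgB f g : avg (fun x => f x - g x) = avg f - avg g.
Proof. by rewrite avgD avgN. Qed.

Lemma avgZl c f : avg (fun x => c * f x) = c * avg f.
Proof. by rewrite /avg -mulr_sumr mulrA. Qed.

Lemma avgZr c f : avg (fun x => f x * c) = avg f * c.
Proof. by rewrite /avg -mulr_suml mulrAC. Qed.

Lemma ler_avg_cst c f : 0 <= c -> (forall x, f x <= c) -> avg f <= c.
Proof.
move=> c0 fc; apply: (le_trans (ler_avg fc)).
rewrite /avg sumr_const -[c *+ _]mulr_natr -mulrA.
have [->|T0] := eqVneq (#|T|%:R : R) 0; first by rewrite mul0r mulr0.
by rewrite divff ?mulr1.
Qed.

Lemma avg_cst c : (0 < #|T|)%N -> avg (fun _ : T => c) = c.
Proof.
move=> T0; rewrite /avg sumr_const -[c *+ _]mulr_natr -mulrA divff ?mulr1//.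
by rewrite pnatr_eq0 -lt0n.
Qed.

Lemma ler_norm_avg f : `|avg f| <= avg (fun x => `|f x|).
Proof.
by rewrite /avg normrM normfV normr_nat ler_wpM2r ?invr_ge0// ler_norm_sum.
Qed.

End Averages.

Lemma exchange_avg (R : realFieldType) (T U : finType) (f : T -> U -> R) :
  avg (fun x => avg (f x)) = avg (fun y => avg (fun x => f x y)).
Proof. by rewrite /avg -!mulr_suml exchange_big/= -!mulrA [_^-1 * _]mulrC. Qed.

Lemma avg_pair (R : realFieldType) (T U : finType) (f : T * U -> R) :
  avg f = avg (fun x => avg (fun y => f (x, y))).
Proof.
rewrite /avg -mulr_suml -mulrA; congr (_ * _).
  by rewrite [RHS]pair_bigA/=; apply: eq_bigr => -[].
by rewrite card_prod natrM invfM mulrC.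
Qed.

Section Integrability.
Variable R : realFieldType.
Implicit Types eps H W : R.

(** Uniform integrability: a bounded third moment lets a small mean of f pass to the
    mean of f ^ 2, which absorbs any factor bounded in mean square. *)
Lemma avg_mul_small eps H W : 0 < eps -> 0 <= H -> 0 <= W ->
  exists2 delta, 0 < delta & forall (T : finType) (f g : T -> R),
    (forall x, 0 <= f x) ->
    avg f <= delta -> avg (fun x => f x ^+ 3) <= H -> avg (fun x => g x ^+ 2) <= W ->
    avg (fun x => f x * g x) <= eps.
Proof.
move=> e0 H0 W0; pose lam := eps / (3 * (W + 1)).
have l0 : 0 < lam by rewrite divr_gt0// mulr_gt0//; lra.
pose mu := lam * (eps / (3 * (H + 1))).
have m0 : 0 < mu by rewrite mulr_gt0// divr_gt0// mulr_gt0//; lra.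
have li : 0 < lam^-1 by rewrite invr_gt0.
have mi : 0 < mu^-1 by rewrite invr_gt0.
exists (lam * mu * (eps / 3)) => [|T f g f0 fd fH gW].
  by apply: mulr_gt0; [apply: mulr_gt0 | apply: divr_gt0].
(* f g <= lam g^2 + f^2 / lam and f^2 <= mu f^3 + f / mu; lam, then mu, then delta are
   chosen so that each of the three resulting terms contributes at most eps / 3 *)
have pw x : f x * g x <= lam * g x ^+ 2 + lam^-1 * mu * f x ^+ 3 + lam^-1 * mu^-1 * f x.
  have h1 : f x * g x <= lam * g x ^+ 2 + lam^-1 * f x ^+ 2.
    rewrite -subr_ge0.
    have -> : lam * g x ^+ 2 + lam^-1 * f x ^+ 2 - f x * g x =
        lam^-1 * ((lam * g x - f x / 2) ^+ 2 + 3 / 4 * f x ^+ 2).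
      by field; rewrite gt_eqF.
    by apply: mulr_ge0; [exact: ltW | rewrite addr_ge0 ?sqr_ge0// mulr_ge0 ?sqr_ge0//; lra].
  have h2 : f x ^+ 2 <= mu * f x ^+ 3 + mu^-1 * f x.
    rewrite -subr_ge0.
    have -> : mu * f x ^+ 3 + mu^-1 * f x - f x ^+ 2 =
        mu^-1 * f x * ((mu * f x - 1 / 2) ^+ 2 + 3 / 4).
      by field; rewrite gt_eqF.
    by apply: mulr_ge0; [apply: mulr_ge0 => //; exact: ltW | rewrite addr_ge0 ?sqr_ge0//; lra].
  apply: (le_trans h1); rewrite -addrA lerD2l -[_ * mu * _]mulrA -[_ * mu^-1 * _]mulrA -mulrDr.
  by apply: ler_wpM2l => //; exact: ltW.
apply: (le_trans (ler_avg pw)); rewrite !avgD !avgZl.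
have -> : eps = eps / 3 + eps / 3 + eps / 3 by field.
apply: lerD; [apply: lerD|].
- apply: (@le_trans _ _ (lam * (W + 1))); first by apply: ler_wpM2l; [exact: ltW | lra].
  rewrite le_eqVlt; apply/orP; left; apply/eqP; rewrite /lam; field; lra.
- apply: (@le_trans _ _ (lam^-1 * mu * (H + 1))).
    by apply: ler_wpM2l; [rewrite mulr_ge0 ?ltW | lra].
  rewrite le_eqVlt; apply/orP; left; apply/eqP; rewrite /mu; field.
  by rewrite gt_eqF//=; lra.
- apply: (@le_trans _ _ (lam^-1 * mu^-1 * (lam * mu * (eps / 3)))).
    by apply: ler_wpM2l => //; rewrite mulr_ge0 ?ltW.
  rewrite le_eqVlt; apply/orP; left; apply/eqP; field.
  by rewrite !gt_eqF.
Qed.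

(** Where g exceeds a high level B, the factor g / B >= 1 can be inserted for free, so
    that moments of f and g of slightly higher order decide. *)
Lemma avg_tail_small eps H W : 0 < eps -> 0 <= H -> 0 <= W ->
  exists2 B, 0 < B & forall (T : finType) (f g : T -> R),
    (forall x, 0 <= f x) -> (forall x, 0 <= g x) ->
    avg (fun x => f x ^+ 4) <= H -> avg (fun x => g x ^+ 2) <= W ->
    avg (fun x => f x * (g x * (B < g x)%R%:R)) <= eps.
Proof.
move=> e0 H0 W0; pose lam := eps / (2 * (W + 1)).
have l0 : 0 < lam by rewrite divr_gt0// mulr_gt0//; lra.
pose b := lam * (eps / (2 * (H + W + 1))).
have b0 : 0 < b by rewrite mulr_gt0// divr_gt0// mulr_gt0//; lra.
have li : 0 < lam^-1 by rewrite invr_gt0.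
exists b^-1 => [|T f g f0 g0 fH gW]; first by rewrite invr_gt0.
have pw x : f x * (g x * (b^-1 < g x)%R%:R) <=
    lam * g x ^+ 2 + lam^-1 * b * (f x ^+ 4 + g x ^+ 2).
  have := f0 x; have := g0 x; move: (f x) (g x) => u v v0 u0.
  case: ltP => [vb|_]; last first.
    have u4 : 0 <= u ^+ 4 + v ^+ 2 by rewrite addr_ge0 ?sqr_ge0 ?exprn_even_ge0.
    have lb : 0 <= lam^-1 * b by rewrite mulr_ge0 ?ltW.
    by rewrite !mulr0; apply: addr_ge0; apply: mulr_ge0 => //; rewrite ?sqr_ge0 ?ltW.
  rewrite mulr1.
  have h1 : u * v <= lam * v ^+ 2 + lam^-1 * u ^+ 2.
    rewrite -subr_ge0.
    have -> : lam * v ^+ 2 + lam^-1 * u ^+ 2 - u * v =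
        lam^-1 * ((lam * v - u / 2) ^+ 2 + 3 / 4 * u ^+ 2).
      by field; rewrite gt_eqF.
    by apply: mulr_ge0; [exact: ltW | rewrite addr_ge0 ?sqr_ge0// mulr_ge0 ?sqr_ge0//; lra].
  apply: (le_trans h1); rewrite lerD2l -mulrA; apply: ler_wpM2l; first exact: ltW.
  have h2 : 1 <= b * v.
    by rewrite -(@ler_pM2l _ b^-1) ?invr_gt0// mulr1 mulrA mulVf ?gt_eqF// mul1r ltW.
  have h3 : u ^+ 2 <= u ^+ 2 * (b * v) by rewrite ler_peMr ?sqr_ge0.
  apply: (le_trans h3); rewrite mulrCA; apply: ler_wpM2l; first exact: ltW.
  rewrite -subr_ge0.
  have -> : u ^+ 4 + v ^+ 2 - u ^+ 2 * v = (u ^+ 2 - v / 2) ^+ 2 + 3 / 4 * v ^+ 2.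
    by field.
  by rewrite addr_ge0 ?sqr_ge0// mulr_ge0 ?sqr_ge0//; lra.
apply: (le_trans (ler_avg pw)); rewrite !avgD !avgZl avgD.
have -> : eps = eps / 2 + eps / 2 by field.
apply: lerD.
- apply: (@le_trans _ _ (lam * (W + 1))); first by apply: ler_wpM2l; [exact: ltW | lra].
  rewrite le_eqVlt; apply/orP; left; apply/eqP; rewrite /lam; field; lra.
- apply: (@le_trans _ _ (lam^-1 * b * (H + W + 1))).
    by apply: ler_wpM2l; [rewrite mulr_ge0 ?ltW | lra].
  rewrite le_eqVlt; apply/orP; left; apply/eqP; rewrite /b; field.
  by rewrite gt_eqF//=; lra.
Qed.

(** As avg_mul_small, when only a joint moment of the two factors is known. *)
Lemma avg_mul_small_weighted eps Q : 0 < eps -> 0 <= Q ->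
  exists2 delta, 0 < delta & forall (T : finType) (f g : T -> R),
    (forall x, 0 <= f x) -> avg f <= delta ->
    avg (fun x => f x * g x ^+ 2) <= Q -> avg (fun x => f x * g x) <= eps.
Proof.
move=> e0 Q0; pose b := eps / (2 * (Q + 1)).
have b0 : 0 < b by rewrite divr_gt0// mulr_gt0//; lra.
exists (b * (eps / 2)) => [|T f g f0 fd fQ]; first by apply: mulr_gt0 => //; apply: divr_gt0.
have pw x : f x * g x <= b^-1 * f x + b * (f x * g x ^+ 2).
  rewrite -subr_ge0.
  have -> : b^-1 * f x + b * (f x * g x ^+ 2) - f x * g x =
      b^-1 * f x * ((b * g x - 1 / 2) ^+ 2 + 3 / 4).
    by field; rewrite gt_eqF.
  by apply: mulr_ge0; [rewrite mulr_ge0// invr_ge0 ltW | rewrite addr_ge0 ?sqr_ge0//; lra].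
apply: (le_trans (ler_avg pw)); rewrite !avgD !avgZl.
have -> : eps = eps / 2 + eps / 2 by field.
apply: lerD.
  by rewrite mulrC ler_pdivrMr// mulrC.
apply: (@le_trans _ _ (b * (Q + 1))); first by apply: ler_wpM2l; [exact: ltW | lra].
rewrite le_eqVlt; apply/orP; left; apply/eqP; rewrite /b; field; lra.
Qed.

End Integrability.

(** * The cut norm and walks on a finite vertex set *)

Section Kernels.
Variables (R : realFieldType) (T : finType).
Implicit Types (W : T -> T -> R) (f g : T -> R).

Definition cut_bound (delta : R) W := forall S S' : pred T,
  `|avg (fun x => avg (fun y => (S x)%:R * W x y * (S' y)%:R))| <= delta.

Lemma cut_bound_ge0 delta W : cut_bound delta W -> 0 <= delta.
Proof. by move=> /(_ pred0 pred0); apply: le_trans. Qed.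

(** The extreme choices of a weight with values in [0, B] are multiples of
    indicators, so that only sets have to be tested. *)
Lemma cut_bound_weight delta B W (S : pred T) g : cut_bound delta W -> 0 <= B ->
  (forall y, 0 <= g y <= B) ->
  `|avg (fun x => avg (fun y => (S x)%:R * W x y * g y))| <= B * delta.
Proof.
move=> cutW B0 gB; pose phi y := avg (fun x => (S x)%:R * W x y).
have swap h : avg (fun x => avg (fun y => (S x)%:R * W x y * h y)) =
    avg (fun y => phi y * h y).
  by rewrite exchange_avg; apply: eq_avg => y; rewrite -avgZr.
have cutphi (S' : pred T) : `|avg (fun y => phi y * (S' y)%:R)| <= delta.
  by rewrite -swap; exact: cutW.
rewrite swap ler_norml; apply/andP; split.
  have /ler_normlP[h _] := cutphi [pred y | phi y <= 0].
  rewrite lerNl; apply: (@le_trans _ _ (B * - avg (fun y => phi y * (phi y <= 0)%R%:R))).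
    rewrite -!avgN -avgZl; apply: ler_avg => y.
    have /andP[g0 gb] := gB y; case: (leP (phi y) 0) => p0.
      by rewrite mulr1; nra.
    by rewrite mulr0 oppr0 mulr0; nra.
  by apply: ler_wpM2l.
have /ler_normlP[_ h] := cutphi [pred y | 0 < phi y].
apply: (@le_trans _ _ (B * avg (fun y => phi y * (0 < phi y)%R%:R))).
  rewrite -avgZl; apply: ler_avg => y.
  have /andP[g0 gb] := gB y; case: (ltP 0 (phi y)) => p0.
    by rewrite mulr1; nra.
  by rewrite !mulr0; nra.
by apply: ler_wpM2l.
Qed.

(** Splitting T by the sign of the image of g turns the L1 norm of this image into two
    tests of W. *)
Lemma cut_bound_L1 delta B W g : cut_bound delta W -> 0 <= B ->
  (forall y, 0 <= g y <= B) ->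
  avg (fun x => `|avg (fun y => W x y * g y)|) <= 2 * B * delta.
Proof.
move=> cutW B0 gB; pose phi x := avg (fun y => W x y * g y).
have cutphi (S : pred T) : `|avg (fun x => (S x)%:R * phi x)| <= B * delta.
  apply: le_trans (cut_bound_weight S cutW B0 gB).
  rewrite le_eqVlt; apply/orP; left; apply/eqP; congr (`| _ |).
  by apply: eq_avg => x; rewrite -avgZl; apply: eq_avg => y; rewrite mulrA.
have /ler_normlP[_ h1] := cutphi [pred x | 0 <= phi x].
have /ler_normlP[h2 _] := cutphi [pred x | phi x < 0].
have -> : avg (fun x => `|phi x|) =
    avg (fun x => (0 <= phi x)%R%:R * phi x) - avg (fun x => (phi x < 0)%R%:R * phi x).
  rewrite -avgB; apply: eq_avg => x; case: (leP 0 (phi x)) => p0.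
    by rewrite ger0_norm// mul1r mul0r subr0.
  by rewrite ltr0_norm// mul0r mul1r sub0r.
by rewrite mulrAC mulr_natl mulr2n mulrC; move: h1 h2 => /=; lra.
Qed.

End Kernels.

Section Walks.
Variables (R : realFieldType) (T : finType) (a : T -> T -> R).
Hypothesis a_ge0 : forall x y, 0 <= a x y.
Hypothesis a_sym : forall x y, a x y = a y x.
Implicit Types f g : T -> R.

Definition kernel_op f x : R := avg (fun y => a x y * f y).
Definition degree x : R := avg (a x).
Definition walks t : T -> R := iter t kernel_op (fun=> 1).

Lemma degree_ge0 x : 0 <= degree x.
Proof. exact: avg_ge0. Qed.

Lemma kernel_op_le f g : (forall x, f x <= g x) -> forall x, kernel_op f x <= kernel_op g x.
Proof. by move=> fg x; apply: ler_avg => y; rewrite ler_wpM2l. Qed.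

Lemma iter_kernel_op_le t f g : (forall x, f x <= g x) ->
  forall x, iter t kernel_op f x <= iter t kernel_op g x.
Proof. by elim: t => [//|t IH] fg; apply: kernel_op_le; exact: IH. Qed.

Lemma eq_iter_kernel_op t f g : f =1 g -> iter t kernel_op f =1 iter t kernel_op g.
Proof.
move=> fg; elim: t => [//|t IH] x /=; apply: eq_avg => y; by rewrite IH.
Qed.

Lemma iter_kernel_op_affine t c f g x :
  iter t kernel_op (fun y => c * f y + g y) x =
  c * iter t kernel_op f x + iter t kernel_op g x.
Proof.
elim: t x => [//|t IH] x /=; rewrite /kernel_op -avgZl -avgD.
by apply: eq_avg => y; rewrite IH; ring.
Qed.

Lemma kernel_op_adjoint f g :
  avg (fun x => f x * kernel_op g x) = avg (fun x => kernel_op f x * g x).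
Proof.
transitivity (avg (fun x => avg (fun y => f x * a x y * g y))).
  by apply: eq_avg => x; rewrite -avgZl; apply: eq_avg => y; rewrite mulrA.
rewrite exchange_avg; apply: eq_avg => y.
by rewrite -avgZr; apply: eq_avg => x; rewrite a_sym [f x * _]mulrC.
Qed.

Lemma iter_kernel_op_adjoint t f g :
  avg (fun x => f x * iter t kernel_op g x) = avg (fun x => iter t kernel_op f x * g x).
Proof.
elim: t f => [//|t IH] f; rewrite iterS kernel_op_adjoint IH.
by apply: eq_avg => x; rewrite -iterSr.
Qed.

(** A pointwise Young inequality f(x) g(y) <= f'(x) + g'(y) survives integration against
    any number of steps of a, because these have nonnegative kernels. *)
Lemma iter_kernel_op_young t f g f' g' :
  (forall x y, f x * g y <= f' x + g' y) ->
  avg (fun x => f x * iter t kernel_op g x) <=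
  avg (fun x => f' x * iter t kernel_op (fun=> 1) x) + avg (fun x => iter t kernel_op g' x).
Proof.
move=> fg; rewrite -avgD; apply: ler_avg => x.
have := iter_kernel_op_affine t (f x) g (fun=> 0) x.
have -> : iter t kernel_op (fun=> 0) x = 0.
  elim: t x => [//|t IH] x /=; rewrite /kernel_op -[RHS](mul0r (degree x)) -avgZl.
  by apply: eq_avg => y; rewrite IH; ring.
rewrite addr0 => <-; rewrite -iter_kernel_op_affine; apply: iter_kernel_op_le => y.
by rewrite addr0 mulr1.
Qed.

(** Up to a factor 2 ^ t, walks with t edges are no more frequent than stars with as many
    edges: an end edge of a walk contributes a degree, and a product of powers of the
    degrees at two vertices is at most the sum of the powers of the same total order. *)
Lemma degree_walks_le k t :
  avg (fun x => degree x ^+ k * walks t x) <= 2 ^+ t * avg (fun x => degree x ^+ (k + t)).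
Proof.
elim: t k => [|t IH] k.
  by rewrite addn0 mul1r; apply: ler_avg => x; rewrite mulr1.
have wS x : walks t.+1 x = iter t kernel_op degree x.
  rewrite /walks iterSr; apply: eq_iter_kernel_op => y.
  by apply: eq_avg => z; rewrite mulr1.
apply: (@le_trans _ _ (2 * avg (fun x => degree x ^+ k.+1 * walks t x))); last first.
  by rewrite exprS -mulrA ler_pM2l// addnS -addSn; exact: IH.
have -> : avg (fun x => degree x ^+ k * walks t.+1 x) =
    avg (fun x => degree x ^+ k * iter t kernel_op degree x).
  by apply: eq_avg => x; rewrite wS.
have young (u v : R) : 0 <= u -> 0 <= v -> u ^+ k * v <= u ^+ k.+1 + v ^+ k.+1.
  move=> u0 v0; case: (leP u v) => uv.
    apply: (@le_trans _ _ (v ^+ k.+1)); last by rewrite lerDr exprn_ge0.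
    by rewrite exprSr ler_wpM2r// lerXn2r.
  apply: (@le_trans _ _ (u ^+ k.+1)); last by rewrite lerDl exprn_ge0.
  by rewrite exprSr ler_wpM2l ?exprn_ge0// ltW.
apply: le_trans (iter_kernel_op_young t
  (fun x y => young _ _ (degree_ge0 x) (degree_ge0 y))) _.
have -> : avg (fun x => iter t kernel_op (fun y => degree y ^+ k.+1) x) =
    avg (fun x => degree x ^+ k.+1 * walks t x).
  transitivity (avg (fun x => 1 * iter t kernel_op (fun y => degree y ^+ k.+1) x)).
    by apply: eq_avg => x; rewrite mul1r.
  by rewrite iter_kernel_op_adjoint; apply: eq_avg => x; rewrite mulrC.
by rewrite mulr_natl mulr2n.
Qed.

(** By symmetry, two walks from the same vertex form one walk of double length. *)
Lemma walks_sqr_le t :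
  avg (fun x => walks t x ^+ 2) <= 2 ^+ (t + t) * avg (fun x => degree x ^+ (t + t)).
Proof.
have -> : avg (fun x => walks t x ^+ 2) = avg (fun x => degree x ^+ 0 * walks (t + t) x).
  transitivity (avg (fun x => walks t x * iter t kernel_op (fun=> 1) x)).
    by apply: eq_avg => x; rewrite expr2.
  rewrite iter_kernel_op_adjoint; apply: eq_avg => x.
  by rewrite expr0 mul1r mulr1 /walks iterD.
exact: degree_walks_le.
Qed.

End Walks.

(** * Chains of kernels *)

Section Chains.
Variables (R : realFieldType) (T : finType).
Implicit Types (W A B : T -> T -> R) (V : pred T) (s : seq (pred T)).

Definition norm1 W := avg (fun x => avg (fun y => `|W x y|)).

Definition comp A B x y : R := avg (fun z => A x z * B z y).

Fixpoint chain W s : T -> T -> R :=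
  if s is V :: s' then comp (fun x z => W x z * (V z)%:R) (chain W s') else W.

Lemma eq_norm1 W W' : (forall x y, W x y = W' x y) -> norm1 W = norm1 W'.
Proof. by move=> e; apply: eq_avg => x; apply: eq_avg => y; rewrite e. Qed.

Lemma ler_norm1 W W' : (forall x y, `|W x y| <= `|W' x y|) -> norm1 W <= norm1 W'.
Proof. by move=> e; apply: ler_avg => x; apply: ler_avg => y. Qed.

Lemma norm1D W W' : norm1 (fun x y => W x y + W' x y) <= norm1 W + norm1 W'.
Proof.
rewrite /norm1 -avgD; apply: ler_avg => x; rewrite -avgD.
by apply: ler_avg => y; exact: ler_normD.
Qed.

Lemma chain_ge0 W s : (forall x y, 0 <= W x y) -> forall x y, 0 <= chain W s x y.
Proof.
move=> W0; elim: s => [|V s IH] x y /=; first exact: W0.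
by apply: avg_ge0 => z; rewrite !mulr_ge0.
Qed.

Lemma chain_le C W s : 0 <= C -> (forall x y, 0 <= W x y <= C) ->
  forall x y, chain W s x y <= C ^+ (size s).+1.
Proof.
move=> C0 WC; have W0 x y : 0 <= W x y by case/andP: (WC x y).
elim: s => [|V s IH] x y; first by case/andP: (WC x y).
apply: ler_avg_cst => [|z]; first by rewrite exprn_ge0.
rewrite exprS ler_pM ?mulr_ge0 ?chain_ge0//.
by rewrite (le_trans _ (proj2 (andP (WC x z))))// ler_piMr//; case: (V z).
Qed.

Lemma avg_chain_le W s x : (forall x y, 0 <= W x y) ->
  avg (chain W s x) <= walks W (size s).+1 x.
Proof.
move=> W0; elim: s x => [|V s IH] x.
  by apply: ler_avg => y; rewrite mulr1.
rewrite [walks _ _]iterS [chain _ _]/= {1}/comp exchange_avg; apply: ler_avg => z.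
rewrite avgZl -mulrA ler_wpM2l//; apply: le_trans (IH z).
by rewrite ler_piMl//; [apply: avg_ge0 => y; exact: chain_ge0 | case: (V z)].
Qed.

End Chains.

Lemma exprD_le2 (R : realFieldType) k (u v : R) : 0 <= u -> 0 <= v ->
  (u + v) ^+ k <= 2 ^+ k * (u ^+ k + v ^+ k).
Proof.
move=> u0 v0; wlog uv : u v u0 v0 / u <= v.
  move=> h; case: (leP u v) => uv; first exact: h.
  by rewrite addrC [u ^+ k + _]addrC; apply: h => //; exact: ltW.
apply: (@le_trans _ _ ((2 * v) ^+ k)).
  by rewrite lerXn2r ?nnegrE ?addr_ge0 ?mulr_ge0//; lra.
by rewrite exprMn ler_wpM2l ?exprn_ge0// lerDr exprn_ge0.
Qed.

Record cut_approx (R : realFieldType) (C delta : R) (m : nat -> R) (T : finType)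
    (a K : T -> T -> R) : Prop := CutApprox {
  approx_ge0 : forall x y, 0 <= a x y;
  approx_sym : forall x y, a x y = a y x;
  limit_bounds : forall x y, 0 <= K x y <= C;
  limit_sym : forall x y, K x y = K y x;
  approx_close : cut_bound delta (fun x y => a x y - K x y);
  approx_degree : forall k, avg (fun x => degree a x ^+ k) <= m k }.

Section ChainLimit.
Variables (R : realFieldType) (C : R) (m : nat -> R).
Hypotheses (C_ge0 : 0 <= C) (m_ge0 : forall k, 0 <= m k).

Lemma degreeC_moment delta (T : finType) (a K : T -> T -> R) k :
  cut_approx C delta m a K ->
  avg (fun x => (degree a x + C) ^+ k) <= 2 ^+ k * (m k + C ^+ k).
Proof.
move=> [a0 _ _ _ _ am].
apply: (@le_trans _ _ (avg (fun x => 2 ^+ k * (degree a x ^+ k + C ^+ k)))).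
  by apply: ler_avg => x; rewrite exprD_le2 ?degree_ge0.
rewrite avgZl ler_wpM2l ?exprn_ge0// avgD lerD//.
by apply: ler_avg_cst; rewrite ?exprn_ge0.
Qed.

(** Composition with a bounded kernel turns cut closeness into L1 closeness, and
    leaves again a bounded kernel in front of a shorter chain. *)
Lemma comp_chain_close t b eps : 0 <= b -> 0 < eps ->
  exists2 delta0, 0 < delta0 & forall delta, delta <= delta0 ->
    forall (T : finType) (a K B : T -> T -> R) s,
    cut_approx C delta m a K -> size s = t ->
    (forall x y, 0 <= B x y <= b) ->
    norm1 (fun x y => comp B (chain a s) x y - comp B (chain K s) x y) <= eps.
Proof.
elim: t b eps => [|t IH] b eps b0 e0.
  exists (eps / (2 * b + 1)) => [|delta dd T a K B s [a0 asym Kb Ksym cutaK _] /size0nil -> Bb /=].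
    by rewrite divr_gt0//; lra.
  apply: (@le_trans _ _ (2 * b * delta)); last first.
    apply: (@le_trans _ _ (2 * b * (eps / (2 * b + 1)))).
      by rewrite ler_wpM2l// mulr_ge0.
    rewrite mulrA ler_pdivrMr; [nra|lra].
  have d0 := cut_bound_ge0 cutaK.
  apply: ler_avg_cst => [|x]; first by rewrite !mulr_ge0.
  apply: le_trans (cut_bound_L1 cutaK b0 (Bb x)).
  rewrite le_eqVlt; apply/orP; left; apply/eqP.
  apply: eq_avg => y; congr (`| _ |).
  rewrite /comp -avgB; apply: eq_avg => z.
  by rewrite (asym y z) (Ksym y z); ring.
have e2 : 0 < eps / 2 by rewrite divr_gt0.
have bC0 : 0 <= b * C by rewrite mulr_ge0.
have [d1 d10 IH1] := IH _ _ bC0 e2.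
pose H := b ^+ 3 * (2 ^+ 3 * (m 3 + C ^+ 3)).
pose Q := 2 ^+ (t.+1 + t.+1) * m (t.+1 + t.+1).
have H0 : 0 <= H by rewrite !mulr_ge0 ?exprn_ge0// addr_ge0 ?exprn_ge0.
have Q0 : 0 <= Q by rewrite mulr_ge0 ?exprn_ge0.
have [d2 d20 UI] := avg_mul_small e2 H0 Q0.
have d20' : 0 < d2 / (2 * b + 1) by rewrite divr_gt0//; lra.
exists (Num.min d1 (d2 / (2 * b + 1))) => [|delta]; first by rewrite lt_min d10.
rewrite le_min => /andP[dd1 dd2] T a K B [//|V s] aK [ss] Bb.
have [a0 asym Kb Ksym cutaK am] := aK.
have delta0 := cut_bound_ge0 cutaK.
(* the first link of the chain is compared with that of K by h; what remains is a
   chain of t links behind the bounded kernel BK *)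
pose h x w := avg (fun z => B x z * (a z w - K z w)).
pose BK x w := avg (fun z => B x z * K z w) * (V w)%:R.
have BKb x y : 0 <= BK x y <= b * C.
  have BK0 : 0 <= avg (fun z => B x z * K z y).
    apply: avg_ge0 => z; have /andP[? _] := Bb x z; have /andP[? _] := Kb z y.
    exact: mulr_ge0.
  rewrite /BK mulr_ge0//=; apply: (@le_trans _ _ (avg (fun z => B x z * K z y))).
    by rewrite ler_piMr//; case: (V y).
  apply: ler_avg_cst => // z; have /andP[? ?] := Bb x z; have /andP[? ?] := Kb z y.
  exact: ler_pM.
have split x y : comp B (chain a (V :: s)) x y - comp B (chain K (V :: s)) x y =
    avg (fun w => h x w * ((V w)%:R * chain a s w y)) +
    (comp BK (chain a s) x y - comp BK (chain K s) x y).
  have expand (W : T -> T -> R) : comp B (chain W (V :: s)) x y =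
      avg (fun w => avg (fun z => B x z * W z w) * ((V w)%:R * chain W s w y)) by
    rewrite {1}/comp /= /comp; under eq_avg do rewrite -avgZl;
    rewrite exchange_avg; apply: eq_avg => w; rewrite -avgZr;
    apply: eq_avg => z; rewrite !mulrA.
  rewrite !expand// /comp -!avgB -avgD; apply: eq_avg => w.
  rewrite /h /BK; under [in RHS]eq_avg do rewrite mulrBr.
  by rewrite avgB; ring.
rewrite (eq_norm1 split); apply: le_trans (norm1D _ _) _.
have -> : eps = eps / 2 + eps / 2 by field.
apply: lerD; last exact: (IH1 _ dd1 _ _ _ _ _ aK).
pose f w := avg (fun x => `|h x w|).
have f0 w : 0 <= f w by apply: avg_ge0 => x.
have fle w : f w <= b * (degree a w + C).
  apply: ler_avg_cst => [|x].
    by rewrite mulr_ge0// addr_ge0// degree_ge0.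
  apply: le_trans (ler_norm_avg _) _.
  apply: (@le_trans _ _ (avg (fun z => b * (a w z + C)))).
    apply: ler_avg => z; have /andP[B0 Bb'] := Bb x z; have /andP[K0 KC] := Kb z w.
    rewrite normrM ger0_norm//; apply: ler_pM => //.
    by rewrite (asym w z) ler_norml; have := a0 z w; lra.
  by rewrite avgZl ler_wpM2l// avgD lerD2l; apply: ler_avg_cst.
apply: (@le_trans _ _ (avg (fun w => f w * walks a t.+1 w))).
  apply: (@le_trans _ _ (avg (fun x => avg (fun w => `|h x w| * walks a t.+1 w)))).
    apply: ler_avg => x.
    apply: (@le_trans _ _ (avg (fun y => avg (fun w => `|h x w| * chain a s w y)))).
      apply: ler_avg => y; apply: le_trans (ler_norm_avg _) _; apply: ler_avg => w.
      rewrite normrM ler_wpM2l// ger0_norm; last by rewrite mulr_ge0 ?chain_ge0.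
      by rewrite ler_piMl ?chain_ge0//; case: (V w).
    rewrite exchange_avg; apply: ler_avg => w.
    by rewrite avgZl ler_wpM2l// -ss avg_chain_le.
  by rewrite exchange_avg; apply: ler_avg => w; rewrite avgZr.
apply: UI => //.
- apply: (@le_trans _ _ (2 * b * delta)).
    rewrite /f exchange_avg; apply: ler_avg_cst => [|x]; first by rewrite !mulr_ge0.
    apply: le_trans (cut_bound_L1 cutaK b0 (Bb x)).
    rewrite le_eqVlt; apply/orP; left; apply/eqP.
    apply: eq_avg => y; congr (`| _ |); apply: eq_avg => z.
    by rewrite (asym y z) (Ksym y z); ring.
  apply: (@le_trans _ _ (2 * b * (d2 / (2 * b + 1)))).
    by rewrite ler_wpM2l// mulr_ge0.
  rewrite mulrA ler_pdivrMr; [nra|lra].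
- apply: (@le_trans _ _ (avg (fun w => b ^+ 3 * (degree a w + C) ^+ 3))).
    apply: ler_avg => w; rewrite -exprMn lerXn2r ?nnegrE//.
    by rewrite mulr_ge0// addr_ge0// degree_ge0.
  by rewrite avgZl ler_wpM2l ?exprn_ge0//; exact: degreeC_moment aK.
- by apply: le_trans (walks_sqr_le a0 asym _) _; rewrite ler_wpM2l ?exprn_ge0.
Qed.

(** The kernel of a chain in a converges in L1 to the same chain in K, as soon as
    the chain without its first link is bounded in L2: the first link then faces a
    uniformly integrable function, and every later one a bounded kernel. *)
Lemma chain_close t Q eps : 0 <= Q -> 0 < eps ->
  exists2 delta0, 0 < delta0 & forall delta, delta <= delta0 ->
    forall (T : finType) (a K : T -> T -> R) (V V' : pred T) s,
    cut_approx C delta m a K -> size s = t ->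
    avg (fun z => avg (fun y => ((V z)%:R * chain a s z y * (V' y)%:R) ^+ 2)) <= Q ->
    norm1 (fun x y => (chain a (V :: s) x y - chain K (V :: s) x y) * (V' y)%:R) <= eps.
Proof.
move=> Q0 e0; have e3 : 0 < eps / 3 by rewrite divr_gt0.
have [d1 d10 step2] := comp_chain_close t C_ge0 e3.
pose H := 2 ^+ 4 * (m 4 + C ^+ 4).
have H0 : 0 <= H by rewrite mulr_ge0 ?exprn_ge0// addr_ge0 ?exprn_ge0.
have [B B0 tail] := avg_tail_small e3 H0 Q0.
exists (Num.min d1 (eps / 3 / (2 * B))) => [|delta].
  by rewrite lt_min d10 divr_gt0// mulr_gt0.
rewrite le_min => /andP[dd1 dd2] T a K V V' s aK ss gQ.
have [a0 asym Kb Ksym cutaK am] := aK.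
have delta0 := cut_bound_ge0 cutaK.
pose g z y := (V z)%:R * chain a s z y * (V' y)%:R.
have g0 z y : 0 <= g z y by rewrite !mulr_ge0 ?chain_ge0.
pose KV x z := K x z * (V z)%:R.
have KVb x y : 0 <= KV x y <= C.
  have /andP[K0 KC] := Kb x y; rewrite mulr_ge0//= (le_trans _ KC)//.
  by rewrite ler_piMr//; case: (V y).
(* below the level B the cut norm applies; above it a - K is replaced by a + C *)
pose low x y := avg (fun z => (a x z - K x z) * (g z y * (g z y <= B)%R%:R)).
pose high x y := avg (fun z => (a x z - K x z) * (g z y * (B < g z y)%R%:R)).
have split x y : (chain a (V :: s) x y - chain K (V :: s) x y) * (V' y)%:R =
    low x y + (high x y +
      (comp KV (chain a s) x y - comp KV (chain K s) x y) * (V' y)%:R).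
  rewrite /= /comp -!avgB -!avgZr -!avgD; apply: eq_avg => z.
  have -> : (B < g z y)%R%:R = 1 - (g z y <= B)%R%:R :> R.
    by case: leP; rewrite ?subrr ?subr0.
  by rewrite /KV /g; ring.
rewrite (eq_norm1 split); apply: le_trans (norm1D _ _) _.
have -> : eps = eps / 3 + (eps / 3 + eps / 3) by field.
apply: lerD; [|apply: le_trans (norm1D _ _) _; apply: lerD].
- apply: (@le_trans _ _ (2 * B * delta)); last first.
    by rewrite mulrC -ler_pdivlMr// mulr_gt0.
  rewrite /norm1 exchange_avg; apply: ler_avg_cst => [|y].
    by rewrite !mulr_ge0// ltW.
  have hb z : 0 <= g z y * (g z y <= B)%R%:R <= B.
    by case: (leP (g z y) B) => gB; [rewrite mulr1 g0 | rewrite mulr0 lexx (ltW B0)].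
  exact: (cut_bound_L1 cutaK (ltW B0) hb).
- pose f (zy : T * T) := degree a zy.1 + C.
  pose g' (zy : T * T) := g zy.1 zy.2.
  apply: le_trans (tail (T * T)%type f g' _ _ _ _).
  + rewrite avg_pair /norm1 exchange_avg [leRHS]exchange_avg; apply: ler_avg => y.
    apply: (@le_trans _ _ (avg (fun x => avg (fun z =>
        (a x z + C) * (g z y * (B < g z y)%R%:R))))).
      apply: ler_avg => x; apply: le_trans (ler_norm_avg _) _; apply: ler_avg => z.
      rewrite normrM; apply: ler_pM => //; last first.
        have hh : 0 <= g z y * (B < g z y)%R%:R by apply: mulr_ge0.
        by rewrite (ger0_norm hh).
      by rewrite ler_norml; have := a0 x z; have /andP[? ?] := Kb x z; lra.
    rewrite exchange_avg; apply: ler_avg => z.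
    have hh : 0 <= g z y * (B < g z y)%R%:R by apply: mulr_ge0.
    rewrite avgZr; apply: ler_wpM2r => //; rewrite avgD lerD//; last exact: ler_avg_cst.
    by rewrite le_eqVlt; apply/orP; left; apply/eqP; apply: eq_avg => x.
  + by move=> x; rewrite addr_ge0// degree_ge0.
  + by move=> x; exact: g0.
  + rewrite avg_pair; apply: le_trans (degreeC_moment 4 aK).
    by apply: ler_avg => x /=; apply: ler_avg_cst; rewrite ?exprn_ge0// addr_ge0// degree_ge0.
  + by rewrite avg_pair.
- apply: le_trans (step2 _ dd1 _ _ _ _ _ aK ss KVb).
  apply: ler_norm1 => x y; rewrite normrM ler_piMr//.
  by rewrite normr_nat; case: (V' y).
Qed.

End ChainLimit.

(** * Products over the edges of a multigraph *)

(** Counts the colourings compatible with an injective map, and the maps with prescribed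
    values at two points. *)
Lemma card_prescribed (A B J : finType) (g : J -> A) (b : J -> B) : injective g ->
  (#|[set c : {ffun A -> B} | [forall i, c (g i) == b i]]| * #|B| ^ #|J| =
   #|B| ^ #|A|)%N.
Proof.
move=> g_inj.
pose F a : pred B := fun y => [forall i, (g i == a) ==> (y == b i)].
have -> : #|[set c : {ffun A -> B} | [forall i, c (g i) == b i]]| = #|family F|.
  apply: eq_card => c; rewrite !inE; apply/forallP/familyP => [h a|h i].
    by apply/forallP => i; apply/implyP => /eqP <-.
  by have /forallP/(_ i) := h (g i); rewrite eqxx.
rewrite card_family foldrE big_map big_enum/= (bigID (fun a => a \in codom g))/=.
rewrite big1 => [|a /codomP[i ->]]; last first.
  rewrite -(card1 (b i)); apply: eq_card => y.
  rewrite !inE; apply/forallP/eqP => [/(_ i)|-> j]; first by rewrite eqxx => /eqP.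
  by apply/implyP => /eqP/g_inj ->.
rewrite mul1n (eq_bigr (fun=> #|B|)) => [|a /negP na]; last first.
  apply: eq_card => y; rewrite [RHS]inE; apply/forallP => i.
  by apply/implyP => /eqP ga; case: na; rewrite -ga codom_f.
rewrite prod_nat_const -expnD; congr (_ ^ _)%N.
rewrite -(card_codom g_inj) addnC -(cardC (mem (codom g))).
congr (_ + _)%N; apply: eq_card => a; rewrite !inE.
Qed.

Lemma avg_ffun2 (R : realFieldType) (V T : finType) (u v : V) (f : T -> T -> R) :
  u != v ->
  avg (fun x : {ffun V -> T} => f (x u) (x v)) = avg (fun y => avg (f y)).
Proof.
move=> uv; pose g (i : bool) := if i then u else v.
have g_inj : injective g.
  by move=> [] [] //= e; move: uv; rewrite e eqxx.
rewrite -(avg_pair (fun yz => f yz.1 yz.2)) /avg.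
rewrite (partition_big (fun x : {ffun V -> T} => (x u, x v)) predT)//=.
rewrite mulr_suml mulr_suml; apply: eq_bigr => -[y z] _ /=.
pose b (i : bool) := if i then y else z.
have := card_prescribed b g_inj; set S := [set _ | _].
have -> : \sum_(x : {ffun V -> T} | (x u, x v) == (y, z)) f (x u) (x v) = f y z *+ #|S|.
  rewrite -sumr_const; apply: eq_big => [x|x /eqP[-> ->]//].
  rewrite inE; apply/eqP/forallP => [[xu xv] [|]|h]; rewrite ?xu ?xv//.
  by have /eqP xu := h true; have /eqP xv := h false; rewrite xu xv.
rewrite card_bool card_ffun card_prod => cardS.
have T0 : #|T|%:R != 0 :> R.
  by rewrite pnatr_eq0 -lt0n; apply/card_gt0P; exists y.
have V0 : (#|T| ^ #|V|)%:R != 0 :> R by rewrite natrX expf_neq0.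
rewrite -[_ *+ #|S|]mulr_natr -mulrA; congr (_ * _).
apply: (mulIf V0); rewrite -mulrA mulVf// mulr1 -cardS -mulnn [(#|S| * _)%:R]natrM mulrCA mulVf ?mulr1//.
by rewrite natrM mulf_neq0.
Qed.

Section Products.
Variable R : realFieldType.

Lemma prod_diff_le (E : eqType) (r : seq E) (al be u : E -> R) :
  (forall e, 0 <= al e <= u e) -> (forall e, 0 <= be e <= u e) ->
  (forall e, 1 <= u e) ->
  `|\prod_(e <- r) al e - \prod_(e <- r) be e| <=
  \sum_(e <- r) `|al e - be e| * \prod_(e <- r) u e.
Proof.
move=> alu beu u1; rewrite -mulr_suml; elim: r => [|e r IH].
  by rewrite !big_nil subrr normr0 mul0r.
rewrite !big_cons; set P := \prod_(j <- r) al j in IH *.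
set P' := \prod_(j <- r) be j in IH *; set U := \prod_(j <- r) u j in IH *.
set S := \sum_(j <- r) _ in IH *.
have S0 : 0 <= S by apply: sumr_ge0.
have U0 : 0 <= U by apply: prodr_ge0 => j _; apply: le_trans (u1 j).
have PU : `|P| <= U.
  rewrite ger0_norm; last by apply: prodr_ge0 => j _; case/andP: (alu j).
  by apply: ler_prod => j _; exact: alu.
have -> : al e * P - be e * P' = (al e - be e) * P + be e * (P - P') by ring.
have /andP[b0 bu] := beu e; have ue := u1 e.
apply: le_trans (ler_normD _ _) _; rewrite [(_ + S) * _]mulrDl; apply: lerD.
  rewrite normrM ler_wpM2l//; apply: le_trans PU _.
  by rewrite ler_peMl.
rewrite normrM (ger0_norm b0) mulrCA; apply: ler_pM => //.
Qed.

(** The largest factor dominates, which reduces moments of a product to moments of its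
    factors. *)
Lemma prod_cube_le (E : finType) (u : E -> R) : (forall e, 1 <= u e) ->
  (\prod_e u e) ^+ 3 <= 1 + \sum_e u e ^+ (3 * #|E|).
Proof.
move=> u1; have u0 e : 0 <= u e by apply: le_trans (u1 e).
case: (pickP (@predT E)) => [e0 _|E0]; last first.
  by rewrite !big_pred0 ?expr1n ?addr0.
pose e1 := [arg max_(e > e0) u e]%O.
have maxe e : u e <= u e1 by rewrite /e1; case: arg_maxP => //= i _; exact.
apply: (@le_trans _ _ (u e1 ^+ (3 * #|E|))).
  rewrite mulnC exprM lerXn2r ?nnegrE ?prodr_ge0 ?exprn_ge0//.
  by rewrite -prodr_const; apply: ler_prod => e _; rewrite u0 maxe.
rewrite (bigD1 e1)//= addrCA lerDl addr_ge0// sumr_ge0// => e _.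
exact: exprn_ge0.
Qed.

(** Telescoping over the edges: one factor is small in L1, and the bounded moments of N
    make the other factors harmless, even if several edges join the same two vertices. *)
Lemma prod_avg_close (V E : finType) (h : E -> V * V) (mom : nat -> R) (C eps : R) :
  (forall e, (h e).1 != (h e).2) -> (forall k, 0 <= mom k) -> 0 <= C -> 0 < eps ->
  exists2 eta, 0 < eta & forall (T : finType) (M K : E -> T -> T -> R) (N : T -> T -> R)
    (w : {ffun V -> T} -> R),
    (forall x, 0 <= w x <= 1) ->
    (forall e x y, 0 <= M e x y <= N x y) -> (forall e x y, 0 <= K e x y <= C) ->
    (forall k, avg (fun x => avg (fun y => N x y ^+ k)) <= mom k) ->
    (forall e, norm1 (fun x y => M e x y - K e x y) <= eta) ->
    `|avg (fun x => w x * \prod_e M e (x (h e).1) (x (h e).2)) -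
      avg (fun x => w x * \prod_e K e (x (h e).1) (x (h e).2))| <= eps.
Proof.
move=> hE mom0 C0 e0; pose k := (3 * #|E|)%N.
pose Q := 1 + #|E|%:R * (2 ^+ k * (mom k + (C + 1) ^+ k)).
have Q0 : 0 <= Q.
  by rewrite addr_ge0// mulr_ge0// mulr_ge0 ?exprn_ge0// addr_ge0// exprn_ge0// addr_ge0.
have e1 : 0 < eps / (#|E|%:R + 1) by rewrite divr_gt0// ltr_wpDl.
have [eta eta0 UI] := avg_mul_small_weighted e1 Q0.
exists eta => // T M K N w w01 MN KC Nmom MK.
have N0 x y (e : E) : 0 <= N x y by have /andP[? ?] := MN e x y; lra.
pose u (x : {ffun V -> T}) e := N (x (h e).1) (x (h e).2) + (C + 1).
pose f e (x : {ffun V -> T}) :=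
  `|M e (x (h e).1) (x (h e).2) - K e (x (h e).1) (x (h e).2)|.
pose g x := \prod_e u x e.
have u1 x e : 1 <= u x e by rewrite /u; have := N0 (x (h e).1) (x (h e).2) e; lra.
have g0 x : 0 <= g x by apply: prodr_ge0 => e _; apply: le_trans (u1 x e).
have fu e x : f e x <= u x e.
  rewrite /f /u; have /andP[? ?] := MN e (x (h e).1) (x (h e).2).
  have /andP[? ?] := KC e (x (h e).1) (x (h e).2).
  by rewrite ler_norml; lra.
have ug e x : u x e <= g x.
  rewrite /g (bigD1 e)//= ler_peMr//; first by apply: le_trans (u1 x e).
  apply: (big_rec (fun z => 1 <= z)) => // i z _ z1.
  by rewrite -[1]mulr1 ler_pM.
have fg e : avg (fun x => f e x * g x) <= eps / (#|E|%:R + 1).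
  apply: UI => //.
  - by move=> x; exact: normr_ge0.
  - have edge2 := avg_ffun2 (fun y z => `|M e y z - K e y z|) (hE e).
    by apply: le_trans (MK e); rewrite -[norm1 _]edge2.
  - apply: (@le_trans _ _ (avg (fun x : {ffun V -> T} => 1 + \sum_e' u x e' ^+ k))).
      apply: ler_avg => x; apply: le_trans (prod_cube_le (u1 x)).
      by rewrite [leRHS]exprS; apply: ler_wpM2r; rewrite ?exprn_ge0 ?(le_trans (fu e x)).
    rewrite avgD; apply: lerD; first exact: ler_avg_cst.
    have -> : avg (fun x : {ffun V -> T} => \sum_e' u x e' ^+ k) =
        \sum_e' avg (fun x : {ffun V -> T} => u x e' ^+ k).
      by rewrite /avg exchange_big/= mulr_suml.
    rewrite mulr_natl -sumr_const; apply: ler_sum => e' _.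
    have -> : avg (fun x : {ffun V -> T} => u x e' ^+ k) =
        avg (fun y => avg (fun z => (N y z + (C + 1)) ^+ k)) by
      exact: (avg_ffun2 (fun y z => (N y z + (C + 1)) ^+ k) (hE e')).
    apply: (@le_trans _ _ (avg (fun y => avg (fun z => 2 ^+ k * (N y z ^+ k + (C + 1) ^+ k))))).
      apply: ler_avg => y; apply: ler_avg => z.
      by rewrite exprD_le2 ?(N0 _ _ e)// addr_ge0.
    apply: (@le_trans _ _ (2 ^+ k * avg (fun y => avg (fun z => N y z ^+ k) + (C + 1) ^+ k))).
      rewrite -avgZl; apply: ler_avg => y; rewrite avgZl ler_wpM2l ?exprn_ge0//.
      rewrite avgD lerD2l; apply: ler_avg_cst => //.
      by rewrite exprn_ge0// addr_ge0.
    rewrite ler_wpM2l ?exprn_ge0// avgD lerD//.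
    by apply: ler_avg_cst => //; rewrite exprn_ge0// addr_ge0.
apply: (@le_trans _ _ (avg (fun x => \sum_e f e x * g x))).
  rewrite -avgB; apply: le_trans (ler_norm_avg _) _; apply: ler_avg => x.
  rewrite -mulrBr normrM; have /andP[w0 w1] := w01 x; rewrite (ger0_norm w0).
  apply: le_trans (_ : _ <= `|\prod_e M e (x (h e).1) (x (h e).2) -
      \prod_e K e (x (h e).1) (x (h e).2)|) _; first by rewrite ler_piMl.
  apply: le_trans (prod_diff_le (u := u x) _ _ _ _) _ => // e; rewrite /u.
    have /andP[? ?] := MN e (x (h e).1) (x (h e).2); apply/andP; lra.
  have /andP[? ?] := KC e (x (h e).1) (x (h e).2).
  have := N0 (x (h e).1) (x (h e).2) e; move=> ?; apply/andP; lra.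
have -> : avg (fun x => \sum_e f e x * g x) = \sum_e avg (fun x => f e x * g x).
  by rewrite /avg exchange_big/= mulr_suml.
apply: (@le_trans _ _ (\sum_(e : E) eps / (#|E|%:R + 1))); first exact: ler_sum.
rewrite sumr_const -(mulr_natr (eps / _)) -mulrA ler_piMr ?(ltW e0)// mulrC.
by rewrite ler_pdivrMr ?mul1r ?lerDl// ltr_wpDl.
Qed.

End Products.

(** * Colour coding of subdivisions *)

Section PathWeights.
Variables (R : realFieldType) (T : finType).
Implicit Types (W : T -> T -> R) (x y : T) (w : seq T) (s : seq (pred T)).

Fixpoint path_weight W x w y : R :=
  if w is z :: w' then W x z * path_weight W z w' y else W x y.

Fixpoint lies_in s w : bool :=
  match s, w with
  | V :: s', z :: w' => V z && lies_in s' w'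
  | [::], [::] => true
  | _, _ => false
  end.

Lemma sum_tupleS m (f : m.+1.-tuple T -> R) :
  \sum_(w : m.+1.-tuple T) f w = \sum_z \sum_(w : m.-tuple T) f [tuple of z :: w].
Proof.
rewrite pair_bigA/= (reindex (fun zw : T * m.-tuple T => [tuple of zw.1 :: zw.2]))//=.
exists (fun w : m.+1.-tuple T => (thead w, [tuple of behead w])) => [[z w] _|w _] /=.
  by congr (_, _); apply: val_inj.
by rewrite -tuple_eta.
Qed.

Lemma chain_sum W s m x y : size s = m ->
  chain W s x y =
  (\sum_(w : m.-tuple T) (lies_in s w)%:R * path_weight W x w y) / #|T|%:R ^+ m.
Proof.
move=> <- {m}; elim: s x y => [|V s IH] x y.
  rewrite expr0 divr1 (big_pred1 [tuple]) /= ?mul1r// => w.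
  by apply/esym/eqP; exact: tuple0.
rewrite /= /comp /avg sum_tupleS exprS invfM [_ * (_ ^+ _)^-1]mulrC mulrA.
rewrite [in RHS]mulr_suml; congr (_ / _).
apply: eq_bigr => z _; rewrite IH mulrA; congr (_ / _).
rewrite mulr_sumr; apply: eq_bigr => w _ /=.
by case: (V z); rewrite /= ?mulr0 ?mul0r// mulr1 mulrCA.
Qed.

Lemma path_weightE W x w y (d : T) :
  path_weight W x w y =
  \prod_(i < (size w).+1) W (nth d (x :: rcons w y) i) (nth d (x :: rcons w y) i.+1).
Proof.
elim: w x => [|z w IH] x /=; first by rewrite big_ord1.
by rewrite big_ord_recl IH.
Qed.

Lemma path_weight_scale W (c : R) x w y :
  path_weight (fun x y => W x y * c) x w y = path_weight W x w y * c ^+ (size w).+1.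
Proof.
elim: w x => [|z w IH] x /=; first by rewrite expr1.
by rewrite IH [c ^+ _.+2]exprS; ring.
Qed.

Lemma path_weight_edge (e : rel T) x w y :
  path_weight (fun x y => (e x y)%:R) x w y = (path e x (rcons w y))%:R.
Proof.
elim: w x => [|z w IH] x /=; first by rewrite andbT.
by rewrite IH; case: (e x z); rewrite ?mul1r ?mul0r.
Qed.

End PathWeights.

(** Colouring the vertices and keeping only the maps that send every vertex of the
    pattern into its own colour class makes all kept maps injective, and decouples
    the paths that replace the edges of H. *)
Section ColourCoding.
Variables (R : realFieldType) (V E T : finType) (h : E -> V * V) (m : nat).
Local Notation X := (V + E * 'I_m)%type.
Implicit Types (W : T -> T -> R) (g : {ffun X -> T}) (c : {ffun T -> X}).

Definition subdiv_weight W g : R :=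
  \prod_a path_weight W (g (inl (h a).1)) [seq g (inr (a, j)) | j <- enum 'I_m]
            (g (inl (h a).2)).

Definition inner_classes c a : seq (pred T) :=
  [seq (fun z => c z == inr (a, j)) | j <- enum 'I_m].

Definition compatible c g : bool := [forall i, c (g i) == i].

Lemma size_inner_classes c a : size (inner_classes c a) = m.
Proof. by rewrite size_map size_enum_ord. Qed.

Lemma lies_in_map (J : Type) (P : J -> pred T) (f : J -> T) (s : seq J) :
  lies_in (map P s) (map f s) = all (fun j => P j (f j)) s.
Proof. by elim: s => //= j s ->. Qed.

(** A compatible map consists of the images of V and, for each edge of H separately, of
    the inner vertices of one path. *)
Lemma sum_compatible W c :
  \sum_(g | compatible c g) subdiv_weight W g =
  #|T|%:R ^+ (m * #|E|) * \sum_(x : {ffun V -> T})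
    ([forall v, c (x v) == inl v])%:R *
    \prod_a chain W (inner_classes c a) (x (h a).1) (x (h a).2).
Proof.
pose join (xo : {ffun V -> T} * {ffun E -> m.-tuple T}) : {ffun X -> T} :=
  [ffun i => match i with inl v => xo.1 v | inr (a, j) => tnth (xo.2 a) j end].
pose split g : {ffun V -> T} * {ffun E -> m.-tuple T} :=
  ([ffun v => g (inl v)], [ffun a => [tuple g (inr (a, j)) | j < m]]).
rewrite (reindex join)/=; last first.
  exists split => [[x o] _|g _].
    congr (_, _); apply/ffunP => v; rewrite !ffunE//.
    by apply: eq_from_tnth => j; rewrite tnth_mktuple ffunE.
  by apply/ffunP => -[v|[a j]]; rewrite !ffunE// tnth_mktuple.
have inner (o : {ffun E -> m.-tuple T}) x a :
    [seq join (x, o) (inr (a, j)) | j <- enum 'I_m] = o a.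
  rewrite -[RHS]map_tnth_enum; apply: eq_map => j; by rewrite ffunE.
have lies (xo : {ffun V -> T} * {ffun E -> m.-tuple T}) a : lies_in (inner_classes c a) (xo.2 a) =
    [forall j, c (join xo (inr (a, j))) == inr (a, j)].
  case: xo => x o /=; rewrite -(inner o x a) /inner_classes lies_in_map.
  apply/allP/forallP => [H j|H j _]; last exact: H.
  by apply: H; rewrite mem_enum.
rewrite big_mkcond/= mulr_sumr.
transitivity (\sum_(x : {ffun V -> T}) \sum_(o : {ffun E -> m.-tuple T})
   ([forall v, c (x v) == inl v])%:R *
   \prod_a ((lies_in (inner_classes c a) (o a))%:R *
     path_weight W (x (h a).1) (o a) (x (h a).2))).
  rewrite pair_bigA/=; apply: eq_bigr => -[x o] _ /=.
  have -> : compatible c (join (x, o)) =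
      [forall v, c (x v) == inl v] && [forall a, lies_in (inner_classes c a) (o a)].
    apply/forallP/andP => [H|[/forallP H1 /forallP H2] [v|[a j]]].
    - split; apply/forallP => a; first by have := H (inl a); rewrite ffunE.
      by rewrite (lies (x, o) a); apply/forallP => j; exact: H.
    - by rewrite ffunE.
    - by have := H2 a; rewrite (lies (x, o) a) => /forallP/(_ j).
  case: [forall v, _] => /=; last by rewrite mul0r.
  rewrite mul1r big_split/=; case: ifPn => [/forallP H|].
    rewrite [X in _ = X * _]big1 => [|a _]; last by rewrite H.
    rewrite mul1r; apply: eq_bigr => a _.
    by rewrite inner !ffunE.
  rewrite negb_forall => /existsP[a na].
  by rewrite (bigD1 a)//= (negbTE na) !mul0r.
apply: eq_bigr => x _; rewrite -mulr_sumr mulrCA; congr (_ * _).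
rewrite -(bigA_distr_bigA (fun a (w : m.-tuple T) =>
  (lies_in (inner_classes c a) w)%:R * path_weight W (x (h a).1) w (x (h a).2))).
rewrite exprM -prodr_const -big_split/=; apply: eq_bigr => a _.
rewrite (chain_sum W _ _ (size_inner_classes c a)).
have [T0|T0] := eqVneq (#|T|%:R : R) 0; last first.
  by rewrite mulrC divfK ?expf_neq0.
have : x (h a).1 \notin T.
  by move/eqP: T0; rewrite pnatr_eq0 => /eqP/card0_eq ->.
by rewrite inE.
Qed.

Lemma compatible_inj c g : compatible c g -> injective g.
Proof.
by move=> /forallP cg i j gij; rewrite -(eqP (cg i)) gij (eqP (cg j)).
Qed.

(** Every injective map is compatible with the same proportion of all colourings, and
    no other map is compatible with any. *)
Lemma avg_sum_compatible (Phi : {ffun X -> T} -> R) : (0 < #|{: X}|)%N ->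
  #|{: X}|%:R ^+ #|{: X}| * avg (fun c => \sum_(g | compatible c g) Phi g) =
  \sum_(g : {ffun X -> T} | injectiveb g) Phi g.
Proof.
move=> X0; rewrite /avg.
have -> : \sum_c \sum_(g | compatible c g) Phi g =
    \sum_(g : {ffun X -> T} | injectiveb g) \sum_(c | compatible c g) Phi g.
  rewrite (exchange_big_dep (fun g : {ffun X -> T} => injectiveb g))//= => c g _ /compatible_inj gi.
  exact/injectiveP.
rewrite mulr_suml mulr_sumr; apply: eq_bigr => g /injectiveP g_inj.
have := card_prescribed (fun i => i) g_inj; set S := [set _ | _] => cardS.
have -> : \sum_(c | compatible c g) Phi g = Phi g *+ #|S|.
  by rewrite -sumr_const; apply: eq_bigl => c; rewrite inE.
rewrite -[Phi g *+ _]mulr_natr card_ffun -cardS natrM natrX.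
have XX : #|{: X}|%:R ^+ #|{: X}| != 0 :> R by rewrite expf_neq0// pnatr_eq0 -lt0n.
have S0 : #|S|%:R != 0 :> R.
  rewrite pnatr_eq0; apply/eqP => S0; move: cardS; rewrite S0 mul0n => /esym/eqP.
  by rewrite expn_eq0 => /andP[/eqP X00]; rewrite X00 in X0.
by field; rewrite XX.
Qed.

End ColourCoding.

(** * Injective maps, and the very sparse regime *)

Section InjectiveSums.
Variables (R : realFieldType) (V E : finType) (h : E -> V * V) (m : nat).
Hypothesis h_loopless : forall e, (h e).1 != (h e).2.
Local Notation X := (V + E * 'I_m)%type.

Definition coloured_chain (T : finType) (W : T -> T -> R) (c : {ffun T -> X}) e x y : R :=
  ((c x == inl (h e).1) && (c y == inl (h e).2))%:R * chain W (inner_classes c e) x y.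

(** Colour by colour, the counts of subdivisions of H are products of chains, so that
    L1 closeness of the chains carries over to the counts of injective maps. *)
Lemma inj_sum_close (mom : nat -> R) (C eps : R) :
  (forall k, 0 <= mom k) -> 0 <= C -> 0 < eps ->
  exists2 eta, 0 < eta & forall (T : finType) (a K N : T -> T -> R),
    (forall x y, 0 <= a x y) -> (forall x y, 0 <= K x y <= C) ->
    (forall c e x y, coloured_chain a c e x y <= N x y) ->
    (forall k, avg (fun x => avg (fun y => N x y ^+ k)) <= mom k) ->
    (forall c e, norm1 (fun x y =>
       coloured_chain a c e x y - coloured_chain K c e x y) <= eta) ->
    `|\sum_(g : {ffun X -> T} | injectiveb g) subdiv_weight h a g -
      \sum_(g : {ffun X -> T} | injectiveb g) subdiv_weight h K g| <=
      eps * #|T|%:R ^+ #|{: X}|.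
Proof.
move=> mom0 C0 eps0; have XX0 : 0 < #|{: X}|%:R ^+ #|{: X}| + 1 :> R by rewrite ltr_wpDl ?exprn_ge0.
have e0 : 0 < eps / (#|{: X}|%:R ^+ #|{: X}| + 1) by rewrite divr_gt0.
have Cm0 : 0 <= C ^+ m.+1 by rewrite exprn_ge0.
have [eta eta0 close] := prod_avg_close h_loopless mom0 Cm0 e0.
exists eta => // T a K N a0 KC aN Nmom aK.
have K0 x y : 0 <= K x y by case/andP: (KC x y).
have [e1 _|E0] := pickP (@predT E); last first.
  rewrite (eq_bigr (fun g => subdiv_weight h K g)) => [|g _].
    by rewrite subrr normr0 mulr_ge0 ?exprn_ge0// ltW.
  by rewrite /subdiv_weight !big_pred0.
have X0 : (0 < #|{: X}|)%N by apply/card_gt0P; exists (inl (h e1).1).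
rewrite -!avg_sum_compatible// -mulrBr -avgB normrM ger0_norm ?exprn_ge0//.
apply: (@le_trans _ _ (#|{: X}|%:R ^+ #|{: X}| *
    (eps / (#|{: X}|%:R ^+ #|{: X}| + 1) * #|T|%:R ^+ #|{: X}|))); last first.
  rewrite mulrA ler_wpM2r ?exprn_ge0// mulrA ler_pdivrMr// mulrC ler_wpM2l//.
    exact: ltW.
  by rewrite lerDl.
rewrite ler_wpM2l ?exprn_ge0//; apply: le_trans (ler_norm_avg _) _.
apply: ler_avg_cst => [|c]; first by rewrite mulr_ge0 ?exprn_ge0// ltW.
pose w (x : {ffun V -> T}) : R := ([forall v, c (x v) == inl v])%:R.
have coloured W : \sum_(g | compatible c g) subdiv_weight h W g =
    #|T|%:R ^+ #|{: X}| *
    avg (fun x => w x * \prod_e coloured_chain W c e (x (h e).1) (x (h e).2)).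
  rewrite sum_compatible /avg card_ffun natrX.
  have -> : #|{: X}| = (m * #|E| + #|V|)%N.
    by rewrite card_sum card_prod card_ord addnC mulnC.
  rewrite exprD -mulrA; congr (_ * _); rewrite [RHS]mulrC.
  have -> : \sum_(x : {ffun V -> T}) ([forall v, c (x v) == inl v])%:R *
       \prod_a0 chain W (inner_classes c a0) (x (h a0).1) (x (h a0).2) =
      \sum_(x : {ffun V -> T}) w x * \prod_e coloured_chain W c e (x (h e).1) (x (h e).2).
    apply: eq_bigr => x _; rewrite /w; case: forallP => [H|_]; last by rewrite !mul0r.
    by congr (_ * _); apply: eq_bigr => e _; rewrite /coloured_chain !H mul1r.
  have [T0|T0] := eqVneq (#|T|%:R ^+ #|V| : R) 0; last by rewrite divfK.
  rewrite T0 mulr0; apply: big1 => x _.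
  move/eqP: T0; rewrite expf_eq0 pnatr_eq0 => /andP[_ /eqP/card0_eq T0].
  by have := T0 (x (h e1).1); rewrite inE.
rewrite !coloured -mulrBr normrM ger0_norm ?exprn_ge0// mulrC.
rewrite ler_wpM2r ?exprn_ge0//; apply: close Nmom _ => [x|e x y|e x y|e].
- by rewrite /w; case: forallP; rewrite ?lexx ?ler01.
- by rewrite aN mulr_ge0// chain_ge0.
- rewrite mulr_ge0 ?chain_ge0//=.
  apply: le_trans (_ : _ <= chain K (inner_classes c e) x y) _.
    by rewrite ler_piMl ?chain_ge0//; case: (_ && _).
  by rewrite -[in leRHS](size_inner_classes c e) chain_le.
- exact: aK.
Qed.

End InjectiveSums.

(** In the very sparse regime closeness in cut norm forces the kernel K to be small. The
    end points of j edges span at most j ^ 2 pairs, to which K gives mass at most C j ^ 2,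
    whereas the scaled graph has mass j / p >= j n there. Adding the edges one at a time,
    their number never exceeds 2 delta n. *)
Lemma sparse_small (R : realFieldType) (T : finType) (C p delta : R) (e : rel T)
  (K : T -> T -> R) : let n := #|T|%:R : R in
  1 <= C -> 0 < p -> n * p <= 1 -> (forall x y, 0 <= K x y <= C) ->
  cut_bound delta (fun x y => (e x y)%:R / p - K x y) ->
  2 * delta + n^-1 <= (2 * C)^-1 -> (0 < #|T|)%N ->
  avg (fun x => avg (K x)) <= 3 * delta.
Proof.
move=> n C1 p0 np KC cutK small T0.
have n0 : 0 < n by rewrite ltr0n.
have d0 := cut_bound_ge0 cutK.
pose Ed := [seq xy <- enum {: T * T} | e xy.1 xy.2].
pose a x y : R := (e x y)%:R / p.
have key j : (j <= size Ed)%N ->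
    j%:R / (p * n ^+ 2) <= C * (j%:R / n) ^+ 2 + delta.
  move=> jE; pose J := take j Ed.
  pose S := [pred x | x \in map fst J]; pose S' := [pred y | y \in map snd J].
  have /ler_normlP[_] := cutK S S'.
  have -> : avg (fun x => avg (fun y => (S x)%:R * (a x y - K x y) * (S' y)%:R)) =
     avg (fun x => avg (fun y => (S x)%:R * a x y * (S' y)%:R)) -
     avg (fun x => avg (fun y => (S x)%:R * K x y * (S' y)%:R)).
    by rewrite -avgB; apply: eq_avg => x; rewrite -avgB; apply: eq_avg => y; ring.
  move=> h; have lo : j%:R / (p * n ^+ 2) <=
      avg (fun x => avg (fun y => (S x)%:R * a x y * (S' y)%:R)).
    rewrite -(avg_pair (fun xy => (S xy.1)%:R * a xy.1 xy.2 * (S' xy.2)%:R)).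
    rewrite /avg card_prod natrM invfM mulrA -expr2.
    apply: ler_wpM2r; first by rewrite invr_ge0 exprn_ge0// ltW.
        rewrite (bigID (fun xy => xy \in J))/= -[leLHS]addr0; apply: lerD; last first.
      by apply: sumr_ge0 => xy _; rewrite !mulr_ge0 ?invr_ge0// ltW.
    have uJ : uniq J by rewrite take_uniq// filter_uniq// enum_uniq.
    rewrite -big_uniq//= (eq_big_seq (fun=> p^-1)) => [|xy xyJ].
      by rewrite big_const_seq count_predT iter_addr_0 size_takel// mulr_natl.
    have : xy \in Ed by apply: mem_take xyJ.
    rewrite mem_filter => /andP[exy _].
    rewrite /S /S' /a exy /= (map_f fst xyJ) (map_f snd xyJ).
    by rewrite !mul1r mulr1.
  have hi : avg (fun x => avg (fun y => (S x)%:R * K x y * (S' y)%:R)) <=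
      C * (j%:R / n) ^+ 2.
    have side (g : T * T -> T) : avg (fun x => (x \in map g J)%:R) <= j%:R / n.
      apply: ler_wpM2r; first by rewrite invr_ge0 ltW.
      rewrite -natr_sum ler_nat -big_mkcond/= sum1_card.
      by rewrite (leq_trans (card_size _))// size_map size_takel.
    apply: (@le_trans _ _ (avg (fun x => (S x)%:R * (C * avg (fun y => (S' y)%:R))))).
      apply: ler_avg => x; rewrite -!avgZl; apply: ler_avg => y.
      rewrite -mulrA ler_wpM2l// ler_wpM2r//.
      by case/andP: (KC x y).
    rewrite avgZr mulrCA ler_wpM2l//; first lra.
    rewrite expr2; apply: ler_pM; rewrite ?avg_ge0//; exact: side.
  lra.
have pn1 : 1 <= (n * p)^-1 by rewrite invf_ge1// mulr_gt0.
(* for u <= 1 / (2 C) the quadratic term is absorbed by half of the linear one *)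
have half (u : R) : 0 <= u -> u <= (2 * C)^-1 -> C * u ^+ 2 <= u / 2.
  move=> u0 uC; rewrite expr2 mulrA mulrC ler_wpM2l//.
  have : C * u <= C * (2 * C)^-1 by rewrite ler_wpM2l//; lra.
  suff -> : C * (2 * C)^-1 = 2^-1 by [].
  by field; lra.
have grow j : (j <= size Ed)%N -> j%:R / n <= 2 * delta.
  elim: j => [|j IH] jE; first by rewrite mul0r mulr_ge0.
  have u0 : 0 <= j.+1%:R / n by rewrite divr_ge0// ltW.
  have uC : j.+1%:R / n <= (2 * C)^-1.
    apply: le_trans small; rewrite -natr1 mulrDl mul1r lerD2r.
    by apply: IH; apply: ltnW.
  have k1 := key _ jE; have k2 := half _ u0 uC.
  have : j.+1%:R / n <= j.+1%:R / (p * n ^+ 2).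
    have -> : j.+1%:R / (p * n ^+ 2) = j.+1%:R / n * (n * p)^-1.
      by field; rewrite !gt_eqF.
    by rewrite ler_peMr.
  lra.
have mE := grow _ (leqnn _).
have u0 : 0 <= (size Ed)%:R / n by rewrite divr_ge0// ltW.
have uC : (size Ed)%:R / n <= (2 * C)^-1.
  by apply: le_trans small; rewrite (le_trans mE)// lerDl invr_ge0 ltW.
have k1 := key _ (leqnn _); have k2 := half _ u0 uC.
have ea : avg (fun x => avg (a x)) = (size Ed)%:R / (p * n ^+ 2).
  rewrite -(avg_pair (fun xy => a xy.1 xy.2)) /avg /a card_prod natrM -mulr_suml.
  rewrite -natr_sum -big_mkcond/= sum1_card -/n.
  have -> : size Ed = #|[pred xy : T * T | e xy.1 xy.2]|.
    by rewrite cardE /enum_mem -enumT; congr size.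
  by field; rewrite !gt_eqF.
have /ler_normlP[h _] := cutK predT predT.
have eK : - avg (fun x => avg (fun y => (predT x)%:R * ((e x y)%:R / p - K x y) * (predT y)%:R)) =
   avg (fun x => avg (K x)) - avg (fun x => avg (a x)).
  rewrite -avgB -avgN; apply: eq_avg => x; rewrite -avgB -avgN; apply: eq_avg => y.
  by rewrite /a /=; ring.
rewrite eK in h.
lra.
Qed.

Lemma avg_chain_bound (R : realFieldType) (T : finType) (C : R) (K : T -> T -> R) s :
  0 <= C -> (forall x y, 0 <= K x y <= C) ->
  avg (fun x => avg (chain K s x)) <= C ^+ size s * avg (fun x => avg (K x)).
Proof.
move=> C0 KC; case: s => [|V s]; first by rewrite mul1r.
have K0 x y : 0 <= K x y by case/andP: (KC x y).
rewrite -avgZl; apply: ler_avg => x /=; rewrite /comp exchange_avg -avgZl.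
apply: ler_avg => z; rewrite avgZl mulrC; apply: ler_pM.
- by apply: avg_ge0 => y; exact: chain_ge0.
- by rewrite mulr_ge0.
- by apply: ler_avg_cst => [|y]; [rewrite exprn_ge0 | exact: chain_le].
- by rewrite ler_piMr//; case: (V z).
Qed.

(** * Edges of a subdivided multigraph *)

Definition edge_weight (R : comNzRingType) (k : nat) (F : sgraph 'I_k) (T : Type)
    (W : T -> T -> R) (g : 'I_k -> T) : R :=
  \prod_(i < k) \prod_(j < k | (i < j)%N && edge F i j) W (g i) (g j).

Definition ordered_edges (k : nat) (F : sgraph 'I_k) : {set 'I_k * 'I_k} :=
  [set ij : 'I_k * 'I_k | (ij.1 < ij.2)%N && edge F ij.1 ij.2].

Lemma edge_weightE (R : comNzRingType) k (F : sgraph 'I_k) T W (g : 'I_k -> T) :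
  edge_weight F W g = \prod_(ij in ordered_edges F) W (g ij.1) (g ij.2) :> R.
Proof. by rewrite /edge_weight pair_big_dep/=; apply: eq_bigl => ij; rewrite inE. Qed.

Lemma card_edges k (F : sgraph 'I_k) : #|edges F| = #|ordered_edges F|.
Proof.
have inj : {in ordered_edges F &, injective (fun ij : 'I_k * 'I_k => [set ij.1; ij.2])}.
  move=> [i j] [i' j']; rewrite !inE /= => /andP[ij _] /andP[ij' _] e.
  have := set21 i j; have := set22 i j; rewrite e !inE.
  move=> /orP[] /eqP ji' /orP[] /eqP ii'; rewrite ?ji' ?ii' //.
  - by move: ij; rewrite ji' ii' ltnn.
  - by move: ij; rewrite ji' ii' => ji; have := ltn_trans ji ij'; rewrite ltnn.
  - by move: ij; rewrite ji' ii' ltnn.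
rewrite -(card_in_imset inj); congr #|pred_of_set _|; apply/setP => s.
apply/imsetP/imsetP => [[[i j]]|[[i j]]]; rewrite !inE /=; last first.
  by move=> /andP[_ eij] ->; exists (i, j) => //; rewrite inE.
move=> eij ->; case: (ltngtP i j) => ij.
- by exists (i, j) => //; rewrite inE ij.
- by exists (j, i); rewrite /= 1?inE ?ij 1?edge_sym// finset.setUC.
- by move: eij; rewrite (val_inj ij) edge_irrefl.
Qed.

Section SubdividedGraphs.
Variables (V E : finType) (H : multigraph V E) (m k : nat).
Hypothesis m_ge2 : (2 <= m)%N.
Local Notation X := (V + E * 'I_m)%type.
Variables (F : sgraph 'I_k) (phi : 'I_k -> X) (psi : X -> 'I_k).
Hypotheses (phiK : cancel phi psi) (psiK : cancel psi phi).
Hypothesis edgeF : forall u v, edge F u v = edge (subdivision H m.+1) (phi u) (phi v).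

Local Notation sv := (subdiv_vertex H m.+1).

Lemma subdiv_vertex_inner (a : E) i (im : (i < m)%N) : sv a i.+1 = inr (a, Ordinal im).
Proof. by rewrite /= insubT. Qed.

Lemma subdiv_vertex_last (a : E) : sv a m.+1 = inl (ends H a).2.
Proof. by rewrite /= insubF// ltnn. Qed.

(** An inner vertex determines the path on which it lies and its position there. *)
Lemma subdiv_vertex_inj (a b : E) (i j : nat) : (0 < i <= m)%N -> (j <= m.+1)%N ->
  sv a i = sv b j -> a = b /\ i = j.
Proof.
case: i => [//|i] im; case: j => [|j] jm; first by rewrite /= insubT.
rewrite (subdiv_vertex_inner a im).
move: jm; rewrite ltnS leq_eqVlt => /orP[/eqP ->|jm]; first by rewrite subdiv_vertex_last.
by rewrite (subdiv_vertex_inner b jm) => -[-> ->].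
Qed.

Let pos (ai : E * 'I_m.+1) : 'I_k * 'I_k :=
  let u := psi (sv ai.1 ai.2) in let v := psi (sv ai.1 ai.2.+1) in
  if (u < v)%N then (u, v) else (v, u).

Let posE a (i : 'I_m.+1) : pos (a, i) =
  if (psi (sv a i) < psi (sv a i.+1))%N then (psi (sv a i), psi (sv a i.+1))
  else (psi (sv a i.+1), psi (sv a i)).
Proof. by []. Qed.

(** At least two inner vertices on every path exclude that two consecutive pairs agree up
    to order: one of the two vertices is inner and fixes the path and the position. *)
Lemma pos_inj : injective pos.
Proof.
have straight a b (i j : 'I_m.+1) : sv a i = sv b j -> sv a i.+1 = sv b j.+1 -> (a, i) = (b, j).
  move=> e1 e2; have im := ltn_ord i; have jm := ltn_ord j.
  have [i0|i0] := posnP i.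
    have [||-> ij] := subdiv_vertex_inj _ _ e2; [lia|lia|].
    by congr (_, _); apply: val_inj; move: ij => /=; lia.
  have [||-> ij] := subdiv_vertex_inj _ _ e1; [lia|lia|].
  by congr (_, _); apply: val_inj.
have crossed a b (i j : 'I_m.+1) : sv a i = sv b j.+1 -> sv a i.+1 = sv b j -> False.
  move=> e1 e2; have im := ltn_ord i; have jm := ltn_ord j.
  have [i0|i0] := posnP i.
    have [||ab ij] := subdiv_vertex_inj _ _ e2; [lia|lia|].
    by have [||_] := subdiv_vertex_inj _ _ (esym e1); lia.
  have [||ab ij] := subdiv_vertex_inj _ _ e1; [lia|lia|].
  have [j0|j0] := posnP j.
    by have [||_] := subdiv_vertex_inj _ _ e2; lia.
  by have [||_] := subdiv_vertex_inj _ _ (esym e2); lia.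
have psi_inj := can_inj psiK.
move=> [a i] [b j]; rewrite /pos /=; case: ifP => _; case: ifP => _ [] /psi_inj e1 /psi_inj e2.
- exact: straight.
- by case: (crossed a b i j).
- by case: (crossed a b i j).
- exact: straight.
Qed.

Lemma pos_image : pos @: [set: E * 'I_m.+1] = ordered_edges F.
Proof.
apply/setP => -[u v]; rewrite inE /=; apply/imsetP/andP => [[[a i] _ e]|[uv]].
  have svn := subdiv_vertexS_neq H a (ltn_ord i).
  have adj : edge (subdivision H m.+1) (sv a i) (sv a i.+1).
    by apply/existsP; exists a; apply/existsP; exists i; rewrite !eqxx.
  move: e; rewrite /pos /=; case: ltngtP => uv [-> ->].
  - by rewrite uv edgeF !psiK.
  - by rewrite uv edgeF !psiK edge_sym.
  - by move: svn; rewrite -(psiK (sv a i)) (val_inj uv) psiK eqxx.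
rewrite edgeF => /existsP[a] /existsP[i] /orP[] /andP[/eqP e1 /eqP e2];
  (exists (a, i); first by rewrite inE); rewrite posE -e1 -e2 !phiK ?uv//.
by rewrite ltnNge ltnW.
Qed.

(** The edges of F are the pairs of consecutive vertices on the paths replacing the edges
    of H, each occurring once, in the order given by the labels of F. *)
Lemma edge_weight_subdivided (R : realFieldType) (T : finType) (W : T -> T -> R)
    (g : {ffun X -> T}) : (forall x y, W x y = W y x) ->
  edge_weight F W (g \o phi) = subdiv_weight (ends H) W g.
Proof.
move=> Wsym; rewrite edge_weightE -pos_image big_imset/=; last by move=> ? ? _ _ /pos_inj.
rewrite (eq_bigl predT) => [|ai]; last by rewrite inE.
transitivity (\prod_(ai : E * 'I_m.+1) W (g (sv ai.1 ai.2)) (g (sv ai.1 ai.2.+1))).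
  by apply: eq_bigr => -[a i] _; rewrite /pos /=; case: ifP => _; rewrite /= !psiK.
rewrite -(pair_bigA _ (fun a (i : 'I_m.+1) => W (g (sv a i)) (g (sv a i.+1))))/=.
apply: eq_bigr => a _; set x := g (inl (ends H a).1); set y := g (inl (ends H a).2).
rewrite (path_weightE _ _ _ _ x) size_map size_enum_ord.
have nthE i : (i <= m.+1)%N ->
    nth x (x :: rcons [seq g (inr (a, j)) | j <- enum 'I_m] y) i = g (sv a i).
  case: i => [//|i] im; rewrite [LHS]/= nth_rcons size_map size_enum_ord.
  case: (ltngtP i m) => [lt|gt|->]; last by rewrite subdiv_vertex_last.
    rewrite (nth_map (Ordinal lt)) ?size_enum_ord// (subdiv_vertex_inner a lt).
    by congr (g (inr (a, _))); apply: val_inj; rewrite /= nth_enum_ord.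
  by move: im; rewrite ltnS leqNgt gt.
by apply: eq_bigr => i _; rewrite !nthE// ltnW.
Qed.

Lemma sum_inj_reindex (R : realFieldType) (T : finType) (f : ('I_k -> T) -> R) :
  (forall g g', g =1 g' -> f g = f g') ->
  \sum_(g : {ffun 'I_k -> T} | injectiveb g) f g =
  \sum_(g : {ffun X -> T} | injectiveb g) f (g \o phi).
Proof.
move=> fext; rewrite (reindex (fun g : {ffun X -> T} => [ffun u => g (phi u)]))/=; last first.
  exists (fun g => [ffun v => g (psi v)]) => g _; apply/ffunP => u; rewrite !ffunE.
    by rewrite psiK.
  by rewrite phiK.
apply: eq_big => [g|g _]; last by apply: fext => u; rewrite ffunE.
apply/injectiveP/injectiveP => g_inj u v.
  move=> guv; rewrite -(psiK u) -(psiK v); congr phi; apply: g_inj.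
  by rewrite !ffunE !psiK.
by rewrite !ffunE => /g_inj/(can_inj phiK).
Qed.

End SubdividedGraphs.

Lemma eq_edge_weight (R : comNzRingType) k (F : sgraph 'I_k) T (W : T -> T -> R) g g' :
  g =1 g' -> edge_weight F W g = edge_weight F W g'.
Proof. by move=> gg'; apply: eq_bigr => i _; apply: eq_bigr => j _; rewrite !gg'. Qed.

Lemma emb_edge_weight (R : realFieldType) k (F : sgraph 'I_k) (W : finType) (G : sgraph W) :
  (emb F G)%:R = \sum_(g : {ffun 'I_k -> W} | injectiveb g)
    edge_weight F (fun x y => (edge G x y)%:R) g :> R.
Proof.
rewrite /emb -sum1dep_card natr_sum big_mkcondr/=; apply: eq_bigr => g _.
case: ifPn => [/forallP hom|].
  rewrite edge_weightE big1// => -[i j]; rewrite inE /= => /andP[_ eij].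
  by have /forallP/(_ j)/implyP/(_ eij) -> := hom i.
rewrite negb_forall => /existsP[u]; rewrite negb_forall => /existsP[v].
rewrite negb_imply => /andP[euv nuv]; rewrite edge_weightE; apply/esym.
wlog uv : u v euv nuv / (u < v)%N.
  move=> hw; case: (ltngtP u v) => uv; first exact: (hw u v).
    by apply: (hw v u) => //; rewrite edge_sym.
  by move: euv; rewrite (val_inj uv) edge_irrefl.
by rewrite (bigD1 (u, v)) ?inE ?uv//= (negbTE nuv) mul0r.
Qed.

(** * Stars, degrees and paths in a graph *)

Section Stars.
Variable k : nat.

Definition star_rel : rel 'I_k.+1 := fun u v => (u == ord0) (+) (v == ord0).

Lemma star_sym : symmetric star_rel.
Proof. by move=> u v; rewrite /star_rel addbC. Qed.

Lemma star_irrefl : irreflexive star_rel.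
Proof. by move=> u; rewrite /star_rel addbb. Qed.

Definition star : sgraph 'I_k.+1 := SGraph star_sym star_irrefl.

Lemma star_is_tree : is_tree star.
Proof.
split; first by rewrite card_ord.
- have to0 u : connect star u ord0.
    have [->|u0] := eqVneq u ord0; first exact: connect0.
    by apply: connect1; rewrite /= /star_rel eqxx (negbTE u0).
  move=> u v; apply: connect_trans (to0 u) _.
  by rewrite (sym_connect_sym star_sym).
- case=> [|x [|y [|z s]]]//= _ /andP[].
  rewrite /star_rel => /= /and3P[xy yz zs] /and4P[xn yn _ _].
  have [y0|y0] := eqVneq y ord0; last first.
    move: xy yz; rewrite (negbTE y0) addbF addFb => /eqP x0 /eqP z0.
    by move: xn; rewrite x0 z0 !inE eqxx orbT.
  move: xy yz; rewrite y0 eqxx addbT addTb => x0 z0.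
  case: s zs yn {xn} => [|w s] /=; rewrite (negbTE z0) addFb.
    by rewrite (negbTE x0).
  by move=> /andP[/eqP -> _]; rewrite y0 !inE eqxx orbT.
Qed.

Lemma card_edges_star : #|edges star| = k.
Proof.
rewrite card_edges -[RHS](card_ord k).
rewrite -(card_imset predT (f := fun j : 'I_k => (@ord0 k, lift ord0 j))) => [|i j /(congr1 snd) ij]; last exact: lift_inj ij.
congr #|pred_of_set _|; apply/setP => -[i j]; rewrite inE /= /star_rel.
apply/andP/imsetP => [[ij]|[j' _ [-> ->]]]; last by rewrite eqxx.
have j0 : j != ord0 by apply/eqP => j0; move: ij; rewrite j0.
rewrite (negbTE j0) addbF => /eqP ->.
case: (unliftP ord0 j) => [j' ->|jj]; first by exists j'.
by rewrite jj in j0.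
Qed.

Variables (W : finType) (G : sgraph W).

Definition deg x : nat := #|[set y | edge G x y]|.

(** A star with k edges is a centre together with an injective choice of k neighbours. *)
Lemma sum_deg_ffact_le : (\sum_x deg x ^_ k <= emb star G)%N.
Proof.
pose build (xg : W * {ffun 'I_k -> W}) : {ffun 'I_k.+1 -> W} :=
  [ffun i => if unlift ord0 i is Some j then xg.2 j else xg.1].
have build0 xg : build xg ord0 = xg.1 by rewrite ffunE unlift_none.
have buildS xg j : build xg (lift ord0 j) = xg.2 j by rewrite ffunE liftK.
have build_inj : injective build.
  move=> [x g] [y h] e; congr (_, _).
    by have := congr1 (fun f : {ffun _ -> _} => f ord0) e; rewrite !build0.
  apply/ffunP => j.
  by have := congr1 (fun f : {ffun _ -> _} => f (lift ord0 j)) e; rewrite !buildS.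
pose S := [set xg : W * {ffun 'I_k -> W} |
  (xg.2 \in ffun_on (mem [set y | edge G xg.1 y])) && injectiveb xg.2].
have -> : (\sum_x deg x ^_ k)%N = #|S|.
  rewrite -sum1_card (eq_bigl (fun xg : W * {ffun 'I_k -> W} => predT xg.1 &&
    ((xg.2 \in ffun_on (mem [set y | edge G xg.1 y])) && injectiveb xg.2))) => [|xg]; last first.
    by rewrite inE.
  rewrite -(pair_big_dep predT (fun x (g : {ffun 'I_k -> W}) =>
    (g \in ffun_on (mem [set y | edge G x y])) && injectiveb g) (fun _ _ => 1%N))/=.
  apply: eq_bigr => x _; rewrite sum1_card -[k in LHS]card_ord -card_inj_ffuns_on.
  by apply: eq_card => g; rewrite !inE.
rewrite -(card_imset _ build_inj) /emb; apply: subset_leq_card.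
apply/fintype.subsetP => f /imsetP[[x g]]; rewrite inE /= => /andP[/ffun_onP gx /injectiveP g_inj] ->.
have adj j : edge G x (g j) by have := gx j; rewrite inE.
rewrite inE; apply/andP; split.
  apply/injectiveP => i j.
  case: (unliftP ord0 i) => [i' ->|->]; case: (unliftP ord0 j) => [j' ->|->] //;
    rewrite ?build0 ?buildS /=.
  - by move=> /g_inj ->.
  - by move=> e; have := adj i'; rewrite e edge_irrefl.
  - by move=> e; have := adj j'; rewrite -e edge_irrefl.
apply/forallP => i; apply/forallP => j; apply/implyP; rewrite /= /star_rel.
case: (unliftP ord0 i) => [i' ->|->]; case: (unliftP ord0 j) => [j' ->|->];
  rewrite ?build0 ?buildS ?eqxx//= => _.
by rewrite edge_sym.
Qed.

End Stars.

Lemma expn_ffact_le n k j : (j <= k)%N -> ((n - k) ^ j <= n ^_ j)%N.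
Proof.
elim: j => [|j IH] jk; first by rewrite ffactn0.
by rewrite ffactnSr expnSr leq_mul ?IH ?leq_sub2l// ltnW.
Qed.

Lemma expn_le_ffact d k : (d ^ k <= (2 * k) ^ k + 2 ^ k * d ^_ k)%N.
Proof.
case: k => [|k]; first by rewrite !expn0.
case: (leqP d (2 * k.+1)) => dk.
  by rewrite (leq_trans _ (leq_addr _ _))// leq_exp2r.
rewrite (leq_trans _ (leq_addl _ _))//.
apply: (@leq_trans (2 ^ k.+1 * (d - k.+1) ^ k.+1)); last by rewrite leq_mul2l expn_ffact_le// orbT.
by rewrite -expnMn leq_exp2r//; lia.
Qed.

Section Densities.
Variables (R : realType) (n : nat) (G : sgraph 'I_n) (p : R).
Hypothesis p_gt0 : 0 < p.

Definition adjacency (x y : 'I_n) : R := (edge G x y)%:R / p.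

Lemma adjacency_ge0 x y : 0 <= adjacency x y.
Proof. by rewrite divr_ge0// ltW. Qed.

Lemma adjacency_sym x y : adjacency x y = adjacency y x.
Proof. by rewrite /adjacency edge_sym. Qed.

(** Falling factorials of the degree count stars, and powers of the degree exceed
    them by a bounded factor, up to a bounded error. *)
Lemma degree_moment_le k (M : R) : 1 <= n%:R * p -> 0 <= M ->
  emb_density p (star k) G <= M ->
  avg (fun x => degree adjacency x ^+ k) <= (2 * k)%:R ^+ k + 2 ^+ k * M.
Proof.
move=> np M0 embM; have np0 : 0 < n%:R * p by lra.
have n0 : 0 < n%:R :> R by rewrite -(pmulr_lgt0 _ p_gt0).
have degE x : degree adjacency x = (deg G x)%:R / (n%:R * p).
  rewrite /degree /avg /adjacency -mulr_suml card_ord -natr_sum -big_mkcond/=.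
  rewrite sum1_card invfM mulrA mulrAC; congr (_%:R / _ / _).
  by apply: eq_card => y; rewrite inE.
have stars : (\sum_x deg G x ^_ k)%:R <= M * (p ^+ k * n%:R ^+ k.+1).
  apply: (@le_trans _ _ (emb (star k) G)%:R); first by rewrite ler_nat sum_deg_ffact_le.
  move: embM; rewrite /emb_density !card_ord card_edges_star; case: ifPn => kn.
    have ff0 : 0 < (n ^_ k.+1)%:R :> R by rewrite ltr0n ffact_gt0.
    rewrite ler_pdivrMr ?mulr_gt0 ?exprn_gt0// => h; apply: le_trans h _.
    rewrite ler_wpM2l//; apply: ler_wpM2l; first by rewrite exprn_ge0 ?ltW.
    rewrite -natrX ler_nat.
    by rewrite ffact_prod -[in leqRHS](card_ord k.+1) -prod_nat_const leq_prod// => i _; rewrite leq_subr.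
  move=> _; rewrite (_ : emb _ _ = 0%N); first by rewrite !mulr_ge0 ?exprn_ge0// ltW.
  apply/eqP; rewrite cards_eq0; apply/eqP/setP => f; rewrite !inE; apply/negP.
  move=> /andP[/injectiveP f_inj _]; move: kn; have := leq_card f f_inj.
  by rewrite !card_ord => ->.
under eq_avg do rewrite degE expr_div_n -natrX.
rewrite avgZr /avg card_ord -mulrA -invfM ler_pdivrMr ?mulr_gt0 ?exprn_gt0//.
rewrite -natr_sum; apply: (@le_trans _ _ (\sum_(x < n) ((2 * k) ^ k + 2 ^ k * deg G x ^_ k)%N)%:R).
  by rewrite ler_nat leq_sum// => x _; exact: expn_le_ffact.
rewrite big_split/= sum_nat_const card_ord -big_distrr/= natrD !natrM !natrX mulrDl.
apply: lerD.
  rewrite mulrC natrM; apply: ler_wpM2l; first by rewrite exprn_ge0// mulr_ge0.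
  by apply: ler_peMr; rewrite ?exprn_ege1// ltW.
rewrite -mulrA ler_wpM2l ?exprn_ge0//; apply: le_trans stars _.
by rewrite exprMn exprS le_eqVlt; apply/orP; left; apply/eqP; ring.
Qed.

Definition path_density t x y : R := (npaths G t x y)%:R / (n%:R ^+ t.-1 * p ^+ t).

(** Walks whose vertices have distinct prescribed colours are paths. *)
Lemma chain_le_path_density (X : eqType) (c : 'I_n -> X) (i0 i1 : X) (cs : seq X) x y :
  uniq (i0 :: rcons cs i1) -> c x = i0 -> c y = i1 ->
  chain adjacency [seq (fun z => c z == i) | i <- cs] x y <= path_density (size cs).+1 x y.
Proof.
move=> cs_uniq cx cy; rewrite (chain_sum _ _ _ (size_map _ _)) card_ord.
rewrite /path_density mulrC invfM mulrCA ler_wpM2l ?invr_ge0 ?exprn_ge0//.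
pose S := [set w : (size cs).-tuple 'I_n |
  lies_in [seq (fun z => c z == i) | i <- cs] w && path (edge G) x (rcons w y)].
have -> : \sum_(w : (size cs).-tuple 'I_n) (lies_in [seq (fun z => c z == i) | i <- cs] w)%:R *
    path_weight adjacency x w y = #|S|%:R / p ^+ (size cs).+1.
  rewrite -sum1dep_card natr_sum mulr_suml [RHS]big_mkcond/=; apply: eq_bigr => w _.
  rewrite path_weight_scale path_weight_edge size_tuple exprVn.
  by case: (lies_in _ _); case: (path _ _ _); rewrite ?mul0r ?mul1r.
apply: ler_wpM2r; first by rewrite invr_ge0 exprn_ge0// ltW.
rewrite ler_nat /npaths.
pose ext (w : (size cs).-tuple 'I_n) := [tuple of rcons w y].
have ext_inj : injective ext.
  by move=> w w' /(congr1 val)/= /rcons_inj[ww']; apply: val_inj.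
rewrite -(card_imset _ ext_inj); apply: subset_leq_card; apply/fintype.subsetP => u.
move=> /imsetP[w]; rewrite inE => /andP[wcs xwy] ->; rewrite inE xwy last_rcons eqxx andbT.
have wc : map c w = cs.
  have lies (cs' : seq X) (w' : seq 'I_n) :
      lies_in [seq (fun z => c z == i) | i <- cs'] w' -> map c w' = cs'.
    by elim: w' cs' => [|z w' IH] [|i cs']//= /andP[/eqP -> /IH ->].
  exact: lies wcs.
apply: (@map_uniq _ _ c); rewrite /= map_rcons wc cx cy; exact: cs_uniq.
Qed.

Lemma npaths_refl t x : (0 < t)%N -> npaths G t x x = 0%N.
Proof.
case: t => // t _; apply/eqP; rewrite cards_eq0; apply/eqP/setP => w; rewrite !inE.
apply/negP => /and3P[_ /andP[xw _] /eqP lx]; case/tupleP: w xw lx => z w xw lx.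
by move: lx xw => /= <-; rewrite mem_last.
Qed.

Lemma path_density_moment t k (K : R) : (0 < t)%N -> (0 < k)%N -> (0 < n)%N ->
  \sum_(u < n) \sum_(v < n | v != u) (npaths G t u v)%:R ^+ k <=
    K * (n%:R ^+ (2 + k * t.-1) * p ^+ (k * t)) ->
  avg (fun x => avg (fun y => path_density t x y ^+ k)) <= K.
Proof.
move=> t0 k0 n0 h; have n0' : 0 < n%:R :> R by rewrite ltr0n.
rewrite /path_density; under eq_avg do under eq_avg do rewrite expr_div_n.
under eq_avg do rewrite avgZr.
rewrite avgZr -(avg_pair (fun xy => (npaths G t xy.1 xy.2)%:R ^+ k)) /avg card_prod card_ord.
rewrite -(pair_bigA _ (fun x y => (npaths G t x y)%:R ^+ k))/=.
rewrite -mulrA -invfM ler_pdivrMr ?mulr_gt0 ?exprn_gt0 ?mulr_gt0 ?exprn_gt0// ?ltr0n ?muln_gt0 ?n0//.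
apply: le_trans (le_trans h _); last first.
  rewrite natrM exprMn -!exprM !exprD le_eqVlt; apply/orP; left; apply/eqP.
  by rewrite [(k * t)%N]mulnC [(k * _)%N]mulnC; ring.
apply: ler_sum => u _; rewrite (bigD1 u)//= npaths_refl// expr0n eqn0Ngt k0 add0r.
by [].
Qed.

End Densities.

(** * Subdivisions in a graph close to a bounded kernel *)

(** A product of factors 1 - i / n is at least one minus the sum of the i / n. *)
Lemma ffact_ratio_ge (R : realFieldType) (n k : nat) : (0 < n)%N ->
  1 - (k * k)%:R / n%:R <= (n ^_ k)%:R / n%:R ^+ k :> R.
Proof.
move=> n0; have n0' : 0 < n%:R :> R by rewrite ltr0n.
elim: k => [|k IH]; first by rewrite mul0r subr0 ffactn0 divr1.
set r : R := (n ^_ k)%:R / n%:R ^+ k in IH.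
have r0 : 0 <= r by rewrite divr_ge0.
have r1 : r <= 1.
  rewrite ler_pdivrMr ?exprn_gt0// mul1r -natrX ler_nat.
  by rewrite ffact_prod -[in leqRHS](card_ord k) -prod_nat_const leq_prod// => i _; rewrite leq_subr.
have -> : (n ^_ k.+1)%:R / n%:R ^+ k.+1 = r * ((n - k)%:R / n%:R).
  by rewrite ffactnSr natrM exprSr invfM /r mulrACA.
have h : 1 - k%:R / n%:R <= (n - k)%:R / n%:R :> R.
  rewrite -(@ler_pM2r _ n%:R)// mulrBl mul1r !divfK ?gt_eqF//.
  case: (leqP k n) => kn; first by rewrite natrB.
  by rewrite (@le_trans _ _ 0)// subr_le0 ler_nat ltnW.
apply: (@le_trans _ _ (r * (1 - k%:R / n%:R))); last by rewrite ler_wpM2l.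
have -> : (k.+1 * k.+1)%:R / n%:R = (k * k)%:R / n%:R + k%:R / n%:R + k.+1%:R / n%:R :> R.
  by rewrite -!mulrDl -!natrD; congr (_%:R / _); lia.
have a0 : 0 <= k%:R / n%:R :> R by rewrite divr_ge0.
have b0 : 0 <= k.+1%:R / n%:R :> R by rewrite divr_ge0.
nra.
Qed.

Section DiscreteCounting.
Variables (R : realType) (V E : finType) (H : multigraph V E) (m k : nat).
Hypothesis m_ge2 : (2 <= m)%N.
Local Notation X := (V + E * 'I_m)%type.
Variables (F : sgraph 'I_k) (phi : 'I_k -> X) (psi : X -> 'I_k).
Hypotheses (phiK : cancel phi psi) (psiK : cancel psi phi).
Hypothesis edgeF : forall u v, edge F u v = edge (subdivision H m.+1) (phi u) (phi v).
Variables (C Q : R) (S P : nat -> R).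
Hypothesis C_ge1 : 1 <= C.

Record path_regular (n : nat) (G : sgraph 'I_n) (p : R) : Prop := PathRegular {
  regular_stars : forall j, emb_density p (star j) G <= S j;
  regular_pred : avg (fun x => avg (fun y => path_density G p m x y ^+ 2)) <= Q;
  regular_paths : forall j, (0 < j)%N ->
    avg (fun x => avg (fun y => path_density G p m.+1 x y ^+ j)) <= P j }.

Lemma coloured_chain_le_path_density n (G : sgraph 'I_n) (p : R) (c : {ffun 'I_n -> X}) e x y : 0 < p ->
  coloured_chain (ends H) (adjacency G p) c e x y <= path_density G p m.+1 x y.
Proof.
move=> p0; rewrite /coloured_chain; have [/andP[/eqP cx /eqP cy]|_] := boolP (_ && _).
  rewrite mul1r; pose cs : seq X := [seq inr (e, j) | j <- enum 'I_m].
  have -> : inner_classes c e = [seq (fun z => c z == i) | i <- cs] by rewrite -map_comp.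
  have sz : size cs = m by rewrite size_map size_enum_ord.
  rewrite -[X in path_density G p X.+1]sz.
  apply: (@chain_le_path_density _ _ G _ p0 _ c _ _ cs x y _ cx cy).
  have inlP (v : V) : inl v \notin cs by apply/negP => /mapP[].
  rewrite cons_uniq mem_rcons inE negb_or inlP andbT rcons_uniq inlP /=.
  rewrite map_inj_uniq ?enum_uniq ?andbT => [|i j [//]].
  by apply: contra (ends_loopless H e) => /eqP[->].
by rewrite mul0r divr_ge0// mulr_ge0// exprn_ge0// ltW.
Qed.

Lemma inner_chain_le_path_density n (G : sgraph 'I_n) (p : R) (c : {ffun 'I_n -> X}) e V0 s z y :
  0 < p -> inner_classes c e = V0 :: s ->
  (V0 z)%:R * chain (adjacency G p) s z y * (c y == inl (ends H e).2)%:R <=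
    path_density G p m z y.
Proof.
move=> p0; have pd0 : 0 <= path_density G p m z y.
  by rewrite divr_ge0 ?mulr_ge0 ?exprn_ge0// ltW.
rewrite /inner_classes; have := enum_uniq 'I_m; have := size_enum_ord m.
case: (enum 'I_m) => [//|j0 r] /= sm /andP[j0r r_uniq] [<- <-].
case: eqP => [cz|]; last by rewrite !mul0r.
case: eqP => [cy|]; last by rewrite mulr0.
rewrite mul1r mulr1; pose cs : seq X := [seq inr (e, j) | j <- r].
have -> : [seq (fun z => c z == inr (e, j)) | j <- r] = [seq (fun z => c z == i) | i <- cs].
  by rewrite -map_comp.
have sz : (size cs).+1 = m by rewrite size_map.
rewrite -[X in path_density G p X]sz.
apply: (@chain_le_path_density _ _ G _ p0 _ c _ _ cs z y _ cz cy).
have inlP (v : V) : inl v \notin cs by apply/negP => /mapP[].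
rewrite cons_uniq mem_rcons inE negb_or /= rcons_uniq inlP.
rewrite map_inj_uniq ?r_uniq ?andbT => [|i j [//]].
by apply/negP => /mapP[j jr [jj]]; move: j0r; rewrite jj jr.
Qed.

(** If n p >= 1, the star counts bound all moments of the degrees and chain_close applies.
    If n p < 1, both chains are small in L1. In the graph, path counts are integers, so
    that the path density is at most sigma times its square with sigma <= 1 / n; in the
    limit, sparse_small applies. *)
Lemma coloured_chain_close (eta : R) : 0 < eta ->
  exists2 delta, 0 < delta & exists N : nat, forall n (G : sgraph 'I_n) (p : R) (K : 'I_n -> 'I_n -> R),
    (N <= n)%N -> 0 < p -> path_regular G p ->
    (forall x y, 0 <= K x y <= C) -> (forall x y, K x y = K y x) ->
    cut_bound delta (fun x y => adjacency G p x y - K x y) ->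
    forall (c : {ffun 'I_n -> X}) e, norm1 (fun x y =>
      coloured_chain (ends H) (adjacency G p) c e x y -
      coloured_chain (ends H) K c e x y) <= eta.
Proof.
move=> eta0; have C1 := C_ge1; have C0 : 0 <= C by lra.
pose mom j : R := (2 * j)%:R ^+ j + 2 ^+ j * `|S j|.
have mom0 j : 0 <= mom j by rewrite addr_ge0 ?mulr_ge0 ?exprn_ge0.
have [d1 d10 dense] := chain_close C0 mom0 m.-1 (normr_ge0 Q) eta0.
have Cm0 : 0 < C ^+ m by rewrite exprn_gt0//; lra.
(* b makes both bounds of the sparse regime small, for delta <= b / 2 and n >= 1 / b *)
pose b := Num.min ((4 * C)^-1) (eta / (2 * (3 * C ^+ m))).
have b0 : 0 < b.
  have ? : 0 < 4 * C by lra.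
  by rewrite lt_min invr_gt0; apply/andP; split=> //; rewrite divr_gt0 ?mulr_gt0.
exists (Num.min d1 (b / 2)); first by rewrite lt_min d10 divr_gt0.
exists (Num.truncn (b^-1 + 2 * (`|P 2| + 1) / eta)).+1 => n G p K nN p0 [stars predl paths] Kb Ksym cutK c e.
have P20 : 0 < `|P 2| + 1 by rewrite ltr_wpDl.
have nR : b^-1 + 2 * (`|P 2| + 1) / eta < n%:R.
  by apply: lt_le_trans (truncnS_gt _) _; rewrite ler_nat.
have bi0 : 0 < b^-1 by rewrite invr_gt0.
have Pe0 : 0 < 2 * (`|P 2| + 1) / eta by rewrite divr_gt0 ?mulr_gt0.
have n0 : 0 < n%:R :> R by lra.
have n0' : (0 < n)%N by rewrite -(ltr0n R).
have a0 := adjacency_ge0 G p0; have asym := adjacency_sym G p.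
have K0 x y : 0 <= K x y by case/andP: (Kb x y).
have size_classes := size_inner_classes c e.
have [np|np] := leP 1 (n%:R * p).
- have approx : cut_approx C (Num.min d1 (b / 2)) mom (adjacency G p) K.
    split=> // j; apply: degree_moment_le => //.
    by apply: le_trans (stars j) _; rewrite ler_norm.
  pose V' : pred 'I_n := fun y => c y == inl (ends H e).2.
  apply: (@le_trans _ _ (norm1 (fun x y => (chain (adjacency G p) (inner_classes c e) x y -
      chain K (inner_classes c e) x y) * (V' y)%:R))).
    apply: ler_norm1 => x y; rewrite /coloured_chain -mulrBr mulrC !normrM ler_wpM2l//.
    by rewrite !normr_nat ler_nat /V'; case: (c x == _).
  case classesE : (inner_classes c e) size_classes => [|V0 s]; first by case: m m_ge2.
  move=> sz; have sm : size s = m.-1 by rewrite -sz.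
  apply: (dense _ _ _ _ _ V0 V' s approx sm); first by rewrite ge_min lexx.
  apply: le_trans (ler_norm Q); apply: le_trans predl.
  apply: ler_avg => z; apply: ler_avg => y.
  have pd0 : 0 <= path_density G p m z y by rewrite divr_ge0 ?mulr_ge0 ?exprn_ge0// ltW.
  have ch0 : 0 <= (V0 z)%:R * chain (adjacency G p) s z y * (V' y)%:R.
    by rewrite !mulr_ge0// chain_ge0.
  rewrite lerXn2r ?nnegrE//.
  exact: inner_chain_le_path_density classesE.
pose sigma : R := n%:R ^+ m * p ^+ m.+1.
have sigma0 : 0 < sigma by rewrite mulr_gt0 ?exprn_gt0.
have sigma_le : sigma <= n%:R^-1.
  rewrite -(@ler_pM2l _ n%:R)// divff ?gt_eqF// mulrA -exprS -exprMn.
  by apply: exprn_ile1; [rewrite mulr_ge0// ltW | exact: ltW].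
have few : avg (fun x => avg (fun y => path_density G p m.+1 x y)) <= eta / 2.
  apply: (@le_trans _ _ (sigma * avg (fun x => avg (fun y => path_density G p m.+1 x y ^+ 2)))).
    rewrite -avgZl; apply: ler_avg => x; rewrite -avgZl; apply: ler_avg => y.
    have -> : sigma * path_density G p m.+1 x y ^+ 2 = (npaths G m.+1 x y)%:R ^+ 2 / sigma.
      by rewrite /path_density -/sigma; field; rewrite gt_eqF.
    rewrite /path_density -/sigma; apply: ler_wpM2r; first by rewrite invr_ge0 ltW.
    by rewrite -natrX ler_nat; case: (npaths _ _ _ _) => // q; rewrite -mulnn leq_pmulr.
  apply: (@le_trans _ _ (n%:R^-1 * (`|P 2| + 1))).
    apply: ler_pM => //; [exact: ltW|by apply: avg_ge0 => x; apply: avg_ge0 => y; exact: sqr_ge0|].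
    by apply: le_trans (paths 2 isT) _; apply: le_trans (ler_norm _) _; rewrite lerDl.
  rewrite mulrC ler_pdivrMr//; have : 2 * (`|P 2| + 1) <= n%:R * eta.
    by rewrite -ler_pdivrMr//; lra.
  lra.
have [d1' d2'] : Num.min d1 (b / 2) <= b / 2 /\ b <= (4 * C)^-1 by rewrite !ge_min !lexx orbT.
have d3' : b <= eta / (2 * (3 * C ^+ m)) by rewrite ge_min lexx orbT.
have ninv : n%:R^-1 <= b.
  by rewrite -[leRHS]invrK lef_pV2 ?posrE//; lra.
have C4 : (4 * C)^-1 + (4 * C)^-1 = (2 * C)^-1 by field; lra.
have Ksmall : avg (fun x => avg (K x)) <= 3 * Num.min d1 (b / 2).
  by apply: (sparse_small C_ge1 p0 _ Kb cutK) => //; rewrite card_ord//; lra.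
apply: (@le_trans _ _ (avg (fun x => avg (fun y => path_density G p m.+1 x y)) +
    avg (fun x => avg (chain K (inner_classes c e) x)))).
  rewrite -avgD; apply: ler_avg => x; rewrite -avgD; apply: ler_avg => y.
  apply: le_trans (ler_normB _ _) _; apply: lerD.
    rewrite ger0_norm; first exact: coloured_chain_le_path_density.
    by rewrite mulr_ge0// chain_ge0.
  rewrite ger0_norm; first by rewrite ler_piMl ?chain_ge0//; case: (_ && _).
  by rewrite mulr_ge0// chain_ge0.
have -> : eta = eta / 2 + eta / 2 by field.
apply: lerD => //; apply: le_trans (avg_chain_bound _ C0 Kb) _.
rewrite size_classes; apply: (@le_trans _ _ (C ^+ m * (3 * (eta / (2 * (3 * C ^+ m)))))).
  by rewrite ler_wpM2l ?ltW//; lra.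
by rewrite le_eqVlt; apply/orP; left; apply/eqP; field; rewrite gt_eqF.
Qed.

(** The count of injective maps is close to that in the limit by coloured_chain_close and
    inj_sum_close; passing to all maps, and from n ^_ k to n ^ k, costs k ^ 2 / n. *)
Lemma discrete_counting (eps : R) : 0 < eps ->
  exists2 delta, 0 < delta & exists N : nat, forall n (G : sgraph 'I_n) (p : R)
      (K : 'I_n -> 'I_n -> R),
    (N <= n)%N -> 0 < p -> path_regular G p ->
    (forall x y, 0 <= K x y <= C) -> (forall x y, K x y = K y x) ->
    cut_bound delta (fun x y => adjacency G p x y - K x y) ->
    `|emb_density p F G - avg (fun g : {ffun 'I_k -> 'I_n} => edge_weight F K g)| <= eps.
Proof.
move=> eps0; have C1 := C_ge1; have C0 : 0 <= C by lra.
(* the moment of order 0 is the mean of a constant *)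
pose mom j : R := if j is 0%N then 1 else `|P j|.
have mom0 j : 0 <= mom j by case: j => [|j] /=.
have e4 : 0 < eps / 4 by rewrite divr_gt0.
have [eta eta0 closeX] := inj_sum_close m (ends_loopless H) mom0 C0 e4.
have [delta delta0 [N1 closeP]] := coloured_chain_close eta0.
pose B := C ^+ #|ordered_edges F|.
have B0 : 0 < B by rewrite exprn_gt0//; lra.
exists delta => //.
exists (N1 + (Num.truncn ((4 * B / eps + 2) * (k * k)%:R)).+1)%N => n G p K nN p0 Gp Kb Ksym cutK.
have nR : (4 * B / eps + 2) * (k * k)%:R < n%:R.
  apply: lt_le_trans (truncnS_gt _) _; rewrite ler_nat; apply: leq_trans nN.
  exact: leq_addl.
have n1 : (N1 <= n)%N by apply: leq_trans nN; exact: leq_addr.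
have Be : 0 < 4 * B / eps by rewrite divr_gt0// mulr_gt0.
have kk0 : 0 <= (k * k)%:R :> R by [].
have n0 : 0 < n%:R :> R by apply: le_lt_trans nR; rewrite mulr_ge0//; lra.
have n0' : (0 < n)%N by rewrite -(ltr0n R).
have K0 x y : 0 <= K x y by case/andP: (Kb x y).
have KW g : 0 <= edge_weight F K g <= B.
  rewrite edge_weightE; apply/andP; split; first exact: prodr_ge0.
  by rewrite /B -prodr_const; apply: ler_prod => ij _; exact: Kb.
have cardX : #|{: X}| = k.
  rewrite -[RHS]card_ord; apply: bij_eq_card (_ : bijective psi).
  by exists phi.
set rho : R := (n ^_ k)%:R / n%:R ^+ k.
have rho1 : 1 - rho <= (k * k)%:R / n%:R by have := ffact_ratio_ge R k n0'; rewrite -/rho; lra.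
have kn : (4 * B / eps + 2) * ((k * k)%:R / n%:R) <= 1.
  by rewrite mulrA ler_pdivrMr// mul1r ltW.
have kn0 : 0 <= (k * k)%:R / n%:R :> R by rewrite divr_ge0.
have rho_half : 2^-1 <= rho.
  have h : 2 * ((k * k)%:R / n%:R) <= 1 :> R.
    by apply: le_trans kn; apply: ler_wpM2r => //; lra.
  lra.
have rho_le1 : rho <= 1.
  rewrite ler_pdivrMr ?exprn_gt0// mul1r -natrX ler_nat.
  by rewrite ffact_prod -[in leqRHS](card_ord k) -prod_nat_const leq_prod// => i _; rewrite leq_subr.
have nk0 : 0 < n%:R ^+ k :> R by rewrite exprn_gt0.
have ff0 : 0 < (n ^_ k)%:R :> R.
  have : 0 < rho by lra.
  by rewrite pmulr_lgt0// invr_gt0.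
have kn' : (k <= n)%N by rewrite -ffact_gt0 -(ltr0n R).
pose Sa : R := \sum_(g : {ffun 'I_k -> 'I_n} | injectiveb g) edge_weight F (adjacency G p) g.
pose SK : R := \sum_(g : {ffun 'I_k -> 'I_n} | injectiveb g) edge_weight F K g.
have embE : emb_density p F G = Sa / (n ^_ k)%:R.
  rewrite /emb_density !card_ord kn' (emb_edge_weight R) invfM mulrA; congr (_ / _).
  rewrite mulr_suml; apply: eq_bigr => g _; rewrite !edge_weightE card_edges.
  by rewrite /adjacency big_split/= prodr_const exprVn.
have SaK : `|Sa - SK| <= eps / 4 * n%:R ^+ k.
  rewrite /Sa /SK.
  rewrite (sum_inj_reindex phiK psiK (@eq_edge_weight _ _ F _ (adjacency G p))).
  rewrite (sum_inj_reindex phiK psiK (@eq_edge_weight _ _ F _ K)).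
  have asym := adjacency_sym G p.
  have E1 (W : 'I_n -> 'I_n -> R) (g : {ffun X -> 'I_n}) : (forall x y, W x y = W y x) ->
      edge_weight F W (g \o phi) = subdiv_weight (ends H) W g.
    by move=> Wsym; rewrite (edge_weight_subdivided m_ge2 phiK psiK edgeF).
  under eq_bigr do rewrite E1//.
  under [X in _ - X]eq_bigr do rewrite E1//.
  have := closeX _ (adjacency G p) K (path_density G p m.+1) (adjacency_ge0 G p0) Kb.
  rewrite cardX card_ord; apply.
  - by move=> c e x y; exact: coloured_chain_le_path_density.
  - case=> [|j]; last by apply: le_trans (ler_norm _); apply: (regular_paths Gp).
    by do 2![apply: ler_avg_cst => // ?].
  - exact: closeP.
have tE : avg (fun g : {ffun 'I_k -> 'I_n} => edge_weight F K g) = SK / n%:R ^+ k +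
    (\sum_(g : {ffun 'I_k -> 'I_n} | ~~ injectiveb g) edge_weight F K g) / n%:R ^+ k.
  by rewrite /avg card_ffun !card_ord natrX -mulrDl [in LHS](bigID (fun g : {ffun _ -> _} => injectiveb g)).
set Sn := \sum_(g | ~~ _) _ in tE.
have card_inj : #|[pred g : {ffun 'I_k -> 'I_n} | injectiveb g]| = (n ^_ k)%N.
  rewrite -[k in RHS]card_ord -[n in RHS]card_ord -card_inj_ffuns.
  by apply: eq_card => g; rewrite !inE.
have Sn0 : 0 <= Sn by apply: sumr_ge0 => g _; case/andP: (KW g).
have SnB : Sn <= (n%:R ^+ k - (n ^_ k)%:R) * B.
  apply: (@le_trans _ _ (\sum_(g : {ffun 'I_k -> 'I_n} | ~~ injectiveb g) B)).
    by apply: ler_sum => g _; case/andP: (KW g).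
  rewrite sumr_const -[B *+ _]mulr_natl ler_wpM2r ?(ltW B0)//.
  rewrite lerBrDl -card_inj -natrD -natrX ler_nat.
  have := cardC [pred g : {ffun 'I_k -> 'I_n} | injectiveb g].
  by rewrite card_ffun !card_ord => <-; rewrite leq_add2l.
have SKB : SK <= (n ^_ k)%:R * B.
  apply: (@le_trans _ _ (\sum_(g : {ffun 'I_k -> 'I_n} | injectiveb g) B)).
    by apply: ler_sum => g _; case/andP: (KW g).
  by rewrite sumr_const -[B *+ _]mulr_natl ler_wpM2r ?(ltW B0)// -card_inj.
have SK0 : 0 <= SK by apply: sumr_ge0 => g _; case/andP: (KW g).
have h1 : `|(Sa - SK) / (n ^_ k)%:R| <= eps / 2.
  rewrite normrM normfV normr_nat ler_pdivrMr//; apply: le_trans SaK _.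
  have : n%:R ^+ k * 2^-1 <= (n ^_ k)%:R :> R by rewrite mulrC -ler_pdivlMr.
  move=> hh; have : eps * (n%:R ^+ k / 2) <= eps * (n ^_ k)%:R by rewrite ler_pM2l.
  lra.
have Brho : B * (1 - rho) <= eps / 4.
  apply: (@le_trans _ _ (B * ((k * k)%:R / n%:R))); first by rewrite ler_pM2l.
  have h : 4 * B / eps * ((k * k)%:R / n%:R) <= 1.
    by apply: le_trans kn; rewrite ler_wpM2r//; lra.
  have := ler_wpM2l (ltW e4) h.
  have -> : eps / 4 * (4 * B / eps * ((k * k)%:R / n%:R)) = B * ((k * k)%:R / n%:R).
    by field; rewrite !gt_eqF.
  by rewrite mulr1.
pose q := SK / (n ^_ k)%:R.
have q0 : 0 <= q by rewrite divr_ge0// ltW.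
have qB : q <= B by rewrite ler_pdivrMr// mulrC.
have SKq : SK / n%:R ^+ k = q * rho by rewrite /q /rho; field; rewrite !gt_eqF.
have Snq0 : 0 <= Sn / n%:R ^+ k by rewrite divr_ge0// ltW.
have Snq : Sn / n%:R ^+ k <= B * (1 - rho).
  rewrite ler_pdivrMr//; apply: le_trans SnB _; rewrite mulrC -mulrA.
  rewrite ler_pM2l// mulrBl mul1r /rho divfK ?gt_eqF//.
have qr0 : 0 <= q * (1 - rho) by rewrite mulr_ge0// subr_ge0.
have qr : q * (1 - rho) <= B * (1 - rho) by rewrite ler_wpM2r// subr_ge0.
have -> : emb_density p F G - avg (fun g : {ffun 'I_k -> 'I_n} => edge_weight F K g) =
    (Sa - SK) / (n ^_ k)%:R + (q * (1 - rho) - Sn / n%:R ^+ k).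
  by rewrite embE tE SKq mulrBl -/q; ring.
apply: le_trans (ler_normD _ _) _.
have : `|q * (1 - rho) - Sn / n%:R ^+ k| <= eps / 4 by rewrite ler_norml; lra.
lra.
Qed.

End DiscreteCounting.

(** * Expectations of bounded measurable functions *)

Section BoundedMeasurable.
Context d (T : measurableType d) (R : realType).
Implicit Types f g : T -> R.

Definition bmeas f : Prop := measurable_fun setT f /\ exists M, forall x, `|f x| <= M.

Lemma bmeas_cst c : bmeas (fun=> c).
Proof. by split; [exact: measurable_cst | exists `|c|]. Qed.

Lemma bmeasD f g : bmeas f -> bmeas g -> bmeas (fun x => f x + g x).
Proof.
move=> [mf [M fM]] [mg [N gN]]; split; first exact: measurable_funD.
by exists (M + N) => x; apply: le_trans (ler_normD _ _) _; rewrite lerD.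
Qed.

Lemma bmeasN f : bmeas f -> bmeas (fun x => - f x).
Proof.
move=> [mf [M fM]]; split; first exact: measurable_funN.
by exists M => x; rewrite normrN.
Qed.

Lemma bmeasB f g : bmeas f -> bmeas g -> bmeas (fun x => f x - g x).
Proof. by move=> bf bg; apply: bmeasD => //; exact: bmeasN. Qed.

Lemma bmeasM f g : bmeas f -> bmeas g -> bmeas (fun x => f x * g x).
Proof.
move=> [mf [M fM]] [mg [N gN]]; split; first exact: measurable_funM.
by exists (M * N) => x; rewrite normrM ler_pM.
Qed.

Lemma bmeas_prod (I : Type) (r : seq I) (Q : pred I) (F : I -> T -> R) :
  (forall i, Q i -> bmeas (F i)) -> bmeas (fun x => \prod_(i <- r | Q i) F i x).
Proof.
move=> bF; elim: r => [|i r IH].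
  rewrite (_ : (fun _ => _) = cst 1); first exact: bmeas_cst.
  by apply/funext => x; rewrite big_nil.
have [Qi|nQi] := boolP (Q i).
  rewrite (_ : (fun _ => _) = fun x => F i x * \prod_(j <- r | Q j) F j x).
    by apply: bmeasM => //; exact: bF.
  by apply/funext => x; rewrite big_cons Qi.
rewrite (_ : (fun _ => _) = fun x => \prod_(j <- r | Q j) F j x)//.
by apply/funext => x; rewrite big_cons (negbTE nQi).
Qed.

Lemma bmeas_bounds f (a b : R) : measurable_fun setT f -> (forall x, a <= f x <= b) -> bmeas f.
Proof.
move=> mf fab; split => //; exists (`|a| + `|b|) => x; have /andP[fa fb] := fab x.
have := ler_norm b; have := lerNnormlW (lexx `|a|); rewrite ler_norml.
have := normr_ge0 a; have := normr_ge0 b; lra.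
Qed.

Variable P : probability T R.
Definition expect f : R := \int[P]_x f x.

Lemma bmeas_integrable f : bmeas f -> P.-integrable setT (EFin \o f).
Proof.
move=> [mf [M fM]]; apply: measurable_bounded_integrable => //.
  by apply: (le_lt_trans (probability_le1 P measurableT)); rewrite ltry.
by exists M; split; [rewrite num_real | move=> y My x _; apply: le_trans (fM x) (ltW My)].
Qed.

Lemma expectE f : bmeas f -> (expect f)%:E = (\int[P]_x (f x)%:E)%E.
Proof.
by move=> bf; rewrite /expect /Rintegral fineK//; apply: integrable_fin_num => //;
  exact: bmeas_integrable.
Qed.

Lemma eq_expect f g : f =1 g -> expect f = expect g.
Proof. by move=> fg; apply: eq_Rintegral => x _. Qed.

Lemma expectD f g : bmeas f -> bmeas g ->
  expect (fun x => f x + g x) = expect f + expect g.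
Proof. by move=> bf bg; apply: RintegralD => //; exact: bmeas_integrable. Qed.

Lemma expectB f g : bmeas f -> bmeas g ->
  expect (fun x => f x - g x) = expect f - expect g.
Proof. by move=> bf bg; apply: RintegralB => //; exact: bmeas_integrable. Qed.

Lemma expectZl c f : bmeas f -> expect (fun x => c * f x) = c * expect f.
Proof. by move=> bf; apply: RintegralZl => //; exact: bmeas_integrable. Qed.

Lemma ler_expect f g : bmeas f -> bmeas g -> (forall x, f x <= g x) -> expect f <= expect g.
Proof. by move=> bf bg fg; apply: le_Rintegral => //; exact: bmeas_integrable. Qed.

Lemma expect_cst c : expect (fun=> c) = c.
Proof. by rewrite /expect Rintegral_cst//= probability_setT mulr1. Qed.

Lemma ler_expect_cst f c : bmeas f -> (forall x, f x <= c) -> expect f <= c.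
Proof. by move=> bf fc; rewrite -[leRHS]expect_cst; apply: ler_expect => //; exact: bmeas_cst. Qed.

Lemma expect_ge_cst f c : bmeas f -> (forall x, c <= f x) -> c <= expect f.
Proof. by move=> bf fc; rewrite -[leLHS]expect_cst; apply: ler_expect => //; exact: bmeas_cst. Qed.

Lemma bmeas_sum (I : Type) (r : seq I) (F : I -> T -> R) : (forall i, bmeas (F i)) ->
  bmeas (fun x => \sum_(i <- r) F i x).
Proof.
move=> bF; elim: r => [|i r IH].
  rewrite (_ : (fun _ => _) = cst 0); first exact: bmeas_cst.
  by apply/funext => x; rewrite big_nil.
rewrite (_ : (fun _ => _) = fun x => F i x + \sum_(j <- r) F j x); first exact: bmeasD.
by apply/funext => x; rewrite big_cons.
Qed.

Lemma expect_sum (I : Type) (r : seq I) (F : I -> T -> R) : (forall i, bmeas (F i)) ->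
  expect (fun x => \sum_(i <- r) F i x) = \sum_(i <- r) expect (F i).
Proof.
move=> bF; elim: r => [|i r IH].
  by rewrite big_nil -[RHS]expect_cst; apply: eq_expect => x; rewrite big_nil.
rewrite big_cons -IH -expectD//; last exact: bmeas_sum.
by apply: eq_expect => x; rewrite big_cons.
Qed.

End BoundedMeasurable.

Lemma bmeas_comp d1 d2 (T1 : measurableType d1) (T2 : measurableType d2) (R : realType)
    (f : T2 -> R) (g : T1 -> T2) :
  bmeas f -> measurable_fun setT g -> bmeas (fun x => f (g x)).
Proof.
move=> [mf [M fM]] mg; split; last by exists M.
exact: (measurableT_comp mf mg).
Qed.

Lemma expect_distribution d1 d2 (T1 : measurableType d1) (T2 : measurableType d2)
    (R : realType) (P : probability T1 R) (X : {RV P >-> T2}) (f : T2 -> R) :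
  bmeas f -> expect (distribution P X) f = expect P (fun x => f (X x)).
Proof.
move=> bf; rewrite /expect /Rintegral integral_distribution//.
  by apply/measurable_EFinP; case: bf.
by apply: bmeas_integrable; apply: bmeas_comp => //; exact: measurable_funPT.
Qed.

Section Fubini.
Context d1 d2 (T1 : measurableType d1) (T2 : measurableType d2) (R : realType).
Variables (P1 : probability T1 R) (P2 : probability T2 R) (f : T1 * T2 -> R).
Hypothesis bf : bmeas f.

Lemma bmeas_section1 x : bmeas (fun y => f (x, y)).
Proof. by apply: (bmeas_comp (g := fun y => (x, y)) bf); exact: pair1_measurable. Qed.

Lemma bmeas_section2 y : bmeas (fun x => f (x, y)).
Proof. by apply: (bmeas_comp (g := fun x => (x, y)) bf); exact: pair2_measurable. Qed.

Let integrable_f : (P1 \x P2)%E.-integrable setT (EFin \o f).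
Proof. exact: bmeas_integrable. Qed.

Lemma bmeas_expect1 : bmeas (fun x => expect P2 (fun y => f (x, y))).
Proof.
split.
  have h := measurable_fubini_F integrable_f.
  apply: (measurableT_comp (f := fine) _ h).
  exact: fine_measurable.
case: bf => _ [M fM]; exists M => x; rewrite ler_norml; apply/andP; split.
  apply: expect_ge_cst; first exact: bmeas_section1.
  by move=> y; have := fM (x, y); rewrite ler_norml => /andP[].
apply: ler_expect_cst; first exact: bmeas_section1.
by move=> y; have := fM (x, y); rewrite ler_norml => /andP[].
Qed.

Lemma bmeas_expect2 : bmeas (fun y => expect P1 (fun x => f (x, y))).
Proof.
split.
  have h := measurable_fubini_G integrable_f.
  apply: (measurableT_comp (f := fine) _ h).
  exact: fine_measurable.
case: bf => _ [M fM]; exists M => y; rewrite ler_norml; apply/andP; split.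
  apply: expect_ge_cst; first exact: bmeas_section2.
  by move=> x; have := fM (x, y); rewrite ler_norml => /andP[].
apply: ler_expect_cst; first exact: bmeas_section2.
by move=> x; have := fM (x, y); rewrite ler_norml => /andP[].
Qed.

Lemma expect_prod1 :
  expect P1 (fun x => expect P2 (fun y => f (x, y))) = expect (P1 \x P2)%E f.
Proof.
apply: EFin_inj; rewrite !expectE//; last exact: bmeas_expect1.
rewrite -(integral12_prod_meas1 integrable_f); apply: eq_integral => x _.
by rewrite expectE//; exact: bmeas_section1.
Qed.

Lemma expect_prod2 :
  expect P2 (fun y => expect P1 (fun x => f (x, y))) = expect (P1 \x P2)%E f.
Proof.
apply: EFin_inj; rewrite !expectE//; last exact: bmeas_expect2.
rewrite -(integral21_prod_meas1 integrable_f); apply: eq_integral => x _.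
by rewrite expectE//; exact: bmeas_section2.
Qed.

Lemma exchange_expect :
  expect P1 (fun x => expect P2 (fun y => f (x, y))) =
  expect P2 (fun y => expect P1 (fun x => f (x, y))).
Proof. by rewrite expect_prod1 expect_prod2. Qed.

End Fubini.

Section Cube.
Variable R : realType.
Local Notation lam := (@lebesgue01 R).
Local Notation cube := (@cube_measure R).

Lemma expect_cube0 (f : 0.-tuple R -> R) : bmeas f -> expect (cube 0) f = f [tuple].
Proof.
move=> bf; apply: EFin_inj; rewrite expectE//= integral_dirac//.
  by rewrite diracT mul1e.
by apply/measurable_EFinP; case: bf.
Qed.

Lemma bmeas_cons k (f : k.+1.-tuple R -> R) : bmeas f ->
  bmeas (fun ux : R * k.-tuple R => f (Defs.cons_tuple ux)).
Proof. by move=> bf; apply: bmeas_comp => //; exact: measurable_cons_tuple. Qed.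

Lemma expect_cubeS k (f : k.+1.-tuple R -> R) : bmeas f ->
  expect (cube k.+1) f = expect lam (fun u => expect (cube k) (fun x => f (Defs.cons_tuple (u, x)))).
Proof.
move=> bf; rewrite [LHS](expect_distribution _ bf).
by rewrite -expect_prod1//; exact: bmeas_cons.
Qed.

End Cube.

(** * Independent uniform coordinates *)

Section CubeLaws.
Variable R : realType.
Local Notation lam := (@lebesgue01 R).
Local Notation cube := (@cube_measure R).

Lemma tnth_cons0 k (u : R) (x : k.-tuple R) : tnth (Defs.cons_tuple (u, x)) ord0 = u.
Proof. by []. Qed.

Lemma tnth_consS k (u : R) (x : k.-tuple R) i :
  tnth (Defs.cons_tuple (u, x)) (lift ord0 i) = tnth x i.
Proof. by rewrite tnthS. Qed.

Lemma ae_lebesgue01 (f g : R -> R) : bmeas f -> bmeas g ->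
  (forall u, unit_itv u -> f u = g u) -> expect lam f = expect lam g.
Proof.
move=> [mf _] [mg _] fg; rewrite /expect /Rintegral; congr fine.
apply: ae_eq_integral => //; [exact/measurable_EFinP|exact/measurable_EFinP|].
exists (~` unit_itv)%classic; split.
- exact: measurableC (@measurable_unit_itv R).
- by rewrite /= /lebesgue01 /mrestr setICl measure0.
- by move=> u /= nfg uu; apply: nfg => _; rewrite fg.
Qed.

Lemma bmeas_pair_cons k (f : k.+1.-tuple R -> R) u : bmeas f ->
  bmeas (fun x => f (Defs.cons_tuple (u, x))).
Proof. by move=> bf; exact: (bmeas_section1 (bmeas_cons bf)). Qed.

Lemma ae_cube k (f g : k.-tuple R -> R) : bmeas f -> bmeas g ->
  (forall x, unit_cube x -> f x = g x) -> expect (cube k) f = expect (cube k) g.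
Proof.
elim: k f g => [|k IH] f g bf bg fg.
  by rewrite !expect_cube0// fg// => -[].
rewrite (expect_cubeS bf) (expect_cubeS bg); apply: ae_lebesgue01 => [||u u01].
- exact: (bmeas_expect1 lam (cube k) (bmeas_cons bf)).
- exact: (bmeas_expect1 lam (cube k) (bmeas_cons bg)).
apply: IH => [||x x01]; [exact: bmeas_pair_cons|exact: bmeas_pair_cons|].
apply: fg => i; case: (unliftP ord0 i) => [j ->|->]; first by rewrite tnth_consS; exact: x01.
by rewrite tnth_cons0.
Qed.

Definition upd k (x : k.-tuple R) (i : 'I_k) (u : R) : k.-tuple R :=
  [tuple if l == i then u else tnth x l | l < k].

Lemma measurable_upd k (i : 'I_k) :
  measurable_fun setT (fun xu : k.-tuple R * R => upd xu.1 i xu.2).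
Proof.
apply/measurable_fun_tnthP => l; rewrite (_ : _ \o _ =
  fun xu : k.-tuple R * R => if l == i then xu.2 else tnth xu.1 l).
  case: eqP => _; first exact: measurable_snd.
  exact: (measurableT_comp (measurable_tnth _) measurable_fst).
by apply/funext => xu /=; rewrite tnth_mktuple.
Qed.

Lemma bmeas_upd k (f : k.-tuple R -> R) i : bmeas f ->
  bmeas (fun xu : k.-tuple R * R => f (upd xu.1 i xu.2)).
Proof. by move=> bf; apply: (bmeas_comp bf); exact: measurable_upd. Qed.

Lemma upd_cons0 k (x : k.-tuple R) v u :
  upd (Defs.cons_tuple (v, x)) ord0 u = Defs.cons_tuple (u, x).
Proof.
apply: eq_from_tnth => l; rewrite tnth_mktuple.
by case: (unliftP ord0 l) => [j ->|->]; rewrite ?tnth_consS ?tnth_cons0// eqxx.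
Qed.

Lemma upd_consS k (x : k.-tuple R) v i u :
  upd (Defs.cons_tuple (v, x)) (lift ord0 i) u = Defs.cons_tuple (v, upd x i u).
Proof.
apply: eq_from_tnth => l; rewrite tnth_mktuple.
case: (unliftP ord0 l) => [j ->|->]; rewrite ?tnth_consS ?tnth_cons0//.
by rewrite tnth_mktuple (inj_eq (@lift_inj _ _)).
Qed.

(** The coordinates are independent, so one of them may be drawn again. *)
Lemma expect_resample k (f : k.-tuple R -> R) (i : 'I_k) : bmeas f ->
  expect (cube k) f = expect (cube k) (fun x => expect lam (fun u => f (upd x i u))).
Proof.
elim: k f i => [|k IH] f i bf; first by case: i.
have bg := bmeas_expect1 (cube k.+1) lam (bmeas_upd i bf).
rewrite [RHS](expect_cubeS bg) [LHS](expect_cubeS bf).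
case: (unliftP ord0 i) => [j ->|->].
  apply: eq_expect => v; rewrite (IH _ j); last exact: bmeas_pair_cons.
  by apply: eq_expect => x; apply: eq_expect => u; rewrite upd_consS.
rewrite (exchange_expect _ _ (bmeas_cons bf)) -[LHS](expect_cst lam).
by apply: eq_expect => v; apply: eq_expect => x; apply: eq_expect => u; rewrite upd_cons0.
Qed.

Lemma measurable_map_tuple k (th : R -> R) : measurable_fun setT th ->
  measurable_fun setT (fun x : k.-tuple R => [tuple of map th x]).
Proof.
move=> mth; apply/measurable_fun_tnthP => l.
rewrite (_ : _ \o _ = fun x : k.-tuple R => th (tnth x l)).
  exact: (measurableT_comp mth (measurable_tnth _)).
by apply/funext => x /=; rewrite tnth_map.
Qed.

Lemma expect_cube_map k (th : R -> R) (f : k.-tuple R -> R) : measurable_fun setT th ->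
  (forall g, bmeas g -> expect lam (fun u => g (th u)) = expect lam g) -> bmeas f ->
  expect (cube k) (fun x => f [tuple of map th x]) = expect (cube k) f.
Proof.
move=> mth inv; elim: k f => [|k IH] f bf.
  have bf' := bmeas_comp bf (@measurable_map_tuple 0 _ mth).
  by rewrite !expect_cube0//; congr f; apply: val_inj.
have bf' := bmeas_comp bf (@measurable_map_tuple k.+1 _ mth).
rewrite (expect_cubeS bf') (expect_cubeS bf).
rewrite -(inv _ (bmeas_expect1 lam (cube k) (bmeas_cons bf))); apply: eq_expect => u.
rewrite -[RHS]IH; last exact: bmeas_pair_cons.
by apply: eq_expect => x; congr f; apply: val_inj.
Qed.

Lemma sum_ffunS (T : finType) k (h : {ffun 'I_k.+1 -> T} -> R) :
  \sum_g h g = \sum_t \sum_(g : {ffun 'I_k -> T})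
    h [ffun i => if unlift ord0 i is Some j then g j else t].
Proof.
rewrite pair_bigA/=; rewrite (reindex (fun tg : T * {ffun 'I_k -> T} =>
  [ffun i => if unlift ord0 i is Some j then tg.2 j else tg.1]))//=.
exists (fun g => (g ord0, [ffun j => g (lift ord0 j)])) => [[t g] _|g _] /=.
  by rewrite ffunE unlift_none; congr (_, _); apply/ffunP => j; rewrite !ffunE liftK.
by apply/ffunP => i; rewrite !ffunE; case: unliftP => [j ->|->]//; rewrite ffunE.
Qed.

(** The law of independent points only matters through the uniform law of the cells
    in which they lie. *)
Section FiniteIndex.
Variables (n : nat) (idx : R -> 'I_n).
Hypothesis idx_law : forall f : 'I_n -> R,
  bmeas (fun u => f (idx u)) /\ expect lam (fun u => f (idx u)) = avg f.

Lemma bmeas_idx k (h : {ffun 'I_k -> 'I_n} -> R) :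
  bmeas (fun x : k.-tuple R => h [ffun i => idx (tnth x i)]).
Proof.
rewrite (_ : (fun _ => _) = fun x : k.-tuple R => \sum_(g : {ffun 'I_k -> 'I_n})
    h g * \prod_i (idx (tnth x i) == g i)%:R).
  apply: bmeas_sum => g; apply: bmeasM; first exact: bmeas_cst.
  apply: bmeas_prod => i _.
  apply: (bmeas_comp (proj1 (idx_law (fun j => (j == g i)%:R)))).
  exact: measurable_tnth.
apply/funext => x; set g0 := [ffun _ => _]; rewrite (bigD1 g0)//= big1 => [|i _].
  rewrite big1 ?mulr1 ?addr0// => g ng.
  have [i gi] : exists i, idx (tnth x i) != g i.
    apply/existsP; rewrite -negb_forall; apply: contra ng => /forallP H.
    by apply/eqP/ffunP => i; rewrite ffunE (eqP (H i)).
  by rewrite (bigD1 i)//= (negbTE gi) mul0r mulr0.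
by rewrite ffunE eqxx.
Qed.

Lemma expect_cube_idx k (h : {ffun 'I_k -> 'I_n} -> R) :
  expect (cube k) (fun x => h [ffun i => idx (tnth x i)]) = avg h.
Proof.
elim: k h => [|k IH] h.
  rewrite (expect_cube0 (bmeas_idx h)) /avg card_ffun !card_ord expn0 divr1.
  rewrite (bigD1 [ffun i => idx (tnth [tuple] i)])//= big1 ?addr0// => g /eqP[].
  by apply/ffunP => -[].
rewrite (expect_cubeS (bmeas_idx h)).
pose h' t (g : {ffun 'I_k -> 'I_n}) :=
  h [ffun i => if unlift ord0 i is Some j then g j else t].
transitivity (expect lam (fun u => avg (h' (idx u)))).
  apply: eq_expect => u; rewrite -IH; apply: eq_expect => x; congr h.
  apply/ffunP => i; rewrite !ffunE; case: unliftP => [j ->|->]; last by rewrite tnth_cons0.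
  by rewrite tnth_consS ffunE.
rewrite (proj2 (idx_law (fun t => avg (h' t)))) /avg sum_ffunS -mulr_suml -mulrA.
by rewrite !card_ffun !card_ord expnS natrM invfM [n%:R^-1 * _]mulrC.
Qed.

End FiniteIndex.
End CubeLaws.

(** * The counting lemma for bounded kernels *)

Section Weights.
Context d (T : measurableType d) (R : realType) (P : probability T R).

Lemma bmeas_indic (S : set T) : measurable S -> bmeas (\1_S : T -> R).
Proof.
move=> mS; split; first exact: measurable_indic.
by exists 1 => x; rewrite indicE normr_nat; case: (x \in S).
Qed.

Lemma ler_norm_expect (f g : T -> R) : bmeas f -> bmeas g -> (forall x, `|f x| <= g x) ->
  `|expect P f| <= expect P g.
Proof.
move=> bf bg fg; have bounds x : - g x <= f x <= g x by rewrite -ler_norml.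
rewrite ler_norml; apply/andP; split; last by apply: ler_expect => // x; case/andP: (bounds x).
rewrite -[leLHS]mulN1r -expectZl//; apply: ler_expect => // [|x].
  by apply: bmeasM => //; exact: bmeas_cst.
by rewrite mulN1r; case/andP: (bounds x).
Qed.

Lemma measurable_pos (phi : T -> R) : bmeas phi -> measurable [set x | 0 < phi x]%classic.
Proof.
move=> [mphi _]; rewrite -preimage_itvoy -[X in measurable X]setTI.
by apply: mphi => //; exact: measurable_itv.
Qed.

(** The best weight with values in [0, B] is B times the indicator of the positive set. *)
Lemma expect_weight_le (phi g : T -> R) (delta B : R) : bmeas phi -> bmeas g ->
  0 <= B -> (forall x, 0 <= g x <= B) ->
  (forall S, measurable S -> `|expect P (fun x => phi x * \1_S x)| <= delta) ->
  expect P (fun x => phi x * g x) <= B * delta.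
Proof.
move=> bphi bg B0 gB test; have mpos := measurable_pos bphi.
have := test _ mpos; rewrite ler_norml => /andP[_ h].
apply: le_trans (ler_wpM2l B0 h); rewrite -expectZl; last first.
  by apply: bmeasM => //; exact: bmeas_indic.
apply: ler_expect => [||x]; first exact: bmeasM.
  apply: bmeasM; first exact: bmeas_cst.
  by apply: bmeasM => //; exact: bmeas_indic.
have /andP[g0 gb] := gB x; rewrite indicE.
have [p0|p0] := ltP 0 (phi x).
  by rewrite mem_set//= mulr1 mulrC; apply: ler_wpM2r => //; exact: ltW.
by rewrite memNset/= ?mulr0 ?mulr_le0_ge0//; apply/negP; rewrite -leNgt.
Qed.

Lemma expect_weight (phi g : T -> R) (delta B : R) : bmeas phi -> bmeas g ->
  0 <= B -> (forall x, 0 <= g x <= B) ->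
  (forall S, measurable S -> `|expect P (fun x => phi x * \1_S x)| <= delta) ->
  `|expect P (fun x => phi x * g x)| <= B * delta.
Proof.
move=> bphi bg B0 gB test; rewrite ler_norml; apply/andP; split; last exact: expect_weight_le.
have neg f : bmeas f -> expect P (fun x => - phi x * f x) = - expect P (fun x => phi x * f x).
  move=> bf; rewrite -[RHS]mulN1r -expectZl; last exact: bmeasM.
  by apply: eq_expect => x; rewrite mulNr mulN1r.
rewrite lerNl -neg//; apply: expect_weight_le => //; first exact: bmeasN.
by move=> S mS; rewrite neg ?normrN; [exact: test|exact: bmeas_indic].
Qed.

End Weights.

Section CutTests.
Variable R : realType.
Local Notation lam := (@lebesgue01 R).
Local Notation cube := (@cube_measure R).

Definition cut_test (delta : R) (W : R * R -> R) : Prop :=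
  forall S S' : set R, measurable S -> measurable S' ->
  `|expect lam (fun u => expect lam (fun v => \1_S u * W (u, v) * \1_S' v))| <= delta.

Lemma bmeas_weighted (W : R * R -> R) (f g : R -> R) : bmeas W -> bmeas f -> bmeas g ->
  bmeas (fun z => f z.1 * W z * g z.2).
Proof.
move=> bW bf bg; apply: bmeasM; first apply: bmeasM => //.
  by apply: (bmeas_comp bf); exact: measurable_fst.
by apply: (bmeas_comp bg); exact: measurable_snd.
Qed.

Lemma cut_test_weight (delta A B : R) (W : R * R -> R) (f g : R -> R) :
  bmeas W -> cut_test delta W -> bmeas f -> bmeas g -> 0 <= A -> 0 <= B ->
  (forall u, 0 <= f u <= A) -> (forall v, 0 <= g v <= B) ->
  `|expect lam (fun u => expect lam (fun v => f u * W (u, v) * g v))| <= A * (B * delta).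
Proof.
move=> bW cutW bf bg A0 B0 fA gB.
have b1 : bmeas (cst 1 : R -> R) by exact: bmeas_cst.
pose phi u := expect lam (fun v => 1 * W (u, v) * g v).
have bphi : bmeas phi by exact: (bmeas_expect1 lam lam (bmeas_weighted bW b1 bg)).
have pull (f' : R -> R) u : f' u * phi u = expect lam (fun v => f' u * W (u, v) * g v).
  rewrite -expectZl; first by apply: eq_expect => v; rewrite mul1r mulrA.
  exact: (bmeas_section1 (bmeas_weighted bW b1 bg)).
have -> : expect lam (fun u => expect lam (fun v => f u * W (u, v) * g v)) =
    expect lam (fun u => phi u * f u).
  by apply: eq_expect => u; rewrite mulrC pull.
apply: expect_weight => // S mS.
have bS := bmeas_indic R mS.
pose phiS v := expect lam (fun u => \1_S u * W (u, v) * 1).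
have bphiS : bmeas phiS by exact: (bmeas_expect2 lam lam (bmeas_weighted bW bS b1)).
have pullS (g' : R -> R) v : phiS v * g' v = expect lam (fun u => \1_S u * W (u, v) * g' v).
  rewrite mulrC -expectZl; first by apply: eq_expect => u; rewrite mulr1 mulrC.
  exact: (bmeas_section2 (bmeas_weighted bW bS b1)).
have -> : expect lam (fun u => phi u * \1_S u) = expect lam (fun v => phiS v * g v).
  transitivity (expect lam (fun u => expect lam (fun v => \1_S u * W (u, v) * g v))).
    by apply: eq_expect => u; rewrite mulrC pull.
  rewrite (exchange_expect lam lam (bmeas_weighted bW bS bg)).
  by apply: eq_expect => v; rewrite pullS.
apply: expect_weight => // S' mS'.
have bS' := bmeas_indic R mS'.
have -> : expect lam (fun v => phiS v * \1_S' v) =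
    expect lam (fun u => expect lam (fun v => \1_S u * W (u, v) * \1_S' v)).
  rewrite (exchange_expect lam lam (bmeas_weighted bW bS bS')).
  by apply: eq_expect => v; rewrite pullS.
exact: cutW.
Qed.

Section Counting.
Variables (k : nat) (P : {set 'I_k * 'I_k}) (C delta : R).
Hypotheses (C_ge1 : 1 <= C) (P_lt : forall e, e \in P -> (e.1 < e.2)%N).
Implicit Types W : 'I_k * 'I_k -> R * R -> R.

Definition weight W (x : k.-tuple R) : R := \prod_(e in P) W e (tnth x e.1, tnth x e.2).

Lemma bmeas_edge (d : measure_display) (T : measurableType d) (W0 : R * R -> R) (f g : T -> R) :
  bmeas W0 -> measurable_fun setT f -> measurable_fun setT g -> bmeas (fun t => W0 (f t, g t)).
Proof.
by move=> bW mf mg; apply: (bmeas_comp (g := fun t => (f t, g t)) bW); exact: measurable_fun_pair.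
Qed.

Lemma bmeas_weight W (Q : pred ('I_k * 'I_k)) : (forall e, bmeas (W e)) ->
  bmeas (fun x : k.-tuple R => \prod_(e | Q e) W e (tnth x e.1, tnth x e.2)).
Proof.
by move=> bW; apply: bmeas_prod => e _; apply: bmeas_edge => //; exact: measurable_tnth.
Qed.

Lemma prod_bounds W (Q : pred ('I_k * 'I_k)) (z z' : 'I_k -> R) :
  (forall e x, 0 <= W e x <= C) ->
  0 <= \prod_(e | (e \in P) && Q e) W e (z e.1, z' e.2) <= C ^+ #|P|.
Proof.
move=> WC; have C1 := C_ge1; apply/andP; split.
  by apply: prodr_ge0 => e _; case/andP: (WC e (z e.1, z' e.2)).
apply: (@le_trans _ _ (\prod_(e | (e \in P) && Q e) C)).
  by apply: ler_prod => e _; exact: WC.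
rewrite prodr_const; apply: ler_weXn2l => //; apply: subset_leq_card.
by apply/fintype.subsetP => e /andP[].
Qed.

(** Drawing again the two ends of the edge whose kernel changes, every other edge
    depends on at most one of them. *)
Lemma edge_change W W' e : e \in P ->
  (forall e', bmeas (W e')) -> (forall e', bmeas (W' e')) ->
  (forall e' x, 0 <= W e' x <= C) ->
  (forall e', e' != e -> W' e' = W e') ->
  cut_test delta (fun z => W e z - W' e z) ->
  `|expect (cube k) (weight W) - expect (cube k) (weight W')| <=
    C ^+ #|P| * (C ^+ #|P| * delta).
Proof.
move=> eP bW bW' WC WW' cutW; have C1 := C_ge1.
have CP0 : 0 <= C ^+ #|P| by rewrite exprn_ge0//; lra.
set i := e.1; set j := e.2.
have ij : i != j by apply/eqP => ij; have := P_lt eP; rewrite -/i -/j ij ltnn.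
pose D x := (W e (tnth x i, tnth x j) - W' e (tnth x i, tnth x j)) *
  \prod_(e' | (e' \in P) && (e' != e)) W e' (tnth x e'.1, tnth x e'.2).
have bWe : bmeas (fun z => W e z - W' e z) by exact: bmeasB.
have bD : bmeas D.
  apply: bmeasM; last exact: bmeas_weight.
  by apply: (bmeas_edge bWe); exact: measurable_tnth.
have -> : expect (cube k) (weight W) - expect (cube k) (weight W') = expect (cube k) D.
  rewrite -expectB; [|exact: bmeas_weight|exact: bmeas_weight].
  apply: eq_expect => x; rewrite /weight (bigD1 e)//= [X in _ - X](bigD1 e)//=.
  rewrite /D mulrBl; congr (_ - _ * _).
  by apply: eq_bigr => e' /andP[_ /WW' ->].
rewrite (expect_resample j bD).
rewrite (expect_resample i (bmeas_expect1 (cube k) lam (bmeas_upd j bD))).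
rewrite -[leRHS](expect_cst (cube k)); apply: ler_norm_expect.
  exact: (bmeas_expect1 (cube k) lam (bmeas_upd i (bmeas_expect1 (cube k) lam (bmeas_upd j bD)))).
  exact: bmeas_cst.
move=> x.
pose zu u l : R := if l == i then u else tnth x l.
pose zv v l : R := if l == j then v else tnth x l.
(* the edges other than e that touch j avoid i, since e is the only edge from i to j *)
pose touch (e' : 'I_k * 'I_k) := (e'.1 == j) || (e'.2 == j).
pose A u := \prod_(e' | (e' \in P) && ((e' != e) && ~~ touch e')) W e' (zu u e'.1, zu u e'.2).
pose B v := \prod_(e' | (e' \in P) && ((e' != e) && touch e')) W e' (zv v e'.1, zv v e'.2).
have mz (i' l : 'I_k) : measurable_fun setT (fun u : R => if l == i' then u else tnth x l).
  by case: eqP => _; [exact: measurable_id|exact: measurable_cst].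
have bA : bmeas A by apply: bmeas_prod => e' _; apply: bmeas_edge => //; exact: mz.
have bB : bmeas B by apply: bmeas_prod => e' _; apply: bmeas_edge => //; exact: mz.
have -> : expect lam (fun u => expect lam (fun v => D (upd (upd x i u) j v))) =
    expect lam (fun u => expect lam (fun v => A u * (W e (u, v) - W' e (u, v)) * B v)).
  apply: eq_expect => u; apply: eq_expect => v; rewrite /D.
  have tz l : tnth (upd (upd x i u) j v) l = if l == j then v else zu u l.
    by rewrite !tnth_mktuple.
  have -> : tnth (upd (upd x i u) j v) i = u by rewrite tz (negbTE ij) /zu eqxx.
  have -> : tnth (upd (upd x i u) j v) j = v by rewrite tz eqxx.
  rewrite mulrAC mulrC; congr (_ * _); rewrite (bigID touch)/= mulrC; congr (_ * _).
    rewrite /A; apply: eq_big => [e'|e']; first by rewrite andbA.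
    by move=> /andP[_]; rewrite /touch negb_or !tz => /andP[/negbTE -> /negbTE ->].
  rewrite /B; apply: eq_big => [e'|e']; first by rewrite andbA.
  move=> /andP[/andP[e'P e'e] tj]; rewrite !tz.
  have lt := P_lt e'P; have lte := P_lt eP; rewrite -/i -/j in lte.
  congr (W e' (_, _)); rewrite /zu /zv.
    case: eqP => // nj; case: eqP => // e1; case/negP: e'e; apply/eqP.
    move: tj; rewrite /touch => /orP[/eqP//|/eqP e2].
    by rewrite (surjective_pairing e') e1 e2 -surjective_pairing.
  case: eqP => // nj; case: eqP => // e2.
  move: tj; rewrite /touch => /orP[/eqP e1|/eqP//].
  by move: lt; rewrite e1 e2 => /ltnW; rewrite leqNgt lte.
by apply: (cut_test_weight bWe cutW bA bB CP0 CP0) => [u|v]; exact: prod_bounds.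
Qed.

(** The counting lemma for bounded kernels: the edges are changed one at a time. *)
Lemma counting (U K : R * R -> R) : bmeas U -> bmeas K ->
  (forall x, 0 <= U x <= C) -> (forall x, 0 <= K x <= C) ->
  cut_test delta (fun z => U z - K z) ->
  `|expect (cube k) (weight (fun=> U)) - expect (cube k) (weight (fun=> K))| <=
    #|P|%:R * (C ^+ #|P| * (C ^+ #|P| * delta)).
Proof.
move=> bU bK UC KC cutUK.
pose mix (s : seq ('I_k * 'I_k)) e := if e \in s then U else K.
have bmix s e : bmeas (mix s e) by rewrite /mix; case: ifP.
have mixC s e x : 0 <= mix s e x <= C by rewrite /mix; case: ifP.
have steps s : {subset s <= P} -> uniq s ->
    `|expect (cube k) (weight (mix s)) - expect (cube k) (weight (fun=> K))| <=
      (size s)%:R * (C ^+ #|P| * (C ^+ #|P| * delta)).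
  elim: s => [_ _|e s IH sP /= /andP[es s_uniq]].
    by rewrite subrr normr0 mul0r.
  rewrite -natr1 mulrDl mul1r [leRHS]addrC.
  rewrite -(subrKA (expect (cube k) (weight (mix s)))).
  apply: le_trans (ler_normD _ _) _; apply: lerD; last first.
    by apply: IH => // e' e's; apply: sP; rewrite inE e's orbT.
  have eP : e \in P by apply: sP; rewrite inE eqxx.
  apply: (edge_change eP (bmix _) (bmix _) (mixC _)).
    by move=> e' ne; rewrite /mix inE (negbTE ne).
  by rewrite {1 2}/mix inE eqxx (negbTE es).
have enumP : {subset enum P <= P} by move=> e; rewrite mem_enum.
have := steps _ enumP (enum_uniq _).
rewrite -cardE; congr (`|_ - _| <= _); apply: eq_expect => x.
by apply: eq_bigr => e eP; rewrite /mix mem_enum eP.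
Qed.

End Counting.
End CutTests.

(** * Step functions on a partition into equal intervals *)

Section Cells.
Variables (R : realType) (n' : nat).
Local Notation n := n'.+1.
Local Notation lam := (@lebesgue01 R).

Definition cell (i : 'I_n) : set R := `](i%:R / n%:R), (i.+1%:R / n%:R)]%classic.

Definition in_cell (i : 'I_n) : R -> R := \1_(cell i).

Let n0 : 0 < n%:R :> R. Proof. by rewrite ltr0n. Qed.

Lemma measurable_cell i : measurable (cell i).
Proof. exact: measurable_itv. Qed.

Lemma bmeas_in_cell i : bmeas (in_cell i).
Proof. by apply: bmeas_indic; exact: measurable_cell. Qed.

Lemma in_cellE i u : in_cell i u = (u \in `](i%:R / n%:R : R), (i.+1%:R / n%:R)])%:R.
Proof. by rewrite /in_cell indicE /cell mem_setE. Qed.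

Lemma in_cell_ge0 i u : 0 <= in_cell i u.
Proof. by rewrite in_cellE. Qed.

Lemma cell_inj (i j : 'I_n) u : u \in `](i%:R / n%:R : R), (i.+1%:R / n%:R)] ->
  u \in `](j%:R / n%:R : R), (j.+1%:R / n%:R)] -> i = j.
Proof.
rewrite !in_itv /= => /andP[iu ui] /andP[ju uj].
have ij : (i%:R / n%:R : R) < j.+1%:R / n%:R by apply: lt_le_trans uj.
have ji : (j%:R / n%:R : R) < i.+1%:R / n%:R by apply: lt_le_trans ui.
move: ij ji; rewrite !ltr_pM2r ?invr_gt0// !ltr_nat !ltnS => ij ji.
by apply: val_inj; apply/eqP; rewrite eqn_leq ij ji.
Qed.

Lemma in_cell_mul i j u : in_cell i u * in_cell j u = (i == j)%:R * in_cell i u.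
Proof.
rewrite !in_cellE; case: eqVneq => [->|ij].
  by case: (_ \in _); rewrite ?mulr1 ?mulr0.
have [ui|_] := boolP (u \in `](i%:R / n%:R : R), _]); last by rewrite !mul0r ?mulr0.
have [uj|_] := boolP (u \in `](j%:R / n%:R : R), _]); last by rewrite mulr0 mul0r.
by rewrite (cell_inj ui uj) eqxx in ij.
Qed.

Lemma expect_in_cell i : expect lam (in_cell i) = n%:R^-1.
Proof.
rewrite /expect /Rintegral /in_cell.
rewrite integral_indic ?setIT//; last exact: measurable_cell.
rewrite /= /lebesgue01 /mrestr setIidl.
  rewrite /cell lebesgue_measure_itv/= lte_fin ltr_pM2r ?invr_gt0// ltr_nat ltnSn.
  by rewrite -EFinB /= -mulrBl -natrB// subSnn mul1r.
move=> u; rewrite /cell /unit_itv /= !in_itv /= => /andP[iu ui]; apply/andP; split.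
  by apply: ltW; apply: le_lt_trans iu; rewrite divr_ge0.
by apply: le_trans ui _; rewrite ler_pdivrMr// mul1r ler_nat.
Qed.

Definition step (f : 'I_n -> R) (u : R) : R := \sum_i f i * in_cell i u.

Lemma bmeas_step f : bmeas (step f).
Proof.
by apply: bmeas_sum => i; apply: bmeasM; [exact: bmeas_cst|exact: bmeas_in_cell].
Qed.

Lemma step_in f (i : 'I_n) u : u \in `](i%:R / n%:R : R), (i.+1%:R / n%:R)] -> step f u = f i.
Proof.
move=> ui; rewrite /step (bigD1 i)//= big1 ?addr0 => [|j ji]; first by rewrite in_cellE ui mulr1.
rewrite in_cellE; case: (boolP (_ \in _)) => [uj|_]; last by rewrite mulr0.
by rewrite (cell_inj uj ui) eqxx in ji.
Qed.

Lemma step_out f u : (forall i : 'I_n, (u \in `](i%:R / n%:R : R), (i.+1%:R / n%:R)]) = false) ->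
  step f u = 0.
Proof. by move=> nu; apply: big1 => j _; rewrite in_cellE nu mulr0. Qed.

(** The cell of u; the default value is taken outside of the half-open unit interval,
    hence on a null set. *)
Definition idx (u : R) : 'I_n :=
  odflt ord0 [pick i : 'I_n | u \in `](i%:R / n%:R : R), (i.+1%:R / n%:R)]].

Lemma idxE (f : 'I_n -> R) u : f (idx u) = step f u + f ord0 * (1 - step (fun=> 1) u).
Proof.
rewrite /idx; case: pickP => [i ui|nu] /=.
  by rewrite !(step_in _ ui); ring.
by rewrite !(step_out _ nu); ring.
Qed.

Lemma bmeas_idx1 (f : 'I_n -> R) : bmeas (fun u => f (idx u)).
Proof.
rewrite (_ : (fun _ => _) = fun u => step f u + f ord0 * (1 - step (fun=> 1) u)).
  apply: bmeasD; first exact: bmeas_step.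
  apply: bmeasM; first exact: bmeas_cst.
  by apply: bmeasB; [exact: bmeas_cst|exact: bmeas_step].
by apply/funext => u; rewrite idxE.
Qed.

Definition cell_mean (phi : R -> R) (i : 'I_n) : R :=
  n%:R * expect lam (fun u => phi u * in_cell i u).

Lemma expect_step phi f : bmeas phi ->
  expect lam (fun u => phi u * step f u) = avg (fun i => cell_mean phi i * f i).
Proof.
move=> bphi; rewrite /avg card_ord mulr_suml.
transitivity (expect lam (fun u => \sum_i f i * (phi u * in_cell i u))).
  by apply: eq_expect => u; rewrite mulr_sumr; apply: eq_bigr => i _; rewrite mulrCA.
have b i : bmeas (fun u => phi u * in_cell i u) by apply: bmeasM => //; exact: bmeas_in_cell.
rewrite expect_sum => [|i]; last by apply: bmeasM => //; exact: bmeas_cst.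
apply: eq_bigr => i _; rewrite expectZl// /cell_mean.
by field; rewrite gt_eqF.
Qed.

(** The indicator of the complement of the cells is nonnegative with integral
    1 - n / n = 0. *)
Lemma expect_idx phi (f : 'I_n -> R) : bmeas phi ->
  expect lam (fun u => phi u * f (idx u)) = expect lam (fun u => phi u * step f u).
Proof.
move=> bphi; pose rest u := 1 - step (fun=> 1) u.
have brest : bmeas rest by apply: bmeasB; [exact: bmeas_cst|exact: bmeas_step].
have rest0 u : 0 <= rest u.
  rewrite /rest; case: (pickP (fun i : 'I_n =>
    u \in `](i%:R / n%:R : R), (i.+1%:R / n%:R)])) => [i ui|nu].
    by rewrite (step_in _ ui) subrr.
  by rewrite (step_out _ nu) subr0.
have Erest : expect lam rest = 0.
  rewrite expectB; [|exact: bmeas_cst|exact: bmeas_step].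
  rewrite expect_cst.
  have -> : expect lam (step (fun=> 1)) = expect lam (fun u => 1 * step (fun=> 1) u).
    by apply: eq_expect => u; rewrite mul1r.
  rewrite (expect_step (phi := fun=> 1)); last exact: bmeas_cst.
  rewrite (@eq_avg _ _ _ (fun=> 1)) ?avg_cst ?card_ord ?subrr// => i.
  rewrite /cell_mean mulr1 (eq_expect _ (g := in_cell i)) => [|u]; last by rewrite mul1r.
  by rewrite expect_in_cell mulfV// gt_eqF.
have Ephi : expect lam (fun u => phi u * rest u) = 0.
  apply/eqP; rewrite -normr_le0; have [_ [M phiM]] := bphi.
  have M0 : 0 <= M by apply: le_trans (phiM 0).
  have bM : bmeas (fun u => M * rest u) by apply: bmeasM => //; exact: bmeas_cst.
  have bp : bmeas (fun u => phi u * rest u) by exact: bmeasM.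
  have EM : expect lam (fun u => M * rest u) = 0 by rewrite expectZl// Erest mulr0.
  have up u : `|phi u * rest u| <= M * rest u by rewrite normrM (ger0_norm (rest0 u)) ler_wpM2r.
  by rewrite -EM; exact: ler_norm_expect.
transitivity (expect lam (fun u => phi u * step f u + f ord0 * (phi u * rest u))).
  by apply: eq_expect => u; rewrite idxE /rest; ring.
have b1 : bmeas (fun u => phi u * step f u) by apply: bmeasM => //; exact: bmeas_step.
have b2 : bmeas (fun u => phi u * rest u) by exact: bmeasM.
rewrite expectD ?expectZl ?Ephi ?mulr0 ?addr0//.
by apply: bmeasM => //; exact: bmeas_cst.
Qed.

Lemma idx_law (f : 'I_n -> R) :
  bmeas (fun u => f (idx u)) /\ expect lam (fun u => f (idx u)) = avg f.
Proof.
split; first exact: bmeas_idx1.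
have b1 : bmeas (fun _ : R => 1 : R) by exact: bmeas_cst.
transitivity (expect lam (fun u => 1 * f (idx u))).
  by apply: eq_expect => u; rewrite mul1r.
rewrite (expect_idx f b1) (expect_step f b1); apply: eq_avg => i.
rewrite /cell_mean (eq_expect _ (g := in_cell i)) => [|u]; last by rewrite mul1r.
by rewrite expect_in_cell mulfV ?mul1r// gt_eqF.
Qed.

Lemma cell_mean_bounds phi i : bmeas phi -> (forall u, 0 <= phi u <= 1) ->
  0 <= cell_mean phi i <= 1.
Proof.
move=> bphi phi01; have b : bmeas (fun u => phi u * in_cell i u).
  by apply: bmeasM => //; exact: bmeas_in_cell.
apply/andP; split.
  apply: mulr_ge0 => //; apply: expect_ge_cst => // u.
  by have /andP[p0 _] := phi01 u; rewrite mulr_ge0 ?in_cell_ge0.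
rewrite -(@mulfV _ (n%:R : R)) ?gt_eqF// ler_pM2l// -(expect_in_cell i).
apply: ler_expect => // [|u]; first exact: bmeas_in_cell.
by have /andP[_ p1] := phi01 u; rewrite ler_piMl ?in_cell_ge0.
Qed.

Lemma step_bounds f u : (forall i, 0 <= f i <= 1) -> 0 <= step f u <= 1.
Proof.
move=> f01; case: (pickP (fun i : 'I_n =>
  u \in `](i%:R / n%:R : R), (i.+1%:R / n%:R)])) => [i ui|nu].
  by rewrite (step_in _ ui).
by rewrite (step_out _ nu) lexx ler01.
Qed.

End Cells.

(** * Averages of a kernel over the cells *)

Section Averaging.
Variables (R : realType) (n' : nat).
Local Notation n := n'.+1.
Local Notation lam := (@lebesgue01 R).
Implicit Types (W : R * R -> R) (al be : 'I_n -> R) (c : 'I_n -> 'I_n -> R).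

Let n0 : 0 < n%:R :> R. Proof. by rewrite ltr0n. Qed.

Definition cell_avg W (i j : 'I_n) : R :=
  n%:R ^+ 2 * expect lam (fun u => expect lam (fun v => in_cell i u * W (u, v) * in_cell j v)).

Lemma bmeas_cells W (i j : 'I_n) : bmeas W ->
  bmeas (fun z : R * R => in_cell i z.1 * W z * in_cell j z.2).
Proof. by move=> bW; apply: bmeas_weighted => //; exact: bmeas_in_cell. Qed.

Lemma avg_cell_avg W al be : bmeas W ->
  avg (fun i => avg (fun j => al i * cell_avg W i j * be j)) =
  expect lam (fun u => expect lam (fun v => step al u * W (u, v) * step be v)).
Proof.
move=> bW; have bE i j := bmeas_expect1 lam lam (bmeas_cells i j bW).
have b2 i j u := bmeas_section1 (bmeas_cells i j bW) u.
transitivity (expect lam (fun u => \sum_i \sum_j (al i * be j) *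
    expect lam (fun v => in_cell i u * W (u, v) * in_cell j v))); last first.
  apply: eq_expect => u.
  transitivity (expect lam (fun v => \sum_i \sum_j (al i * be j) *
      (in_cell i u * W (u, v) * in_cell j v))).
    rewrite expect_sum => [|i].
      apply: eq_bigr => i _; rewrite expect_sum => [|j].
        by apply: eq_bigr => j _; rewrite expectZl//; exact: b2.
      by apply: bmeasM; [exact: bmeas_cst|exact: b2].
    by apply: bmeas_sum => j; apply: bmeasM; [exact: bmeas_cst|exact: b2].
  apply: eq_expect => v; rewrite /step mulr_suml big_distrl/=.
  apply: eq_bigr => i _; rewrite mulr_sumr; apply: eq_bigr => j _; ring.
rewrite expect_sum => [|i]; last first.
  by apply: bmeas_sum => j; apply: bmeasM; [exact: bmeas_cst|exact: bE].
rewrite /avg card_ord mulr_suml; apply: eq_bigr => i _.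
rewrite expect_sum => [|j]; last by apply: bmeasM; [exact: bmeas_cst|exact: bE].
rewrite mulr_suml mulr_suml; apply: eq_bigr => j _.
rewrite expectZl; last exact: bE.
by rewrite /cell_avg; field; rewrite gt_eqF.
Qed.

Lemma cell_avg_bounds W (C : R) (i j : 'I_n) : bmeas W -> (forall z, 0 <= W z <= C) ->
  0 <= cell_avg W i j <= C.
Proof.
move=> bW WC; have bc := bmeas_cells i j bW.
have bE : bmeas (fun u => expect lam (fun v => in_cell i u * W (u, v) * in_cell j v)).
  exact: (bmeas_expect1 lam lam bc).
have bi u : bmeas (fun v => in_cell i u * W (u, v) * in_cell j v) by exact: (bmeas_section1 bc u).
have C0 : 0 <= C by have /andP[h1 h2] := WC (0, 0); apply: le_trans h2.
have cc u v : 0 <= in_cell i u * W (u, v) * in_cell j v <= C * in_cell i u * in_cell j v.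
  have /andP[w0 w1] := WC (u, v).
  rewrite !mulr_ge0 ?in_cell_ge0//= ler_wpM2r ?in_cell_ge0// mulrC.
  by rewrite ler_wpM2r ?in_cell_ge0.
apply/andP; split.
  apply: mulr_ge0; first by rewrite exprn_ge0.
  apply: (expect_ge_cst _ bE) => u; apply: (expect_ge_cst _ (bi u)) => v.
  by case/andP: (cc u v).
have n2 : 0 < n%:R ^+ 2 :> R by rewrite exprn_gt0.
rewrite /cell_avg -(@ler_pM2l _ (n%:R ^+ 2)^-1) ?invr_gt0// mulrA mulVf ?gt_eqF// mul1r.
apply: (@le_trans _ _ (expect lam (fun u => C / n%:R * in_cell i u))).
  apply: ler_expect => // [|u].
    by apply: bmeasM; [exact: bmeas_cst|exact: bmeas_in_cell].
  apply: (@le_trans _ _ (expect lam (fun v => C * in_cell i u * in_cell j v))).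
    apply: ler_expect => // [|v]; last by case/andP: (cc u v).
    by apply: bmeasM; [exact: bmeas_cst|exact: bmeas_in_cell].
  rewrite expectZl; last exact: bmeas_in_cell.
  by rewrite expect_in_cell mulrAC.
rewrite expectZl; last exact: bmeas_in_cell.
by rewrite expect_in_cell -mulrA -invfM -expr2 mulrC.
Qed.

Lemma cell_avg_sym W (i j : 'I_n) : bmeas W -> (forall u v, W (u, v) = W (v, u)) ->
  cell_avg W i j = cell_avg W j i.
Proof.
move=> bW sym; rewrite /cell_avg; have swap := exchange_expect lam lam (bmeas_cells i j bW).
apply: (congr1 (fun e => n%:R ^+ 2 * e)); apply: (etrans swap).
by apply: eq_expect => u; apply: eq_expect => v; rewrite /= sym; ring.
Qed.

Lemma cell_avgB W W' (i j : 'I_n) : bmeas W -> bmeas W' ->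
  cell_avg (fun z => W z - W' z) i j = cell_avg W i j - cell_avg W' i j.
Proof.
move=> bW bW'; rewrite /cell_avg -mulrBr; congr (_ * _).
have b1 := bmeas_cells i j bW; have b2 := bmeas_cells i j bW'.
rewrite -expectB; [|exact: (bmeas_expect1 lam lam b1)|exact: (bmeas_expect1 lam lam b2)].
apply: eq_expect => u.
rewrite -expectB; [|exact: (bmeas_section1 b1)|exact: (bmeas_section1 b2)].
by apply: eq_expect => v /=; ring.
Qed.

Definition step2 c (z : R * R) : R := \sum_i \sum_j c i j * (in_cell i z.1 * in_cell j z.2).

Lemma bmeas_step2 c : bmeas (step2 c).
Proof.
apply: bmeas_sum => i; apply: bmeas_sum => j; apply: bmeasM; first exact: bmeas_cst.
apply: bmeasM.
  exact: (bmeas_comp (bmeas_in_cell R i) measurable_fst).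
exact: (bmeas_comp (bmeas_in_cell R j) measurable_snd).
Qed.

Lemma cell_avg_step2 c (i j : 'I_n) : cell_avg (step2 c) i j = c i j.
Proof.
rewrite /cell_avg.
have -> : expect lam (fun u => expect lam (fun v => in_cell i u * step2 c (u, v) * in_cell j v)) =
    expect lam (fun u => c i j / n%:R * in_cell i u).
  apply: eq_expect => u.
  transitivity (expect lam (fun v => c i j * in_cell i u * in_cell j v)).
    apply: eq_expect => v; rewrite /step2 mulr_sumr mulr_suml (bigD1 i)//= [X in _ + X]big1 ?addr0 => [|i' ii'].
      rewrite mulr_sumr mulr_suml (bigD1 j)//= big1 ?addr0 => [|j' jj'].
        transitivity (c i j * (in_cell i u * in_cell i u) * (in_cell j v * in_cell j v)); first by ring.
        by rewrite !in_cell_mul !eqxx !mul1r.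
      transitivity (c i j' * (in_cell i u * in_cell i u) * (in_cell j' v * in_cell j v)); first by ring.
      by rewrite [in_cell j' v * _]in_cell_mul (negbTE jj') mul0r mulr0.
    rewrite mulr_sumr mulr_suml big1// => j' _.
    transitivity (c i' j' * (in_cell i' u * in_cell i u) * (in_cell j' v * in_cell j v)); first by ring.
    by rewrite [in_cell i' u * _]in_cell_mul (negbTE ii') mul0r mulr0 mul0r.
  rewrite expectZl; last exact: bmeas_in_cell.
  by rewrite expect_in_cell mulrAC.
rewrite expectZl; last exact: bmeas_in_cell.
by rewrite expect_in_cell; field; rewrite gt_eqF.
Qed.

Lemma expect_step2 c (f g : R -> R) : bmeas f -> bmeas g ->
  expect lam (fun u => expect lam (fun v => f u * step2 c (u, v) * g v)) =
  avg (fun i => avg (fun j => cell_mean f i * c i j * cell_mean g j)).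
Proof.
move=> bf bg.
transitivity (expect lam (fun u => f u * step (fun i => avg (fun j => cell_mean g j * c i j)) u)).
  apply: eq_expect => u.
  transitivity (expect lam (fun v => (f u) * (g v * step (fun j => step (fun i => c i j) u) v))).
    apply: eq_expect => v; rewrite -mulrA; congr (_ * _); rewrite mulrC; congr (_ * _).
    rewrite /step2 /step exchange_big/=; apply: eq_bigr => j _.
    by rewrite mulr_suml; apply: eq_bigr => i _; rewrite mulrA.
  rewrite expectZl; last by apply: bmeasM => //; exact: bmeas_step.
  rewrite expect_step//; congr (_ * _).
  rewrite /step /avg; under [RHS]eq_bigr do rewrite mulr_suml mulr_suml.
  rewrite exchange_big/= mulr_suml; apply: eq_bigr => j _.
  by rewrite mulr_sumr mulr_suml; apply: eq_bigr => i _; ring.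
rewrite expect_step//; apply: eq_avg => i; rewrite -avgZl; apply: eq_avg => j; ring.
Qed.

Lemma expect_idx2 c (f g : R -> R) : bmeas f -> bmeas g ->
  expect lam (fun u => expect lam (fun v => f u * c (idx n' u) (idx n' v) * g v)) =
  avg (fun i => avg (fun j => cell_mean f i * c i j * cell_mean g j)).
Proof.
move=> bf bg.
transitivity (expect lam (fun u => f u * avg (fun j => cell_mean g j * c (idx n' u) j))).
  apply: eq_expect => u.
  rewrite -(expect_step (fun j => c (idx n' u) j) bg).
  rewrite -(expect_idx (fun j => c (idx n' u) j) bg) -expectZl.
    by apply: eq_expect => v; ring.
  by apply: bmeasM => //; exact: bmeas_idx1.
rewrite (expect_idx (fun i => avg (fun j => cell_mean g j * c i j)) bf) expect_step//.
by apply: eq_avg => i; rewrite -avgZl; apply: eq_avg => j; ring.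
Qed.

Lemma bmeas_idx2 c : bmeas (fun z : R * R => c (idx n' z.1) (idx n' z.2)).
Proof.
rewrite (_ : (fun _ => _) = fun z : R * R => \sum_i \sum_j
  c i j * ((idx n' z.1 == i)%:R * (idx n' z.2 == j)%:R)).
  apply: bmeas_sum => i; apply: bmeas_sum => j; apply: bmeasM; first exact: bmeas_cst.
  apply: bmeasM.
    exact: (bmeas_comp (bmeas_idx1 (fun i' => (i' == i)%:R)) measurable_fst).
  exact: (bmeas_comp (bmeas_idx1 (fun j' => (j' == j)%:R)) measurable_snd).
apply/funext => z; rewrite (bigD1 (idx n' z.1))//= [X in _ + X]big1 ?addr0 => [|i ni].
  rewrite (bigD1 (idx n' z.2))//= big1 ?addr0 ?eqxx ?mulr1// => j nj.
  by rewrite [_ == j]eq_sym (negbTE nj) !mulr0.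
by apply: big1 => j _; rewrite [_ == i]eq_sym (negbTE ni) mul0r mulr0.
Qed.

Lemma indic_bounds (S : set R) u : 0 <= (\1_S u : R) <= 1.
Proof. by rewrite indicE; case: (u \in S); rewrite /= ?lexx ?ler01. Qed.

(** A weight on the cells is a step function on the interval, and a step function is its
    own average, so that every test of the averages is a test of the kernels. *)
Lemma cut_bound_cell_avg c U delta : bmeas U ->
  cut_test delta (fun z => step2 c z - U z) ->
  cut_bound delta (fun i j => c i j - cell_avg U i j).
Proof.
move=> bU cutU S S'; have b2 := bmeas_step2 c.
have bD : bmeas (fun z => step2 c z - U z) by exact: bmeasB.
have bool01 (Q : pred 'I_n) i : 0 <= ((Q i)%:R : R) <= 1 by case: (Q i); rewrite lexx ler01.
have -> : avg (fun i => avg (fun j => (S i)%:R * (c i j - cell_avg U i j) * (S' j)%:R)) =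
    expect lam (fun u => expect lam (fun v =>
      step (fun i => (S i)%:R) u * (step2 c (u, v) - U (u, v)) * step (fun j => (S' j)%:R) v)).
  rewrite -(avg_cell_avg (fun i => (S i)%:R) (fun j => (S' j)%:R) bD).
  by apply: eq_avg => i; apply: eq_avg => j; rewrite cell_avgB// cell_avg_step2.
rewrite -[delta]mul1r -[X in 1 * X]mul1r.
apply: (cut_test_weight bD cutU) => //; do ?exact: bmeas_step.
  by move=> u; apply: step_bounds => i; exact: bool01.
by move=> u; apply: step_bounds => i; exact: bool01.
Qed.

(** The triangle inequality through step2 c. Testing a step function on sets weights the
    cells by the proportions cell_mean in which they meet these sets, which again amounts to
    a test of step2 c - U by step functions. *)
Lemma cut_test_cell_avg c U delta : bmeas U ->
  cut_test delta (fun z => step2 c z - U z) ->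
  cut_test (2 * delta) (fun z => U z - cell_avg U (idx n' z.1) (idx n' z.2)).
Proof.
move=> bU cutU S S' mS mS'; have b2 := bmeas_step2 c.
have bD : bmeas (fun z => step2 c z - U z) by exact: bmeasB.
have bI := bmeas_idx2 (cell_avg U).
have bS := bmeas_indic R mS; have bS' := bmeas_indic R mS'.
have bw W : bmeas W -> bmeas (fun z => \1_S z.1 * W z * \1_S' z.2) by move=> bW; exact: bmeas_weighted.
pose form W := expect lam (fun u => expect lam (fun v => \1_S u * W (u, v) * \1_S' v)).
have formB W W' : bmeas W -> bmeas W' -> form (fun z => W z - W' z) = form W - form W'.
  move=> bW bW'; rewrite /form -expectB; last first.
  - exact: (bmeas_expect1 lam lam (bw _ bW')).
  - exact: (bmeas_expect1 lam lam (bw _ bW)).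
  apply: eq_expect => u; rewrite -expectB; last first.
  - exact: (bmeas_section1 (bw _ bW')).
  - exact: (bmeas_section1 (bw _ bW)).
  by apply: eq_expect => v; ring.
have h1 : `|form (step2 c) - form U| <= delta by rewrite -formB//; exact: cutU.
have h2 : `|form (step2 c) - form (fun z => cell_avg U (idx n' z.1) (idx n' z.2))| <= delta.
  rewrite /form (expect_step2 c bS bS') (expect_idx2 (cell_avg U) bS bS') -avgB.
  pose al : 'I_n -> R := cell_mean \1_S; pose be : 'I_n -> R := cell_mean \1_S'.
  have -> : avg (fun i => avg (fun j => al i * c i j * be j) -
        avg (fun j => al i * cell_avg U i j * be j)) =
      expect lam (fun u => expect lam (fun v =>
        step al u * (step2 c (u, v) - U (u, v)) * step be v)).
    rewrite -(avg_cell_avg al be bD).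
    apply: eq_avg => i; rewrite -avgB; apply: eq_avg => j.
    by rewrite cell_avgB// cell_avg_step2; ring.
  rewrite -[delta]mul1r -[X in 1 * X]mul1r.
  apply: (cut_test_weight bD cutU) => //; do ?exact: bmeas_step.
    by move=> u; apply: step_bounds => i; apply: cell_mean_bounds => // v; exact: indic_bounds.
  by move=> u; apply: step_bounds => i; apply: cell_mean_bounds => // v; exact: indic_bounds.
change (`|form (fun z => U z - cell_avg U (idx n' z.1) (idx n' z.2))| <= 2 * delta).
rewrite (formB _ _ bU bI).
set x := form _ in h1 h2 *; set y := form U in h1 *; set z := form _ in h2 *.
clearbody x y z; have -> : y - z = (x - z) - (x - y) by ring.
by rewrite mulr_natl mulr2n; apply: le_trans (ler_normB (x - z) (x - y)) (lerD h2 h1).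
Qed.

Lemma graph_kernel_step2 (p : R) (G : sgraph 'I_n) z :
  graph_kernel p G z = step2 (adjacency G p) z.
Proof.
rewrite /graph_kernel /step2.
have E i j : adjacency G p i j * (in_cell i z.1 * in_cell j z.2) =
    ([&& edge G i j, z.1 \in `](i%:R / n%:R), (i.+1%:R / n%:R)] &
        z.2 \in `](j%:R / n%:R), (j.+1%:R / n%:R)]])%:R / p.
  rewrite /adjacency !in_cellE.
  by case: (edge G i j); case: (z.1 \in _); case: (z.2 \in _) => /=; ring.
under eq_bigr do under eq_bigr do rewrite E.
case: ifPn => [/existsP[i /existsP[j ij]]|nij].
  rewrite !mem_setE in ij; have /and3P[eij zi zj] := ij.
  rewrite (bigD1 i)//= [X in _ + X]big1 ?addr0 => [|i' ni].
    rewrite (bigD1 j)//= ij mul1r big1 ?addr0// => j' nj.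
    case: and3P => [[_ _ zj']|_]; last by rewrite mul0r.
    by rewrite (cell_inj zj' zj) eqxx in nj.
  apply: big1 => j' _; case: and3P => [[_ zi' _]|_]; last by rewrite mul0r.
  by rewrite (cell_inj zi' zi) eqxx in ni.
apply/esym; apply: big1 => i _; apply: big1 => j _.
case: and3P => [h|_]; last by rewrite mul0r.
by case/negP: nij; apply/existsP; exists i; apply/existsP; exists j; rewrite !mem_setE; apply/and3P.
Qed.

End Averaging.

(** * The limit kernel and its relabellings *)

Local Open Scope classical_set_scope.
Local Open Scope ring_scope.

Section LimitKernel.
Variables (R : realType) (C : R) (ka : R * R -> R).
Hypotheses (ka_kernel : is_kernel ka) (C_ge0 : 0 <= C).
Hypothesis ka_le : forall x y, unit_itv x -> unit_itv y -> ka (x, y) <= C.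
Local Notation lam := (@lebesgue01 R).
Local Notation cube := (@cube_measure R).
Local Notation square := (@unit_itv R `*` @unit_itv R).

(** Total, so that measurability and bounds hold on the whole plane. *)
Definition total_kernel : R * R -> R := fun z => if z \in square then ka z else 0.

Lemma measurable_square : measurable square.
Proof. by apply: measurableX; exact: measurable_unit_itv. Qed.

Lemma total_kernelE x y : unit_itv x -> unit_itv y -> total_kernel (x, y) = ka (x, y).
Proof. by move=> x01 y01; rewrite /total_kernel mem_set. Qed.

Lemma total_kernel_bounds z : 0 <= total_kernel z <= C.
Proof.
rewrite /total_kernel; case: ifPn => [|_]; last by rewrite lexx.
case: z => x y; rewrite inE => -[/= x01 y01]; have [_ _ ka0] := ka_kernel.
by rewrite ka0// ka_le.
Qed.

Lemma total_kernel_sym x y : total_kernel (x, y) = total_kernel (y, x).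
Proof.
rewrite /total_kernel; have -> : ((y, x) \in square) = ((x, y) \in square).
  by apply/idP/idP; rewrite !inE => -[].
by case: ifPn => //; rewrite inE => -[/= x01 y01]; have [_ ks _] := ka_kernel; exact: ks.
Qed.

Lemma bmeas_total_kernel : bmeas total_kernel.
Proof.
apply: (bmeas_bounds (a := 0) (b := C)); last exact: total_kernel_bounds.
have [mka _ _] := ka_kernel.
rewrite (_ : total_kernel = ka \_ square).
  by apply/(measurable_restrictT _ measurable_square).
by apply/funext => z; rewrite /total_kernel patchE.
Qed.

(** The points of the cube outside of the unit cube form a null set. *)
Lemma kernel_density_expect k (F : sgraph 'I_k) :
  kernel_density F ka =
  (expect (cube k) (weight (ordered_edges F) (fun=> total_kernel)))%:E.
Proof.
have bw : bmeas (weight (ordered_edges F) (fun=> total_kernel)).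
  by apply: bmeas_weight => _; exact: bmeas_total_kernel.
pose unit_ind (x : k.-tuple R) : R := \prod_(i < k) \1_(@unit_itv R) (tnth x i).
have bu : bmeas unit_ind.
  apply: bmeas_prod => i _.
  exact: (bmeas_comp (bmeas_indic R (@measurable_unit_itv R)) (measurable_tnth _)).
have unitE x : unit_ind x = \1_(@unit_cube R k) x.
  rewrite /unit_ind [RHS]indicE; have [x01|nx] := boolP (x \in @unit_cube R k).
    rewrite inE in x01; apply: big1 => i _; rewrite indicE mem_set//; exact: x01.
  have [i ni] : exists i, ~ unit_itv (tnth x i).
    by apply: contrapT => h; move/negP: nx; apply; rewrite inE => i; apply: contrapT => ni; apply: h; exists i.
  by rewrite (bigD1 i)//= indicE memNset// mul0r.
have bwu : bmeas (fun x => weight (ordered_edges F) (fun=> total_kernel) x * unit_ind x).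
  exact: bmeasM.
rewrite (_ : expect _ _ = expect (cube k) (fun x =>
    weight (ordered_edges F) (fun=> total_kernel) x * unit_ind x)); last first.
  by apply: ae_cube => // x x01; rewrite unitE indicE mem_set// mulr1.
rewrite (expectE _ bwu) /kernel_density integral_mkcond; apply: eq_integral => x _.
rewrite patchE unitE indicE; case: ifPn => [x01|_]; last by rewrite mulr0.
rewrite mulr1 /weight; congr (_%:E).
rewrite -/(edge_weight F (fun x y => ka (x, y)) (tnth x)).
rewrite edge_weightE; apply: eq_bigr => e _; rewrite total_kernelE//; rewrite inE in x01; exact: x01.
Qed.

Section Transport.
Variable tau : R -> R.
Hypothesis tau_mp : mp_bijection tau.

Definition total_map : R -> R := fun u => if u \in @unit_itv R then tau u else 0.

Lemma unit_itv0 : unit_itv (0 : R).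
Proof. by rewrite /unit_itv /= in_itv /= lexx ler01. Qed.

Lemma total_map_unit u : unit_itv (total_map u).
Proof.
rewrite /total_map; case: ifPn => [|_]; last exact: unit_itv0.
by rewrite inE => u01; have [[h _ _] _ _] := tau_mp; exact: h.
Qed.

Lemma total_mapE u : unit_itv u -> total_map u = tau u.
Proof. by move=> u01; rewrite /total_map mem_set. Qed.

Lemma measurable_total_map : measurable_fun setT total_map.
Proof.
have [_ mtau _] := tau_mp; rewrite (_ : total_map = tau \_ (@unit_itv R)).
  by apply/(measurable_restrictT _ (@measurable_unit_itv R)).
by apply/funext => z; rewrite /total_map patchE.
Qed.

Lemma expect_total_map g : bmeas g -> expect lam (fun u => g (total_map u)) = expect lam g.
Proof.
move=> bg; have bgt := bmeas_comp bg measurable_total_map.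
pose mix := isMeasurableFun.Build _ _ _ _ total_map measurable_total_map.
pose X : {RV lam >-> R} := HB.pack total_map mix.
transitivity (expect (distribution lam X) g); first by rewrite expect_distribution.
rewrite /expect /Rintegral; congr fine; apply: eq_measure_integral => A mA _.
rewrite /= /distribution /= /pushforward /= /lebesgue01 /mrestr.
have [[tau01 _ _] _ inv] := tau_mp.
have mA01 : measurable (A `&` @unit_itv R) by apply: measurableI => //; exact: measurable_unit_itv.
rewrite -(inv _ mA01) => [|u []//]; congr (lebesgue_measure _).
apply/seteqP; split => u /=.
  by move=> [Au u01]; rewrite -total_mapE//; split => //; split => //; exact: total_map_unit.
by move=> [u01 [Au _]]; rewrite total_mapE.
Qed.

(** The kernel to which the graph is close in cut norm without further relabelling. *)
Definition moved_kernel : R * R -> R := fun z => total_kernel (total_map z.1, total_map z.2).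

Lemma bmeas_moved_kernel : bmeas moved_kernel.
Proof.
apply: (bmeas_comp (g := fun z : R * R => (total_map z.1, total_map z.2)) bmeas_total_kernel).
apply: measurable_fun_pair; apply: measurableT_comp measurable_total_map _.
  exact: measurable_fst.
exact: measurable_snd.
Qed.

(** The relabelling preserves the law of each coordinate, hence of all of them. *)
Lemma moved_density k (P : {set 'I_k * 'I_k}) :
  expect (cube k) (weight P (fun=> moved_kernel)) =
  expect (cube k) (weight P (fun=> total_kernel)).
Proof.
rewrite -[RHS](expect_cube_map measurable_total_map expect_total_map).
  by apply: eq_expect => x; apply: eq_bigr => e _; rewrite /moved_kernel !tnth_map.
by apply: bmeas_weight => _; exact: bmeas_total_kernel.
Qed.

Lemma cut_norm_test W delta : bmeas W ->
  (cut_norm (fun z => W z - ka (tau z.1, tau z.2))%R <= delta%:E)%E ->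
  cut_test delta (fun z => W z - moved_kernel z).
Proof.
move=> bW cutW S S' mS mS'; have bM := bmeas_moved_kernel.
have bD : bmeas (fun z => W z - moved_kernel z) by exact: bmeasB.
pose A := S `&` @unit_itv R; pose A' := S' `&` @unit_itv R.
have mA : measurable A by apply: measurableI => //; exact: measurable_unit_itv.
have mA' : measurable A' by apply: measurableI => //; exact: measurable_unit_itv.
have bA := bmeas_indic R mA; have bA' := bmeas_indic R mA'.
have bS := bmeas_indic R mS; have bS' := bmeas_indic R mS'.
have restr (B : set R) u : unit_itv u -> \1_(B `&` @unit_itv R) u = \1_B u :> R.
  move=> u01; rewrite !indicE.
  suff -> : (u \in B `&` @unit_itv R) = (u \in B) by [].
  by apply/idP/idP; rewrite !inE; [case|split].
have -> : expect lam (fun u => expect lam (fun v =>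
      \1_S u * (W (u, v) - moved_kernel (u, v)) * \1_S' v)) =
    expect lam (fun u => expect lam (fun v =>
      \1_A u * (W (u, v) - moved_kernel (u, v)) * \1_A' v)).
  apply: ae_lebesgue01 => [||u u01].
  - exact: (bmeas_expect1 lam lam (bmeas_weighted bD bS bS')).
  - exact: (bmeas_expect1 lam lam (bmeas_weighted bD bA bA')).
  apply: ae_lebesgue01 => [||v v01].
  - exact: (bmeas_section1 (bmeas_weighted bD bS bS')).
  - exact: (bmeas_section1 (bmeas_weighted bD bA bA')).
  by rewrite !restr.
rewrite (expect_prod1 lam lam (bmeas_weighted bD bA bA')).
rewrite -lee_fin; apply: le_trans cutW; apply: ereal_sup_ubound.
exists A, A'; split => //; [by move=> u []|by move=> u []|].
rewrite -abse_EFin expectE; last exact: bmeas_weighted.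
congr (`| _ |)%E; rewrite [RHS]integral_mkcond; apply: eq_integral => -[u v] _.
rewrite patchE /=; case: ifPn => [|nz].
  rewrite inE => -[/= Au Av]; rewrite !indicE !mem_set// mul1r mulr1 /moved_kernel /=.
  have [[_ u01] [_ v01]] := (Au, Av).
  by rewrite (total_kernelE (total_map_unit u) (total_map_unit v)) !total_mapE.
have [Au|nAu] := boolP (u \in A); last by rewrite indicE (negbTE nAu) !mul0r.
have [Av|nAv] := boolP (v \in A'); last by rewrite [X in _ * X]indicE (negbTE nAv) mulr0.
by case/negP: nz; rewrite inE; split; apply: set_mem.
Qed.

End Transport.
End LimitKernel.

(** * Convergence of the densities *)

(** The averages of the relabelled limit kernel over the cells of the graph play the
    role of the limit kernel on the vertex set. *)
Lemma discretize (R : realType) (C : R) (ka : R * R -> R) (n : nat) (p delta : R)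
    (G : sgraph 'I_n) :
  1 <= C -> is_kernel ka -> (forall x y, unit_itv x -> unit_itv y -> ka (x, y) <= C) ->
  (0 < n)%N -> (d_cut (graph_kernel p G) ka < delta%:E)%E ->
  exists K : 'I_n -> 'I_n -> R,
    [/\ forall x y, 0 <= K x y <= C, forall x y, K x y = K y x,
        cut_bound delta (fun x y => adjacency G p x y - K x y) &
        forall k (F : sgraph 'I_k),
        `|expect (@cube_measure R k) (weight (ordered_edges F) (fun=> total_kernel ka)) -
          avg (fun g : {ffun 'I_k -> 'I_n} => edge_weight F K g)| <=
        #|ordered_edges F|%:R * (C ^+ #|ordered_edges F| *
          (C ^+ #|ordered_edges F| * (2 * delta)))].
Proof.
move=> C1 ka_kernel ka_le; case: n G => [//|n'] G _ dG; have C0 : 0 <= C by lra.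
have [_ [tau tau_mp <-] cutn] := ereal_inf_lt dG.
have bU := bmeas_moved_kernel ka_kernel C0 ka_le tau_mp.
set U := moved_kernel ka tau in bU.
have UC z : 0 <= U z <= C by exact: total_kernel_bounds.
have bG : bmeas (graph_kernel p G).
  rewrite (_ : graph_kernel p G = step2 (adjacency G p)); first exact: bmeas_step2.
  by apply/funext => z; exact: graph_kernel_step2.
have test : cut_test delta (fun z => step2 (adjacency G p) z - U z).
  have := cut_norm_test ka_kernel C0 ka_le tau_mp bG (ltW cutn).
  by under eq_fun do rewrite graph_kernel_step2.
pose K : 'I_n'.+1 -> 'I_n'.+1 -> R := cell_avg U.
have KC x y : 0 <= K x y <= C by exact: cell_avg_bounds.
exists K; split.
- exact: KC.
- by move=> x y; apply: cell_avg_sym => // u v; exact: total_kernel_sym.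
- exact: cut_bound_cell_avg.
- move=> k F; rewrite -(moved_density ka_kernel C0 ka_le tau_mp).
have -> : avg (fun g : {ffun 'I_k -> 'I_n'.+1} => edge_weight F K g) =
    expect (@cube_measure R k) (weight (ordered_edges F)
      (fun=> fun z => K (idx n' z.1) (idx n' z.2))).
  rewrite -(expect_cube_idx (@idx_law R n')); apply: eq_expect => x.
  by rewrite edge_weightE; apply: eq_bigr => e _; rewrite !ffunE.
have P_lt e : e \in ordered_edges F -> (e.1 < e.2)%N by rewrite inE => /andP[].
have KidxC (z : R * R) : 0 <= K (idx n' z.1) (idx n' z.2) <= C by exact: KC.
exact: (counting C1 P_lt bU (bmeas_idx2 K) UC KidxC (cut_test_cell_avg bU test)).
Qed.

Theorem theorem5p17 (R : realType) (C : R) (l : nat)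
  (I : set nat) (p : nat -> R) (G : forall n : nat, sgraph 'I_n)
  (ka : R * R -> R)
  (C_gt0 : 0 < C) (l_ge3 : (3 <= l)%N)
  (I_infinite : infinite_set I)
  (p_gt0 : forall n, I n -> 0 < p n)
  (tree_bound : forall (k : nat) (F : sgraph 'I_k), is_tree F ->
     (ereal_sup [set (emb_density (p n) F (G n))%:E | n in I] < +oo)%E)
  (paths_pred_l : exists K : R, forall n, I n ->
     \sum_(u < n) \sum_(v < n | v != u) (npaths (G n) l.-1 u v)%:R ^+ 2
       <= K * (n%:R ^+ (2 * l - 2) * p n ^+ (2 * l - 2)))
  (paths_l : forall k : nat, (1 <= k)%N -> exists K : R, forall n, I n ->
     \sum_(u < n) \sum_(v < n | v != u) (npaths (G n) l u v)%:R ^+ k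
       <= K * (n%:R ^+ (2 + k * (l - 1)) * p n ^+ (k * l)))
  (ka_kernel : is_kernel ka)
  (ka_le : forall x y, unit_itv x -> unit_itv y -> ka (x, y) <= C)
  (ka_lim : d_cut (graph_kernel (p n) (G n)) ka @[n --> within I \oo] --> 0%E) :
  forall (k : nat) (F : sgraph 'I_k), subdivided_class l F ->
    (emb_density (p n) F (G n))%:E @[n --> within I \oo] --> kernel_density F ka.
Proof.
move=> k F [V [E [H [phi [psi phiK psiK] iso]]]].
case: l l_ge3 paths_pred_l paths_l H phi psi phiK psiK iso => [//|m] m_ge2.
move=> [Q predQ] paths H phi psi phiK psiK iso.
pose C' := Num.max C 1.
(* enlarging C makes its powers monotone in the exponent *)
have C'1 : 1 <= C' by rewrite le_max lexx orbT.
have C'0 : 0 <= C' by lra.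
have ka_le' x y : unit_itv x -> unit_itv y -> ka (x, y) <= C'.
  by move=> x01 y01; rewrite le_max ka_le.
have [P pathsP] : {P : nat -> R & forall j, (0 < j)%N -> forall n, I n ->
    \sum_(u < n) \sum_(v < n | v != u) (npaths (G n) m.+1 u v)%:R ^+ j
      <= P j * (n%:R ^+ (2 + j * (m.+1 - 1)) * p n ^+ (j * m.+1))}.
  apply: (@choice _ _ (fun j K => (0 < j)%N -> forall n, I n -> _ <= K * _)) => j.
  have [->|j0] := posnP j; first by exists 0.
  by have [K hK] := paths j j0; exists K.
pose S j := fine (ereal_sup [set (emb_density (p n) (star j) (G n))%:E | n in I]).
have starS j n : I n -> emb_density (p n) (star j) (G n) <= S j.
  move=> In; rewrite -lee_fin fineK; first by apply: ereal_sup_ubound; exists n.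
  rewrite fin_numE; apply/andP; split; last by rewrite lt_eqF// tree_bound//; exact: star_is_tree.
  rewrite gt_eqF//; apply: lt_le_trans (ltNyr (emb_density (p n) (star j) (G n))) _.
  by apply: ereal_sup_ubound; exists n.
rewrite (kernel_density_expect ka_kernel C'0 ka_le').
set s := expect _ _.
apply: cvg_EFin; first exact: nearW.
rewrite (_ : fine \o _ = fun n => emb_density (p n) F (G n))//.
apply/cvgrPdist_le => eps eps0.
have e2 : 0 < eps / 2 by rewrite divr_gt0.
have [d1 d10 [N main]] := discrete_counting m_ge2 phiK psiK iso Q S P C'1 e2.
set B : R := #|ordered_edges F|%:R * (C' ^+ #|ordered_edges F| * (C' ^+ #|ordered_edges F| * 2)).
have B0 : 0 <= B by rewrite !mulr_ge0 ?exprn_ge0.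
have B10 : 0 < B + 1 by lra.
pose delta := Num.min d1 (eps / 2 / (B + 1)).
have delta0 : 0 < delta by rewrite lt_min d10 divr_gt0.
have close : \forall n \near within I \oo, (d_cut (graph_kernel (p n) (G n)) ka < delta%:E)%E.
  apply: (ka_lim [set x | (x < delta%:E)%E]).
  by apply: open_nbhs_nbhs; split; [exact: open_ereal_lt_ereal|rewrite /= lte_fin].
have large : \forall n \near within I \oo, (maxn N 1 <= n)%N.
  by apply: cvg_within; exact: nbhs_infty_ge.
have inI : \forall n \near within I \oo, I n by exact: withinT.
near=> n.
have In : I n by near: n.
have /andP[nN n0] : (N <= n)%N && (0 < n)%N by rewrite -geq_max; near: n.
have dn : (d_cut (graph_kernel (p n) (G n)) ka < delta%:E)%E by near: n.
have [K [KC Ksym cutK dens]] := discretize C'1 ka_kernel ka_le' n0 dn.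
have m_gt0 : (0 < m)%N by apply: leq_trans (m_ge2 : (2 <= m)%N).
have exp1 : (2 * m.+1 - 2 = 2 * m)%N by rewrite mulnS addKn.
have exp2 : (n%:R ^+ (2 * m) * p n ^+ (2 * m) = n%:R ^+ (2 + 2 * m.-1) * p n ^+ (2 * m) :> R)%R.
  by rewrite -mulnS prednK.
have regular : path_regular m Q S P (G n) (p n).
  split=> [j||j j0]; first exact: starS.
    apply: (path_density_moment (p_gt0 n In) m_gt0 (ltn0Sn 1) n0).
    by have := predQ n In; rewrite exp1 exp2.
  apply: (path_density_moment (p_gt0 n In) (ltn0Sn m) j0 n0).
  by have := pathsP j j0 n In; rewrite subn1.
have h1 : `|emb_density (p n) F (G n) -
    avg (fun g : {ffun 'I_k -> 'I_n} => edge_weight F K g)| <= eps / 2.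
  apply: main => //; first exact: p_gt0.
  by move=> T T'; apply: le_trans (cutK T T') _; rewrite ge_min lexx.
have h2 : `|s - avg (fun g : {ffun 'I_k -> 'I_n} => edge_weight F K g)| <= eps / 2.
  apply: le_trans (dens k F) _.
  have -> : #|ordered_edges F|%:R * (C' ^+ #|ordered_edges F| *
      (C' ^+ #|ordered_edges F| * (2 * delta))) = B * delta by rewrite /B; ring.
  apply: (@le_trans _ _ ((B + 1) * (eps / 2 / (B + 1)))).
    by apply: ler_pM => //; [exact: ltW|rewrite lerDl|rewrite ge_min lexx orbT].
  by rewrite mulrC divfK// gt_eqF.
move: h1 h2; rewrite !ler_norml; lra.
Unshelve. all: by end_near.
Qed.
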